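(* Let $k$ be a perfect field of characteristic $p>0$, let $C_0$ be a smooth affine curve over $k$, and let $G=\mu_d$ be a finite subgroup scheme of $T=\mathbb{G}_{\mathrm m}$, with $d\ge 2$. There is a one-to-one correspondence between (a) the set $\mathcal{E}_{\mathrm{aff}}$ of $G$-isomorphism classes of $G$-normal affine curves with quotient $C_0$; and (b) the set $\mathcal{S}_{\mathrm{aff}}$ of isomorphism classes of geometrically integral $\Phi$-pairs $(\mathfrak{D},\alpha)$ over $C_0$.
   Context: A variety is a separated, geometrically integral $k$-scheme of finite type; a curve is a variety of dimension 1. A $G$-curve $X$ is $G$-normal if every finite birational morphism of $G$-curves $X'\to X$ is an isomorphism; ''with quotient $C_0$'' means $X/G\simeq C_0$. Polyhedral divisors (rank one, tail cone $\{0\}$). The character and cocharacter lattices of $T$ are $M=N=\mathbb{Z}$. Let $\mathfrak{D}=\sum_{y}\Delta_y\otimes\{y\}$ be a formal sum over closed points $y\in C_0$, with each $\Delta_y\subset\mathbb{Q}$ a nonempty compact interval with rational endpoints (a polyhedron with tail cone $\{0\}$) and $\Delta_y=\{0\}$ for all but finitely many $y$. For $m\in\mathbb{Z}$ put $\mathfrak{D}(m)=\sum_y(\min_{v\in\Delta_y}mv)\,y$. Such a $\mathfrak{D}$ is a proper polyhedral divisor (pp-divisor) with tail cone $\{0\}$, written $\mathfrak{D}\in\mathrm{PPDiv}_{\mathbb{Q}}(C_0,\{0\})$ (the conditions that the $\mathfrak{D}(m)$ be semiample and big are automatic on an affine curve). Put $H^0(C_0,\mathcal{O}(\mathfrak{D}(m)))=\{h\in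 k(C_0): h=0\text{ or }\operatorname{div}(h)+\lfloor\mathfrak{D}(m)\rfloor\ge 0\}$ and let $A[C_0,\mathfrak{D}]=\bigoplus_{m\in\mathbb{Z}}H^0(C_0,\mathcal{O}(\mathfrak{D}(m)))$ be the $\mathbb{Z}$-graded algebra with multiplication induced from $k(C_0)$. $\Phi$-pairs. Let $G\text{-}\mathrm{PPDiv}_{\mathbb{Q}}(C_0,\{0\})$ be the set of $\mathfrak{D}\in\mathrm{PPDiv}_{\mathbb{Q}}(C_0,\{0\})$ such that $A[C_0,\mathfrak{D}]$ has homogeneous units of degree $d$ and of degree $-d$. For such $\mathfrak{D}$, a $\Phi$-structure on $\mathfrak{D}$ is an element $\alpha\in A[C_0,\mathfrak{D}]^{*}\cap H^0(C_0,\mathcal{O}(\mathfrak{D}(d)))$, i.e. a unit of $A[C_0,\mathfrak{D}]$ homogeneous of degree $d$; then $(\mathfrak{D},\alpha)$ is called a $\Phi$-pair over $C_0$. The pair is integral if $\alpha$ is not a power (with exponent $\ge 2$) of some homogeneous element of $A[C_0,\mathfrak{D}]$, and geometrically integral if for every algebraic extension $K/k$ the base-changed pair $(\mathfrak{D}_K,\alpha_K)$ is integral. Isomorphisms. An isomorphism $(\psi,\mathfrak{f})\colon\mathfrak{D}_1\to\mathfrak{D}_2$ of pp-divisors on $C_0$ consists of an automorphism $\psi$ of $C_0$ and a plurifunction $\mathfrak{f}=\sum n_i\otimes f_i\in\mathbb{Z}\otimes k(C_0)^*$ with $\psi^*\mathfrak{D}_2=\mathfrak{D}_1+\operatorname{div}(\mathfrak{f})$,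 where $\operatorname{div}(\mathfrak f)=\sum\{n_i\}\otimes\operatorname{div}(f_i)$ and coefficients are added by Minkowski sum; $\mathfrak{f}(m):=\prod f_i^{n_im}$. Two $\Phi$-pairs $(\mathfrak{D}_1,\alpha_1)$, $(\mathfrak{D}_2,\alpha_2)$ are isomorphic if there is an isomorphism $(\psi,\mathfrak{f})\colon\mathfrak{D}_1\to\mathfrak{D}_2$ such that $\alpha_1/\psi^*(\alpha_2)=\mathfrak{f}(d)=f^d$ for some $f\in k[C_0]^*$.
   Formalization: In the definition of isomorphic Φ-pairs, f ranges over k(C_0)^* instead of k[C_0]^*, and the G-action on the curves in (a) is required to be faithful; without these, the correspondence given by A[C_0,D]/(α-1) fails. *)

(* Defs.v *)
From HB Require Import structures.
From mathcomp Require Import all_boot all_order all_algebra.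
From mathcomp Require Import boolp classical_sets cardinality.

Set Implicit Arguments.
Unset Strict Implicit.
Unset Printing Implicit Defensive.

Import Order.TTheory GRing.Theory Num.Theory.
Local Open Scope ring_scope.
Local Open Scope classical_set_scope.

Notation tofrac := (@FracField.tofrac _).

Definition is_ideal (R : comNzRingType) (I : set R) : Prop :=
  [/\ I 0, forall a b, I a -> I b -> I (a + b) & forall a b, I b -> I (a * b)].

Definition prime_ideal (R : comNzRingType) (I : set R) : Prop :=
  [/\ is_ideal I, ~ I 1 & forall a b, I (a * b) -> I a \/ I b].

Definition maximal_ideal (R : comNzRingType) (I : set R) : Prop :=
  [/\ is_ideal I, ~ I 1 &
      forall J, is_ideal J -> I `<=` J -> J = I \/ J = setT].

Definition krull_dim1 (R : comNzRingType) : Prop :=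
  (exists P Q : set R, [/\ prime_ideal P, prime_ideal Q & P `<` Q]) /\
  ~ (exists P Q S : set R,
       [/\ prime_ideal P, prime_ideal Q, prime_ideal S, P `<` Q & Q `<` S]).

Definition integral_domain (R : comNzRingType) : Prop :=
  forall a b : R, a * b = 0 -> a = 0 \/ b = 0.

(* The map on fraction fields induced by [phi]; meaningful only for injective
   [phi]. *)
Definition frac_map (R S : idomainType) (phi : {rmorphism R -> S})
    (x : {fraction R}) : {fraction S} :=
  tofrac (phi (\n_(repr x))) / tofrac (phi (\d_(repr x))).

(* [B], with [jA] and [jC], is the tensor product of [A] and [C] over [k], by
   its universal property (pushout of commutative rings). *)
Definition is_tensor_product (k A C B : comNzRingType)
    (iA : {rmorphism k -> A}) (iC : {rmorphism k -> C})
    (jA : {rmorphism A -> B}) (jC : {rmorphism C -> B}) : Prop :=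
  (forall c, jA (iA c) = jC (iC c)) /\
  forall (E : comNzRingType) (f : {rmorphism A -> E}) (g : {rmorphism C -> E}),
    (forall c, f (iA c) = g (iC c)) ->
    exists h : {rmorphism B -> E},
      [/\ forall a, h (jA a) = f a, forall c, h (jC c) = g c &
          forall h' : {rmorphism B -> E},
            (forall a, h' (jA a) = f a) -> (forall c, h' (jC c) = g c) ->
            forall b, h' b = h b].

Definition perfect_field (p : nat) (k : fieldType) : Prop :=
  p \in [pchar k] /\ forall x : k, exists y : k, y ^+ p = x.

Definition algebraic_extension (k K : fieldType) (i : {rmorphism k -> K}) :
  Prop := forall x : K, algebraicOver i x.

(* An integral affine [k]-scheme [Spec A]. *)
Record affine_scheme (k : fieldType) := AffineScheme {
  coord_ring :> idomainType;
  structure_map : {rmorphism k -> coord_ring} }.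

Section AffineCurves.
Variable k : fieldType.
Implicit Types A B : affine_scheme k.

Definition finite_type A : Prop :=
  exists s : seq A, forall S : set A,
    (forall c, S (structure_map A c)) ->
    (forall a b, S a -> S b -> S (a - b)) ->
    (forall a b, S a -> S b -> S (a * b)) ->
    (forall a, a \in s -> S a) -> S = setT.

Definition geometrically_integral A : Prop :=
  forall (K : fieldType) (i : {rmorphism k -> K}) (B : comNzRingType)
    (jA : {rmorphism A -> B}) (jK : {rmorphism K -> B}),
    is_tensor_product (structure_map A) i jA jK -> integral_domain B.

Definition affine_curve A : Prop :=
  [/\ finite_type A, geometrically_integral A & krull_dim1 A].

(* A morphism [Spec B -> Spec A] over [k], through its comorphism. *)
Definition k_hom A B (phi : {rmorphism A -> B}) : Prop :=
  forall c, phi (structure_map A c) = structure_map B c.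

Definition finite_hom A B (phi : {rmorphism A -> B}) : Prop :=
  exists s : seq B, forall b : B, exists c : nat -> A,
    b = \sum_(i < size s) phi (c i) * s`_i.

Definition birational_hom A B (phi : {rmorphism A -> B}) : Prop :=
  injective phi /\ bijective (frac_map phi).

End AffineCurves.

Section Orders.
Variable R : idomainType.
Implicit Types (y : set R) (h pi : {fraction R}).

Definition local_ring y : set {fraction R} :=
  [set h | exists a s : R, ~ y s /\ h = tofrac a / tofrac s].

Definition local_max y : set {fraction R} :=
  [set h | exists a s : R, [/\ y a, ~ y s & h = tofrac a / tofrac s]].

Definition uniformizer y pi : Prop :=
  local_max y pi /\
  forall h, local_max y h -> exists2 u, local_ring y u & h = u * pi.

(* The order at [y] of [h != 0], when the local ring at [y] is a discrete
   valuation ring. *)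
Definition ord y h : int :=
  xget 0 [set n : int | exists pi u, [/\ uniformizer y pi, u != 0,
                          local_ring y u, local_ring y u^-1 & h = u * pi ^ n]].

End Orders.

(* Smooth = geometrically regular.  For a curve the local rings at closed points
   have dimension 1, so they are regular iff their maximal ideal is generated by
   one element. *)
Definition smooth_curve (k : fieldType) (A : affine_scheme k) : Prop :=
  affine_curve A /\
  forall (K : fieldType) (i : {rmorphism k -> K}) (B : idomainType)
    (jA : {rmorphism A -> B}) (jK : {rmorphism K -> B}),
    is_tensor_product (structure_map A) i jA jK ->
    forall y : set B, maximal_ideal y -> exists pi, uniformizer y pi.

(* An action of [mu_d = Spec k[t]/(t^d - 1)] on [Spec A], as a coaction
   [a |-> \sum_i coact i a (x) t^i] written in the basis [(t^i)_(i < d)]. *)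
Record mu_action (d : nat) (k : fieldType) (A : affine_scheme k) := MuAction {
  coact :> 'I_d -> A -> A;
  coactD : forall i a b, coact i (a + b) = coact i a + coact i b;
  coactZ : forall i c a,
    coact i (structure_map A c * a) = structure_map A c * coact i a;
  coact1 : forall i, coact i 1 = (i == 0 :> nat)%:R;
  coactM : forall (n : 'I_d) a b, coact n (a * b) =
    \sum_(i < d) \sum_(j < d | ((i + j) %% d == n)%N) coact i a * coact j b;
  coact_counit : forall a, \sum_(i < d) coact i a = a;
  coact_coassoc : forall i j a,
    coact i (coact j a) = if i == j then coact i a else 0 }.

Record mu_curve (d : nat) (k : fieldType) := MuCurve {
  mu_scheme :> affine_scheme k;
  mu_curveP : affine_curve mu_scheme;
  mu_act : mu_action d mu_scheme }.

Section MuCurves.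
Variables (d : nat) (k : fieldType).
Implicit Types X Y : mu_curve d k.

Definition equivariant X Y (phi : {rmorphism X -> Y}) : Prop :=
  forall i a, phi (mu_act X i a) = mu_act Y i (phi a).

Definition mu_isomorphic X Y : Prop :=
  exists phi : {rmorphism X -> Y},
    [/\ k_hom phi, equivariant phi & bijective phi].

(* For [e %| d], the coaction of the subgroup [mu_e] is obtained by reducing the
   exponents of [t] modulo [e]; it is trivial iff its component of exponent 0 is
   the identity. *)
Definition subgroup_acts_trivially X (e : nat) : Prop :=
  forall a, \sum_(i < d | (e %| i)%N) mu_act X i a = a.

(* The subgroup schemes of [mu_d] are the [mu_e], [e %| d]. *)
Definition faithful X : Prop :=
  forall e, (e %| d)%N -> subgroup_acts_trivially X e -> e = 1%N.

(* A scheme that is finite over an affine one is affine, so affine [X'] suffice. *)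
Definition mu_normal X : Prop :=
  forall (X' : mu_curve d k) (phi : {rmorphism X -> X'}),
    k_hom phi -> equivariant phi -> finite_hom phi -> birational_hom phi ->
    bijective phi.

Definition invariant X (a : X) : Prop :=
  forall i, mu_act X i a = if i == 0 :> nat then a else 0.

(* [X / mu_d] is the spectrum of the ring of invariants. *)
Definition has_quotient (C0 : affine_scheme k) X : Prop :=
  exists phi : {rmorphism C0 -> X},
    [/\ k_hom phi, injective phi & range phi = [set a | invariant a]].

End MuCurves.

(* A nonempty compact interval of [rat] with rational endpoints. *)
Record interval_Q := IntervalQ {
  lower : rat; upper : rat; lower_upper : lower <= upper }.

(* The minimum of [v |-> m * v] on the interval, reached at an endpoint. *)
Definition interval_min (m : int) (I : interval_Q) : rat :=
  Num.min (m%:~R * lower I) (m%:~R * upper I).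

Section IntervalOps.
Implicit Type I : interval_Q.

Fact translate_proof (n : int) I : lower I + n%:~R <= upper I + n%:~R.
Proof. by rewrite lerD2r lower_upper. Qed.
(* Minkowski sum with the point [{n}]. *)
Definition translate n I := IntervalQ (translate_proof n I).

Fact dilate_proof (e : nat) I : e%:R * lower I <= e%:R * upper I.
Proof. by rewrite ler_wpM2l ?ler0n ?lower_upper. Qed.
Definition dilate e I := IntervalQ (dilate_proof e I).

End IntervalOps.

(* Only the values at maximal ideals, i.e. at closed points, are relevant. *)
Definition polyhedral_divisor (R : idomainType) := set R -> interval_Q.

Section PolyhedralDivisors.
Variable R : idomainType.
Implicit Types (D : polyhedral_divisor R) (h : {fraction R}) (m : int).

Definition ppdivisor D : Prop :=
  finite_set [set y : set R | maximal_ideal y /\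
                              ~ (lower (D y) = 0 /\ upper (D y) = 0)].

(* The coefficient at [y] of the Q-divisor [D(m)]. *)
Definition ppeval D m (y : set R) : rat := interval_min m (D y).

Definition H0 D m : set {fraction R} :=
  [set h | h = 0 \/ forall y, maximal_ideal y ->
                      0 <= ord y h + Num.floor (ppeval D m y)].

(* [A[C_0, D]] is realized inside [k(C_0)(t)]: the element [h] of degree [m] is
   represented by [h * t ^ m]. *)
Definition monomial h m : {fraction {poly {fraction R}}} :=
  tofrac h%:P * tofrac 'X ^ m.

Definition algebra_of D : set {fraction {poly {fraction R}}} :=
  [set x | exists (s : seq int) (h : int -> {fraction R}),
     (forall m, H0 D m (h m)) /\ x = \sum_(m <- s) monomial (h m) m].

Definition unit_of_algebra D (x : {fraction {poly {fraction R}}}) : Prop :=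
  algebra_of D x /\ exists2 x', algebra_of D x' & x * x' = 1.

Definition homogeneous_unit D m h : Prop :=
  H0 D m h /\ unit_of_algebra D (monomial h m).

Definition G_ppdivisor (d : nat) D : Prop :=
  [/\ ppdivisor D, exists h, homogeneous_unit D d%:Z h &
      exists h, homogeneous_unit D (- d%:Z) h].

Definition Phi_structure (d : nat) D (alpha : {fraction R}) : Prop :=
  homogeneous_unit D d%:Z alpha.

Definition integral_pair (d : nat) D (alpha : {fraction R}) : Prop :=
  ~ exists (e : nat) m h,
      [/\ (2 <= e)%N, H0 D m h & monomial alpha d%:Z = monomial h m ^+ e].

(* An element [\sum n_i (x) f_i] of [Z (x) k(C_0)^*]. *)
Definition plurifunction := seq (int * {f : {fraction R} | f != 0}).

Definition pluri_eval (F : plurifunction) m : {fraction R} :=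
  \prod_(nf <- F) sval nf.2 ^ (nf.1 * m).

Definition pluri_ord (F : plurifunction) (y : set R) : int :=
  \sum_(nf <- F) nf.1 * ord y (sval nf.2).

End PolyhedralDivisors.

Section Pullback.
Variables (R S : idomainType) (phi : {rmorphism R -> S}).

(* Ramification index at the point [z] of [Spec S -> Spec R]. *)
Definition ramification (z : set S) : nat :=
  xget 0%N [set e : nat | exists pi, uniformizer (phi @^-1` z) pi /\
                                     ord z (frac_map phi pi) = e%:Z].

Definition pullback (D : polyhedral_divisor R) : polyhedral_divisor S :=
  fun z => dilate (ramification z) (D (phi @^-1` z)).

End Pullback.

Definition geometrically_integral_pair (k : fieldType) (C0 : affine_scheme k)
    (d : nat) (D : polyhedral_divisor C0) (alpha : {fraction C0}) : Prop :=
  forall (K : fieldType) (i : {rmorphism k -> K}), algebraic_extension i ->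
  forall (B : idomainType) (j : {rmorphism C0 -> B}) (jK : {rmorphism K -> B}),
    is_tensor_product (structure_map C0) i j jK ->
    integral_pair d (pullback j D) (frac_map j alpha).

Record Phi_pair (d : nat) (k : fieldType) (C0 : affine_scheme k) := PhiPair {
  pair_divisor : polyhedral_divisor C0;
  pair_unit : {fraction C0};
  pair_divisorP : G_ppdivisor d pair_divisor;
  pair_unitP : Phi_structure d pair_divisor pair_unit }.

Section PhiPairs.
Variables (k : fieldType) (C0 : affine_scheme k).

Definition ppdivisor_iso (D1 D2 : polyhedral_divisor C0)
    (psi : {rmorphism C0 -> C0}) (F : plurifunction C0) : Prop :=
  [/\ k_hom (A := C0) (B := C0) psi, bijective psi &
      forall y, maximal_ideal y ->
        pullback psi D2 y = translate (pluri_ord F y) (D1 y)].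

(* [f] ranges over [k(C_0)^*]: since [F] is [1 (x) g] with [g ^+ d = f ^+ d],
   requiring [f] to be in [k[C_0]^*] would force [div F = 0].  It would separate
   [(D, alpha)] from [(D + div g, g ^- d * alpha)] when [div g != 0], although
   multiplication by [g ^ m] in degree [m] is an isomorphism from
   [A[C_0, D + div g]] to [A[C_0, D]] that matches the two units. *)
Definition Phi_isomorphic (d : nat) (P1 P2 : Phi_pair d C0) : Prop :=
  exists (psi : {rmorphism C0 -> C0}) (F : plurifunction C0),
    ppdivisor_iso (pair_divisor P1) (pair_divisor P2) psi F /\
    exists f : {fraction C0}, [/\ f != 0,
      pair_unit P1 / frac_map psi (pair_unit P2) = pluri_eval F d%:Z &
      pluri_eval F d%:Z = f ^+ d].

End PhiPairs.

Definition iso_classes (T : Type) (P : T -> Prop) (iso : T -> T -> Prop) :=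
  {c : T -> Prop | exists2 x, P x & c = (fun x' => P x' /\ iso x x')}.

Definition E_aff (d : nat) (k : fieldType) (C0 : affine_scheme k) :=
  iso_classes (fun X : mu_curve d k =>
                 [/\ faithful X, mu_normal X & has_quotient C0 X])
              (@mu_isomorphic d k).

Definition S_aff (d : nat) (k : fieldType) (C0 : affine_scheme k) :=
  iso_classes (fun P : Phi_pair d C0 =>
                 geometrically_integral_pair d (pair_divisor P) (pair_unit P))
              (@Phi_isomorphic k C0 d).

(* Main.v *)
(** Both sides are classified by radicands.  Let [R] be the coordinate ring of
    the smooth curve [C0] and [F] its fraction field.

    The coaction of [mu_d] on a curve [X] with quotient [C0] is a grading of its
    ring by [Z/d] whose part of degree 0 is [R].  If the action is faithful, there
    is some [s <> 0] of degree 1, and [s ^ d = r] for some [r] in [R].  Since [R]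
    is integrally closed, [X] is normal iff each graded piece consists of all the
    [h s ^ i], [h] in [F], that are integral over [R]; hence [r] determines [X],
    and two radicands give isomorphic curves iff they are related by an
    automorphism of [C0] and a factor in [F ^ d].

    On the other side, the two homogeneous units of degrees [d] and [- d] force
    [D = - div(alpha) / d], so a pair is the same thing as [alpha], and [alpha]
    corresponds to the radicand [alpha ^ -1].

    Finally [X] is geometrically integral iff [r] is not an [e]-th power,
    [1 < e | d], in [Frac (R (x) k')] for any algebraic extension [k'] of [k].
    An [e]-th root of [r] makes [s ^ d - r] reducible.  Conversely, by
    specialization, [r] has no root over any extension [K] of [k] whatsoever;
    enlarging [K] so that it contains the [d]-th roots of unity, [X ^ d - r] is
    irreducible over [Frac (R (x) K)], and [X (x) K] embeds in the field that it
    defines. *)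

From HB Require Import structures.
From mathcomp Require Import all_boot all_order all_algebra all_field.
From mathcomp Require Import boolp classical_sets cardinality.
From mathcomp Require Import ring.
Require Import Defs.

Set Implicit Arguments.
Unset Strict Implicit.
Unset Printing Implicit Defensive.

Import Order.TTheory GRing.Theory Num.Theory.
Local Open Scope ring_scope.
Local Open Scope classical_set_scope.

(** * Morphisms and fractions *)

(** Three obstacles shape the proof. [is_tensor_product] is a universal property and says nothing
    about elements, while integrality after base change is a statement about elements. They are
    reached by comparison with an explicit model, in which a sum of pure tensors is tested for
    nullity by contracting it with every linear functional on the left factor. This needs no basis,
    and contractions commute with a change of scalars, in particular with a specialization. The
    characteristic may divide [d]. Then ['X^d - r] is inseparable and the trace form degenerates.
    Irreducibility is therefore read off the constant terms of factors, the roots of unity being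
    counted with multiplicity; having them in the field also removes exceptions such as ['X^4 + 4],
    which is reducible even where -4 is no square. Finiteness of the normal curve over [C0] comes
    from Noetherianity, each graded piece being isomorphic to an ideal of [R]. Curves must stay
    integral over all extensions of [k], pairs only over the algebraic ones; a specialization to
    algebraic scalars that keeps a chosen denominator nonzero closes this gap. *)

Section PackMorphism.
Variables (R S : nzRingType) (f : R -> S).

Definition pack_rmorphism of zmod_morphism f & monoid_morphism f := f.

Hypotheses (fB : zmod_morphism f) (fM : monoid_morphism f).

HB.instance Definition _ :=
  GRing.isZmodMorphism.Build R S (pack_rmorphism fB fM) fB.
HB.instance Definition _ :=
  GRing.isMonoidMorphism.Build R S (pack_rmorphism fB fM) fM.

(** Bundles a map obtained by choice or on representatives once its laws are proved; the existential
    keeps the wrapper out of later goals. *)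
Lemma rmorphism_ex : exists g : {rmorphism R -> S}, g =1 f.
Proof. by exists (pack_rmorphism fB fM). Qed.

End PackMorphism.

Lemma rmorphism_inverse (R S : nzRingType) (f : {rmorphism R -> S}) :
  bijective f -> exists g : {rmorphism S -> R}, cancel f g /\ cancel g f.
Proof.
case=> g fK gK.
have [|| g' g'E] := @rmorphism_ex _ _ g.
- by move=> x y; apply: (can_inj fK); rewrite rmorphB !gK.
- split; first by apply: (can_inj fK); rewrite rmorph1 gK.
  by move=> x y; apply: (can_inj fK); rewrite rmorphM !gK.
by exists g'; split=> x; rewrite g'E.
Qed.

Section DomainOf.
Variables (B : comNzRingType) (domB : integral_domain B).

(** [integral_domain] is a property of a ring, whereas [{fraction _}] wants an [idomainType]. The
    alias carries the proof, so that an inverse chosen classically can be attached to it. *)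
Definition domain_of of integral_domain B : Type := B.

HB.instance Definition _ := GRing.ComNzRing.on (domain_of domB).

Let unit_pred : pred (domain_of domB) := fun x => `[< exists y, y * x = 1 >].
Let inverse (x : domain_of domB) : domain_of domB :=
  if pselect (exists y, y * x = 1) is left e then projT1 (cid e) else x.

Fact domain_of_mulVx : {in unit_pred, left_inverse 1 inverse *%R}.
Proof.
move=> x /asboolP e; rewrite /inverse; case: pselect => // e'.
exact: (projT2 (cid e')).
Qed.

Fact domain_of_unitPl : forall x y : domain_of domB, y * x = 1 -> unit_pred x.
Proof. by move=> x y e; apply/asboolP; exists y. Qed.

Fact domain_of_inv_out : {in [predC unit_pred], inverse =1 id}.
Proof.
move=> x; rewrite inE => /asboolP e; rewrite /inverse; by case: pselect.
Qed.

HB.instance Definition _ := GRing.ComNzRing_hasMulInverse.Build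
  (domain_of domB) domain_of_mulVx domain_of_unitPl domain_of_inv_out.

Fact domain_of_mulf_eq0 :
  forall x y : domain_of domB, x * y = 0 -> (x == 0) || (y == 0).
Proof. by move=> x y /domB[->|->]; rewrite eqxx ?orbT. Qed.

HB.instance Definition _ := GRing.ComUnitRing_isIntegral.Build
  (domain_of domB) domain_of_mulf_eq0.

End DomainOf.

Lemma tofrac_inj (R : idomainType) : injective (@FracField.tofrac R).
Proof. by move=> a b /eqP; rewrite tofrac_eq => /eqP. Qed.

Lemma frac_repr (R : idomainType) (x : {fraction R}) :
  x = tofrac (\n_(repr x)) / tofrac (\d_(repr x)).
Proof.
apply: (canRL (mulfK _)); first by rewrite tofrac_eq0 denom_ratioP.
have mulE (r : {ratio R}) : (\pi_({fraction R}) r)%qT * tofrac \d_r = tofrac \n_r.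
  rewrite !piE; apply/eqmodP; rewrite /= FracField.equivfE /FracField.mulf /=.
  by rewrite !numden_Ratio ?mulf_neq0 ?oner_eq0 ?denom_ratioP // !mulr1 mulrC.
by rewrite -[RHS]mulE reprK.
Qed.

Lemma fracP (R : idomainType) (x : {fraction R}) :
  exists a b : R, b != 0 /\ x = tofrac a / tofrac b.
Proof.
exists (\n_(repr x)), (\d_(repr x)); split; first exact: denom_ratioP.
exact: frac_repr.
Qed.

Lemma frac_eq (R : idomainType) (a b c e : R) : b != 0 -> e != 0 ->
  tofrac a / tofrac b = tofrac c / tofrac e <-> a * e = c * b.
Proof.
move=> b0 e0; split=> [/eqP|h].
  by rewrite eqr_div ?tofrac_eq0 // -!tofracM => /eqP/tofrac_inj.
by apply/eqP; rewrite eqr_div ?tofrac_eq0 // -!tofracM h.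
Qed.

Lemma rmorph_neq0 (R S : nzRingType) (f : {rmorphism R -> S}) (a : R) :
  injective f -> a != 0 -> f a != 0.
Proof. by move=> injf; apply: contraNneq => fa0; apply/eqP/injf; rewrite fa0 rmorph0. Qed.

Section FracExtension.
Variables (R : idomainType) (E : fieldType) (phi : {rmorphism R -> E}).
Hypothesis phi_inj : injective phi.

Let ext (x : {fraction R}) : E := phi (\n_(repr x)) / phi (\d_(repr x)).

Let extE a b : b != 0 -> ext (tofrac a / tofrac b) = phi a / phi b.
Proof.
move=> b0; rewrite /ext; set x := tofrac a / tofrac b.
have [d0 e] : \d_(repr x) != 0 /\ x = tofrac (\n_(repr x)) / tofrac (\d_(repr x)).
  split; first exact: denom_ratioP.
  exact: frac_repr.
apply/eqP; rewrite eqr_div ?(rmorph_neq0 phi_inj) // -!rmorphM.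
by rewrite ((frac_eq _ _ d0 b0).1 (esym e)).
Qed.

(** The value does not depend on the representative, by [frac_eq]. The explicit formula is kept
    because, for [tofrac \o phi], it is that of [frac_map], which thereby becomes a morphism. *)
Lemma frac_extension : exists Phi : {rmorphism {fraction R} -> E},
  Phi =1 (fun x => phi (\n_(repr x)) / phi (\d_(repr x))) /\
  forall a, Phi (tofrac a) = phi a.
Proof.
have extF a : ext (tofrac a) = phi a.
  by rewrite -[tofrac a]divr1 -tofrac1 extE ?oner_eq0 // rmorph1 divr1.
have [|| Phi PhiE] := @rmorphism_ex _ _ ext.
- move=> x y; have [a [b [b0 ->]]] := fracP x.
  have [c [e [e0 ->]]] := fracP y.
  rewrite -mulNr addf_div ?tofrac_eq0 // -rmorphN -!rmorphM -rmorphD.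
  rewrite !extE ?mulf_neq0 // -[in RHS]mulNr addf_div ?(rmorph_neq0 phi_inj) //.
  by rewrite -rmorphN -!rmorphM -rmorphD.
- split; first by rewrite -tofrac1 extF rmorph1.
  move=> x y; have [a [b [b0 ->]]] := fracP x.
  have [c [e [e0 ->]]] := fracP y.
  by rewrite mulf_div -!rmorphM !extE ?mulf_neq0 // mulf_div !rmorphM.
by exists Phi; split=> [x|a]; rewrite PhiE.
Qed.

End FracExtension.

Lemma frac_map_morphism (R S : idomainType) (phi : {rmorphism R -> S}) :
  injective phi ->
  exists Phi : {rmorphism {fraction R} -> {fraction S}},
    Phi =1 frac_map phi /\ forall a, Phi (tofrac a) = tofrac (phi a).
Proof.
move=> phi_inj; pose phi' := (@FracField.tofrac S) \o phi.
exact: (frac_extension (phi := phi')) (inj_comp (@tofrac_inj S) phi_inj).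
Qed.

(** * Linear functionals *)

(** [Zorn_bigcup] also asks for the union of the empty chain. Adding the empty set to [P] provides
    it, and a maximal element that is empty must equal [W]. *)
Lemma Zorn_nonempty (T : Type) (P : set (set T)) (W : set T) : P W ->
  (forall F : set (set T), F `<=` P -> total_on F subset -> F !=set0 ->
     P (\bigcup_(X in F) X)) ->
  exists A, P A /\ forall B, A `<=` B -> P B -> B = A.
Proof.
move=> PW Pchain.
have [F FP' totF|A [P'A maxA]] :=
    Zorn_bigcup (P := [set U : set T | U = set0 \/ P U]).
  have [F0|F0] := pselect ((F `&` P) !=set0); last first.
    left; rewrite -subset0 => x [X FX Xx]; case: (FP' X FX) => [X0|PX].
      by rewrite -X0.
    by case: F0; exists X.
  right; suff -> : \bigcup_(X in F) X = \bigcup_(X in F `&` P) X.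
    by apply: Pchain => [X []//|X Y [FX _] [FY _]|//]; exact: totF.
  apply/seteqP; split=> x [X FX Xx]; last by exists X => //; case: FX.
  by case: (FP' X FX) => [X0|PX]; [rewrite X0 in Xx|exists X].
have maxA' B : A `<=` B -> P B -> B = A.
  move=> AB PB; apply: contrapT => BA; apply: (maxA B); last by right.
  by rewrite properEneq; split=> //; apply/eqP => AB'; apply: BA.
exists A; split=> //; case: P'A => // A0; suff <- : W = A by [].
by apply: maxA' => //; rewrite A0.
Qed.

Section LinearFunctionals.
Variables (k : fieldType) (V : comNzRingType) (i : {rmorphism k -> V}).

Definition subspace (W : set V) : Prop :=
  W 0 /\ forall c a b, W a -> W b -> W (i c * a + b).

Definition functional (lam : V -> k) : Prop :=
  (forall a b, lam (a + b) = lam a + lam b) /\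
  (forall c a, lam (i c * a) = c * lam a).

Lemma functional0 lam : functional lam -> lam 0 = 0.
Proof. by case=> _ h; rewrite -(mulr0 (i 0)) h mul0r. Qed.

Lemma functionalN lam a : functional lam -> lam (- a) = - lam a.
Proof. by case=> _ h; rewrite -mulN1r -(rmorph1 i) -rmorphN h mulN1r. Qed.

Lemma functional_sum lam (I : Type) (s : seq I) (P : pred I) (F : I -> V) :
  functional lam -> lam (\sum_(j <- s | P j) F j) = \sum_(j <- s | P j) lam (F j).
Proof.
move=> h; apply: (big_morph lam); [exact: h.1|exact: functional0].
Qed.

Lemma subspaceB W a b : subspace W -> W a -> W b -> W (a - b).
Proof.
by case=> _ h Wa Wb; rewrite addrC -mulN1r -(rmorph1 i) -rmorphN; apply: h.
Qed.

Lemma subspaceZ W c a : subspace W -> W a -> W (i c * a).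
Proof. by case=> W0 h Wa; rewrite -[_ * _]addr0; apply: h. Qed.

(** A subspace [U] maximal among those that contain [W] and miss [v] is a complement of the line of
    [v]; the functional is the coordinate along [v]. *)
Lemma separating_functional (W : set V) v : subspace W -> ~ W v ->
  exists lam, [/\ functional lam, lam v = 1 & forall w, W w -> lam w = 0].
Proof.
move=> subW Wv.
have [||U [[subU WU Uv] maxU]] :=
  @Zorn_nonempty _ [set U | [/\ subspace U, W `<=` U & ~ U v]] W.
- by split.
- move=> F FP totF [X0 FX0]; split.
  + split=> [|c a b [X FX Xa] [Y FY Yb]].
      by exists X0 => //; have [[]] := FP _ FX0.
    have [XY|YX] := totF _ _ FX FY.
      by exists Y => //; have [[_ h] _ _] := FP _ FY; apply: h => //; apply: XY.
    by exists X => //; have [[_ h] _ _] := FP _ FX; apply: h => //; apply: YX.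
  + by move=> w Ww; exists X0 => //; have [_ h _] := FP _ FX0; apply: h.
  + by case=> X FX Xv; have [_ _ h] := FP _ FX.
(* If [x] is not in [U], the span of [U] and [x] contains [v] by maximality, and that relation is
   solved for [x] modulo [U]. *)
have dec x : exists c, U (x - i c * v).
  have [Ux|Ux] := pselect (U x); first by exists 0; rewrite rmorph0 mul0r subr0.
  pose U' := [set y | exists c u, U u /\ y = i c * x + u].
  have subU' : subspace U'.
    split=> [|c _ _ [c1 [u1 [Uu1 ->]]] [c2 [u2 [Uu2 ->]]]].
      by exists 0, 0; rewrite rmorph0 mul0r addr0; split=> //; case: subU.
    exists (c * c1 + c2), (i c * u1 + u2); split; first exact: subU.2.
    by rewrite rmorphD rmorphM mulrDr mulrDl mulrA addrACA.
  have UU' : U `<=` U'.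
    by move=> u Uu; exists 0, u; rewrite rmorph0 mul0r add0r.
  have U'v : U' v.
    apply: contrapT => U'v; apply: Ux; rewrite -(maxU U') //.
      by exists 1, 0; rewrite rmorph1 mul1r addr0; split=> //; case: subU.
    by split=> //; apply: subset_trans UU'.
  have [c [u [Uu vE]]] := U'v.
  have c0 : c != 0.
    by apply/eqP => c0; apply: Uv; rewrite vE c0 rmorph0 mul0r add0r.
  exists c^-1; rewrite vE mulrDr mulrA -rmorphM mulVf // rmorph1 mul1r.
  rewrite opprD addrA subrr add0r -mulNr -rmorphN; exact: subspaceZ.
have uniq x c1 c2 : U (x - i c1 * v) -> U (x - i c2 * v) -> c1 = c2.
  move=> h1 h2; apply: contrapT => /eqP; rewrite -subr_eq0 => c12; apply: Uv.
  have := subspaceZ (c1 - c2)^-1 subU (subspaceB subU h2 h1).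
  rewrite (_ : x - _ - _ = i (c1 - c2) * v); last by rewrite rmorphB; ring.
  by rewrite mulrA -rmorphM mulVf // rmorph1 mul1r.
exists (fun x => projT1 (cid (dec x))); split.
- split=> [a b|c a].
    case: cid => e /= h; case: cid => e1 /= h1; case: cid => e2 /= h2.
    apply: uniq h _; have [_ subD] := subU; have := subD 1 _ _ h1 h2.
    by congr U; rewrite rmorphD rmorph1; ring.
  case: cid => e /= h; case: cid => e1 /= h1; apply: uniq h _.
  by have := subspaceZ c subU h1; congr U; rewrite rmorphM; ring.
- case: cid => e /= h; apply: (uniq _ _ _ h).
  by rewrite rmorph1 mul1r subrr; case: subU.
- move=> w Ww; case: cid => e /= h; apply: (uniq _ _ _ h).
  by rewrite rmorph0 mul0r subr0; apply: WU.
Qed.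

End LinearFunctionals.

(** With [lam b = 1], the extension is a functional that is 1 at [f b] and kills the image of the
    kernel of [lam]. The map [f] is only linear, since it will be multiplication by an element. *)
Lemma functional_extension (k : fieldType) (V V' : comNzRingType)
    (i : {rmorphism k -> V}) (i' : {rmorphism k -> V'}) (f : V -> V') :
    injective f -> (forall a b, f (a + b) = f a + f b) ->
    (forall c a, f (i c * a) = i' c * f a) ->
  forall lam, functional i lam ->
    exists2 lam', functional i' lam' & forall a, lam' (f a) = lam a.
Proof.
move=> injf fD fZ lam lamP.
have [[a0 la0]|/forallNP lam0] := pselect (exists a, lam a <> 0); last first.
  exists (fun=> 0); first by split=> *; rewrite ?addr0 ?mulr0.
  by move=> a; have /contrapT := lam0 a.
have {}la0 : lam a0 != 0 by apply/eqP.
pose b := i (lam a0)^-1 * a0.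
have lb : lam b = 1 by rewrite lamP.2 mulVf.
have f0 : f 0 = 0 by apply: (addrI (f 0)); rewrite -fD !addr0.
pose W := [set y | exists2 a, lam a = 0 & y = f a].
have subW : subspace i' W.
  split=> [|c _ _ [a1 l1 ->] [a2 l2 ->]].
    by exists 0; rewrite ?f0 // (functional0 lamP).
  by exists (i c * a1 + a2); rewrite ?fD ?fZ // lamP.1 lamP.2 l1 l2 mulr0 addr0.
have [|mu [muP mub muW]] := separating_functional subW (v := f b).
  by case=> a la /injf ba; move: lb; rewrite ba la => /eqP; rewrite eq_sym oner_eq0.
exists mu => // a.
have : W (f (a - i (lam a) * b)).
  exists (a - i (lam a) * b) => //.
  by rewrite lamP.1 (functionalN _ lamP) lamP.2 lb mulr1 subrr.
rewrite -mulNr -rmorphN fD fZ => /muW.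
by rewrite muP.1 muP.2 mub mulr1 => /eqP; rewrite subr_eq0 => /eqP.
Qed.

(** * Tensor products over a field *)

Section TensorProduct.
Variables (k : fieldType) (A C : comNzRingType).
Variables (iA : {rmorphism k -> A}) (iC : {rmorphism k -> C}).

(* The value at the formal tensor [\sum x.1 (x) x.2] of the map to [C] induced by
   the functional [lam] on [A]. *)
Definition contract (lam : A -> k) (s : seq (A * C)) : C :=
  \sum_(x <- s) iC (lam x.1) * x.2.

Definition tensor_null (s : seq (A * C)) : Prop :=
  forall lam, functional iA lam -> contract lam s = 0.

(** Induction on the number of terms. If [a1] is a combination of the other left factors, its term
    is absorbed into theirs; otherwise a functional that is 1 at [a1] and 0 at the others shows that
    [c1 = 0]. *)
Lemma tensor_null_eval (E : comNzRingType) (f : {rmorphism A -> E})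
    (g : {rmorphism C -> E}) (s : seq (A * C)) :
  (forall c, f (iA c) = g (iC c)) -> tensor_null s ->
  \sum_(x <- s) f x.1 * g x.2 = 0.
Proof.
move=> fg; have [n] := ubnP (size s); elim: n s => // n IH [|[a1 c1] s] /=.
  by rewrite big_nil.
rewrite ltnS => sn nulls; pose x0 : A * C := (0, 0).
pose W := [set a | exists e : nat -> k,
  a = \sum_(j < size s) iA (e j) * (nth x0 s j).1].
have subW : subspace iA W.
  split; first by exists (fun=> 0); rewrite big1 // => j _; rewrite rmorph0 mul0r.
  move=> c _ _ [e1 ->] [e2 ->]; exists (fun j => c * e1 j + e2 j).
  rewrite mulr_sumr -big_split; apply: eq_bigr => j _ /=.
  by rewrite rmorphD rmorphM mulrDl mulrA.
have [[e a1E]|Wa1] := pselect (W a1).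
  pose s' := mkseq (fun j => ((nth x0 s j).1, (nth x0 s j).2 + iC (e j) * c1)) (size s).
  have /IH : (size s' < n)%N by rewrite size_mkseq.
  have sumE (G : A * C -> E) : \sum_(x <- s') G x =
      \sum_(j < size s) G ((nth x0 s j).1, (nth x0 s j).2 + iC (e j) * c1).
    by rewrite big_map -[X in iota _ X]subn0 -/(index_iota _ _) big_mkord.
  have sumE' : forall lam, contract lam s' =
      \sum_(j < size s) iC (lam (nth x0 s j).1) *
         ((nth x0 s j).2 + iC (e j) * c1).
    by move=> lam; rewrite /contract big_map -[X in iota _ X]subn0
      -/(index_iota _ _) big_mkord.
  have nulls' : tensor_null s'.
    move=> lam lamP; rewrite sumE'; transitivity (contract lam ((a1, c1) :: s)); last exact: nulls.
    rewrite /contract big_cons /=; under [LHS]eq_bigr do rewrite mulrDr.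
    rewrite big_split addrC /= (big_nth x0) big_mkord; congr (_ + _).
    rewrite a1E (functional_sum _ _ _ lamP) rmorph_sum mulr_suml.
    by apply: eq_bigr => j _; rewrite lamP.2 rmorphM; ring.
  move=> /(_ nulls') s'0; rewrite -[RHS]s'0 sumE big_cons /=.
  symmetry.
  under [LHS]eq_bigr do rewrite rmorphD mulrDr.
  rewrite big_split addrC /= (big_nth x0) big_mkord; congr (_ + _).
  rewrite a1E rmorph_sum mulr_suml.
  by apply: eq_bigr => j _; rewrite !rmorphM fg; ring.
have [lam [lamP lam1 lamW]] := separating_functional subW Wa1.
have c10 : c1 = 0.
  have := nulls _ lamP; rewrite /contract big_cons /= lam1 rmorph1 mul1r.
  rewrite (big_nth x0) big_mkord big1 ?addr0 // => j _.
  rewrite lamW ?rmorph0 ?mul0r //; exists (fun l : nat => (l == j :> nat)%:R).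
  rewrite (bigD1 j) //= eqxx rmorph1 mul1r big1 ?addr0 // => l /negPf lj.
  by rewrite -val_eqE /= in lj; rewrite lj rmorph0 mul0r.
rewrite big_cons /= c10 rmorph0 mulr0 add0r IH // => mu muP.
by have := nulls _ muP; rewrite /contract big_cons /= c10 mulr0 add0r.
Qed.

Definition tensor_mul (s t : seq (A * C)) : seq (A * C) :=
  [seq (x.1 * y.1, x.2 * y.2) | x <- s, y <- t].

Lemma contract_mul lam s t : contract lam (tensor_mul s t) =
  \sum_(x <- s) \sum_(y <- t) iC (lam (x.1 * y.1)) * (x.2 * y.2).
Proof. by rewrite /contract big_allpairs_dep. Qed.

Lemma functional_mulr lam a : functional iA lam ->
  functional iA (fun x => lam (x * a)).
Proof.
by case=> lD lZ; split=> *; rewrite -?lD ?mulrDl // -lZ mulrA.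
Qed.

Lemma contract_mulr lam s t : contract lam (tensor_mul s t) =
  \sum_(y <- t) contract (fun x => lam (x * y.1)) s * y.2.
Proof.
rewrite contract_mul exchange_big; apply: eq_bigr => y _.
by rewrite /contract mulr_suml; apply: eq_bigr => x _; rewrite mulrA.
Qed.

Lemma contract_mulC lam s t :
  contract lam (tensor_mul s t) = contract lam (tensor_mul t s).
Proof.
rewrite !contract_mul exchange_big; apply: eq_bigr => y _; apply: eq_bigr => x _.
by rewrite (mulrC x.1) (mulrC x.2).
Qed.

Let lin := {lam | functional iA lam}.
Let value (s : seq (A * C)) : lin -> C := fun lam => contract (sval lam) s.

(* A tensor is encoded by its contractions with all functionals on [A]. *)
Definition tensor : Type := {F : lin -> C | exists s, F = value s}.

HB.instance Definition _ := gen_eqMixin tensor.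
HB.instance Definition _ := gen_choiceMixin tensor.

Definition tensor_of (s : seq (A * C)) : tensor :=
  exist _ (value s) (ex_intro _ s erefl).
Definition tensor_repr (x : tensor) : seq (A * C) := projT1 (cid (svalP x)).

Lemma tensor_reprK : cancel tensor_repr tensor_of.
Proof.
move=> [F sF]; apply: eq_exist; rewrite /tensor_repr /=.
by case: cid.
Qed.

Lemma tensor_of_eq s t : tensor_of s = tensor_of t <->
  forall lam, functional iA lam -> contract lam s = contract lam t.
Proof.
split=> [e lam lamP|e].
  exact: (congr1 (fun F : tensor => sval F (exist _ lam lamP)) e).
by apply: eq_exist; apply: funext => -[lam lamP]; apply: e.
Qed.

Lemma contract_repr s lam : functional iA lam ->
  contract lam (tensor_repr (tensor_of s)) = contract lam s.
Proof. by move: lam; apply/tensor_of_eq; rewrite tensor_reprK. Qed.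

Lemma tensor_of_mul s s' t t' : tensor_of s = tensor_of s' ->
  tensor_of t = tensor_of t' ->
  tensor_of (tensor_mul s t) = tensor_of (tensor_mul s' t').
Proof.
move=> /tensor_of_eq ss /tensor_of_eq tt; apply/tensor_of_eq => lam lamP.
transitivity (contract lam (tensor_mul s' t)).
  rewrite !contract_mulr; apply: eq_bigr => y _.
  by rewrite ss //; apply: functional_mulr.
rewrite contract_mulC [RHS]contract_mulC !contract_mulr.
by apply: eq_bigr => y _; rewrite tt //; apply: functional_mulr.
Qed.

Definition tensor_opp (s : seq (A * C)) := [seq (- x.1, x.2) | x <- s].

Lemma contract_opp lam s : functional iA lam ->
  contract lam (tensor_opp s) = - contract lam s.
Proof.
move=> lamP; rewrite /contract big_map -sumrN; apply: eq_bigr => x _ /=.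
by rewrite (functionalN _ lamP) rmorphN mulNr.
Qed.

Lemma contract_cat lam s t : contract lam (s ++ t) = contract lam s + contract lam t.
Proof. by rewrite /contract big_cat. Qed.

Let addT x y := tensor_of (tensor_repr x ++ tensor_repr y).
Let oppT x := tensor_of (tensor_opp (tensor_repr x)).
Let mulT x y := tensor_of (tensor_mul (tensor_repr x) (tensor_repr y)).
Let zeroT := tensor_of [::].
Let oneT := tensor_of [:: (1, 1)].

Let addTE s t : addT (tensor_of s) (tensor_of t) = tensor_of (s ++ t).
Proof.
by apply/tensor_of_eq => lam lamP; rewrite !contract_cat !contract_repr.
Qed.
Let oppTE s : oppT (tensor_of s) = tensor_of (tensor_opp s).
Proof.
by apply/tensor_of_eq => lam lamP; rewrite !contract_opp // contract_repr.
Qed.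
Let mulTE s t : mulT (tensor_of s) (tensor_of t) = tensor_of (tensor_mul s t).
Proof. by apply: tensor_of_mul; rewrite tensor_reprK. Qed.

Let ofP (P : tensor -> Prop) : (forall s, P (tensor_of s)) -> forall x, P x.
Proof. by move=> h x; rewrite -[x]tensor_reprK. Qed.

Fact tensor_addA : associative addT.
Proof. by do 3![apply: ofP => ?]; rewrite !addTE catA. Qed.
Fact tensor_addC : commutative addT.
Proof.
do 2![apply: ofP => ?]; rewrite !addTE; apply/tensor_of_eq => lam lamP.
by rewrite !contract_cat addrC.
Qed.
Fact tensor_add0 : left_id zeroT addT.
Proof. by apply: ofP => s; rewrite addTE. Qed.
Fact tensor_addN : left_inverse zeroT oppT addT.
Proof.
apply: ofP => s; rewrite oppTE addTE; apply/tensor_of_eq => lam lamP.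
by rewrite contract_cat contract_opp // addNr /contract big_nil.
Qed.
Fact tensor_mulA : associative mulT.
Proof.
do 3![apply: ofP => ?]; rewrite !mulTE; apply/tensor_of_eq => lam lamP.
rewrite [LHS]contract_mul [RHS]contract_mul big_allpairs_dep /=.
apply: eq_bigr => x _; rewrite big_allpairs_dep; apply: eq_bigr => y _.
by apply: eq_bigr => z _; rewrite !mulrA.
Qed.
Fact tensor_mulC : commutative mulT.
Proof.
do 2![apply: ofP => ?]; rewrite !mulTE; apply/tensor_of_eq => lam lamP.
exact: contract_mulC.
Qed.
Fact tensor_mul1 : left_id oneT mulT.
Proof.
apply: ofP => s; rewrite mulTE; apply/tensor_of_eq => lam lamP.
by rewrite contract_mul big_seq1; apply: eq_bigr => x _; rewrite !mul1r.
Qed.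
Fact tensor_mulDl : left_distributive mulT addT.
Proof.
do 3![apply: ofP => ?]; rewrite !(addTE, mulTE); apply/tensor_of_eq => lam lamP.
by rewrite contract_cat !contract_mul big_cat.
Qed.
Fact tensor_one_neq0 : oneT != zeroT.
Proof.
apply/eqP => /tensor_of_eq e.
have [||lam [lamP lam1 _]] :=
  separating_functional (i := iA) (W := [set 0]) (v := 1).
- by split=> // c a b -> ->; rewrite mulr0 addr0.
- by apply/eqP; rewrite oner_eq0.
move: (e lam lamP); rewrite /contract big_seq1 big_nil /= lam1 rmorph1 mul1r.
by apply/eqP; rewrite oner_eq0.
Qed.

HB.instance Definition _ := GRing.isZmodule.Build tensor
  tensor_addA tensor_addC tensor_add0 tensor_addN.
HB.instance Definition _ := GRing.Zmodule_isComNzRing.Build tensor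
  tensor_mulA tensor_mulC tensor_mul1 tensor_mulDl tensor_one_neq0.

Lemma tensor_of_sum s : tensor_of s = \sum_(x <- s) tensor_of [:: x].
Proof.
elim: s => [|x s IH]; first by rewrite big_nil.
by rewrite big_cons -IH -cat1s -addTE.
Qed.

Lemma tensor_existence : exists (jA : {rmorphism A -> tensor})
  (jC : {rmorphism C -> tensor}),
  is_tensor_product iA iC jA jC /\
  forall s, tensor_of s = \sum_(x <- s) jA x.1 * jC x.2.
Proof.
have [|| jA jAE] := @rmorphism_ex _ _ (fun a => tensor_of [:: (a, 1)]).
- move=> a b; rewrite -[RHS]/(addT _ (oppT _)) oppTE addTE.
  apply/tensor_of_eq => lam lamP; rewrite /contract !(big_cons, big_nil) /=.
  by rewrite lamP.1 (functionalN _ lamP) rmorphD mulrDl !addr0.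
- split=> // a b; rewrite [RHS]mulTE; apply/tensor_of_eq => lam lamP.
  by rewrite /contract !(big_cons, big_nil) /= !mulr1.
have [|| jC jCE] := @rmorphism_ex _ _ (fun c => tensor_of [:: (1, c)]).
- move=> a b; rewrite -[RHS]/(addT _ (oppT _)) oppTE addTE.
  apply/tensor_of_eq => lam lamP; rewrite /contract !(big_cons, big_nil) /=.
  by rewrite (functionalN _ lamP) rmorphN mulNr mulrBr !addr0.
- split=> // a b; rewrite [RHS]mulTE; apply/tensor_of_eq => lam lamP.
  by rewrite /contract !(big_cons, big_nil) /= !mulr1.
have ofE s : tensor_of s = \sum_(x <- s) jA x.1 * jC x.2.
  rewrite tensor_of_sum; apply: eq_bigr => -[a c] _ /=; rewrite jAE jCE.
  by rewrite [RHS]mulTE /tensor_mul /= mulr1 mul1r.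
exists jA, jC; split=> //; split=> [c|E f g fg].
  rewrite jAE jCE; apply/tensor_of_eq => lam lamP.
  rewrite /contract !big_seq1 /= -[iA c]mulr1 lamP.2 rmorphM.
  by rewrite mulr1 mulrC.
(* Defined on representatives; [tensor_null_eval] makes the value independent of them. *)
pose h x := \sum_(y <- tensor_repr x) f y.1 * g y.2.
have hE s : h (tensor_of s) = \sum_(x <- s) f x.1 * g x.2.
  apply/eqP; rewrite -subr_eq0; apply/eqP.
  transitivity (\sum_(x <- tensor_repr (tensor_of s) ++ tensor_opp s) f x.1 * g x.2).
    rewrite big_cat /=; congr (_ + _); rewrite big_map -sumrN; apply: eq_bigr => x _.
    by rewrite rmorphN mulNr.
  apply: tensor_null_eval => // lam lamP.
  by rewrite contract_cat contract_opp // contract_repr // subrr.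
have [|| h' h'E] := @rmorphism_ex _ _ h.
- do 2![apply: ofP => ?]; rewrite -[X in h X]/(addT _ (oppT _)).
  rewrite oppTE addTE !hE big_cat /=; congr (_ + _).
  by rewrite big_map -sumrN; apply: eq_bigr => x _; rewrite rmorphN mulNr.
- split; first by rewrite -[X in h X]/oneT hE big_seq1 !rmorph1 mulr1.
  do 2![apply: ofP => ?]; rewrite -[X in h X]/(mulT _ _) mulTE !hE.
  rewrite big_allpairs_dep mulr_suml; apply: eq_bigr => x _.
  by rewrite mulr_sumr; apply: eq_bigr => y _; rewrite !rmorphM mulrACA.
exists h'; split.
- by move=> a; rewrite h'E jAE hE big_seq1 rmorph1 mulr1.
- by move=> a; rewrite h'E jCE hE big_seq1 rmorph1 mul1r.
- move=> h2 h2A h2C; apply: ofP => s; rewrite h'E hE ofE rmorph_sum.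
  by apply: eq_bigr => x _; rewrite rmorphM h2A h2C.
Qed.

Variables (B : comNzRingType) (jA : {rmorphism A -> B}) (jC : {rmorphism C -> B}).
Hypothesis tensB : is_tensor_product iA iC jA jC.

(** [B] is sent to the explicit model and back; by uniqueness in the universal property the round
    trip is the identity, so the generators of the model suffice for [B]. *)
Lemma tensor_span b : exists s : seq (A * C), b = \sum_(x <- s) jA x.1 * jC x.2.
Proof.
have [jA' [jC' [tensT ofE]]] := tensor_existence.
have [h [hA hC _]] := tensB.2 _ _ _ tensT.1.
have [g [gA gC _]] := tensT.2 _ _ _ tensB.1.
have [h0 [_ _ uniq]] := tensB.2 _ _ _ tensB.1.
have gh : g (h b) = b.
  transitivity (h0 b).
    by apply: (uniq (g \o h)) => /= ?; rewrite ?hA ?gA ?hC ?gC.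
  by symmetry; apply: (uniq idfun).
exists (tensor_repr (h b)); rewrite -[LHS]gh -[h b in LHS]tensor_reprK ofE.
by rewrite rmorph_sum; apply: eq_bigr => x _; rewrite rmorphM gA gC.
Qed.

(** The criterion holds by construction in the explicit model, where equality means equality of all
    contractions, and the universal property carries it over to any tensor product. *)
Lemma tensor_nullP s : \sum_(x <- s) jA x.1 * jC x.2 = 0 <-> tensor_null s.
Proof.
split; last by apply: tensor_null_eval => c; exact: tensB.1.
have [jA' [jC' [tensT ofE]]] := tensor_existence.
have [h [hA hC _]] := tensB.2 _ _ _ tensT.1.
move=> /(congr1 h); rewrite rmorph0 rmorph_sum.
under eq_bigr do rewrite rmorphM hA hC.
rewrite -ofE => /(tensor_of_eq _ [::]).1 e lam /e ->.
by rewrite /contract big_nil.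
Qed.

Lemma tensor_inl_inj : injective jA.
Proof.
move=> a b /eqP; rewrite -subr_eq0 -rmorphB => /eqP ab.
have /tensor_nullP null : \sum_(x <- [:: (a - b, 1)]) jA x.1 * jC x.2 = 0.
  by rewrite big_seq1 /= ab mul0r.
apply: contrapT => /eqP; rewrite -subr_eq0 => /eqP ab0.
have [|lam [lamP lam1 _]] :=
  separating_functional (i := iA) (W := [set 0]) (v := a - b) _ ab0.
- by split=> // c x y -> ->; rewrite mulr0 addr0.
move: (null lam lamP); rewrite /contract big_seq1 /= lam1 rmorph1 mul1r.
by apply/eqP; rewrite oner_eq0.
Qed.

End TensorProduct.

(** * Field extensions and specialization *)

Lemma integral_trans (R S T : comNzRingType) (f : {rmorphism R -> S})
    (g : {rmorphism S -> T}) (x : T) :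
  integralRange f -> integralOver g x -> integralOver (g \o f) x.
Proof.
move=> intf [p p_mon px]; apply: integral_root_monic (monic_map g p_mon) px _.
by apply/integral_poly => i; rewrite coef_map /=; apply: integral_rmorph.
Qed.

Lemma algebraic_trans (k k1 k2 : fieldType) (f : {rmorphism k -> k1})
    (g : {rmorphism k1 -> k2}) :
  algebraic_extension f -> algebraic_extension g -> algebraic_extension (g \o f).
Proof.
move=> algf algg x; apply/integral_algebraic.
by apply: integral_trans => [y|]; apply/integral_algebraic; [apply: algf|apply: algg].
Qed.

Lemma irreducible_factor (F : fieldType) (p : {poly F}) : (1 < size p)%N ->
  exists2 q, irreducible_poly q & q %| p.
Proof.
have [n] := ubnP (size p); elim: n p => // n IH p; rewrite ltnS => pn p1.
have [irr|nirr] := pselect (irreducible_poly p); first by exists p.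
have [q [q1 qp qNp]] : exists q : {poly F}, [/\ size q != 1%N, q %| p & ~~ (q %= p)].
  apply: contrapT => /forallNP nq; apply: nirr; split=> // q q1 qp.
  by apply: contrapT => /negP ?; apply: (nq q).
have p0 : p != 0 by rewrite -size_poly_gt0 ltnW.
have q0 : q != 0 by apply: contraNneq p0 => q0; rewrite -dvd0p -q0.
have sq : (size q < size p)%N.
  by rewrite ltn_neqAle dvdp_leq // andbT dvdp_size_eqp.
have [||r irr rq] := IH q; first exact: leq_trans sq pn.
  by rewrite ltn_neqAle eq_sym q1 size_poly_gt0.
by exists r => //; apply: dvdp_trans qp.
Qed.

Lemma fieldExt_algebraic (F : fieldType) (L : fieldExtType F) :
  algebraic_extension (in_alg L).
Proof.
move=> x; have /polyOver1P[q qE] := minPolyOver 1 x.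
exists q; last by rewrite -qE root_minPoly.
apply: contraTneq (monic_minPoly 1 x) => q0.
by rewrite qE q0 rmorph0 monicE lead_coef0 eq_sym oner_eq0.
Qed.

Lemma root_extension (F : fieldType) (p : {poly F}) : (1 < size p)%N ->
  exists (F' : fieldType) (i : {rmorphism F -> F'}),
    algebraic_extension i /\ exists t, root (map_poly i p) t.
Proof.
move=> /irreducible_factor[q /irredp_FAdjoin[L _ [z qz _]] qp].
exists L, (in_alg L); split; first exact: fieldExt_algebraic.
exists z; have /dvdpP[r ->] := qp.
by rewrite rmorphM rootM qz orbT.
Qed.

Lemma split_extension (F : fieldType) (p : {poly F}) : p \is monic ->
  exists (F' : fieldType) (i : {rmorphism F -> F'}) (rs : seq F'),
    map_poly i p = \prod_(t <- rs) ('X - t%:P).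
Proof.
have [n] := ubnP (size p); elim: n F p => // n IH F p; rewrite ltnS => pn p_mon.
have [p1|p1] := leqP (size p) 1%N.
  exists F, idfun, [::]; rewrite big_nil map_poly_id //.
  by move: p_mon; rewrite monicE (size1_polyC p1) lead_coefC => /eqP ->.
have [F' [i [_ [t /factor_theorem[q qE]]]]] := root_extension p1.
have q_mon : q \is monic.
  by rewrite -(monicMr _ (monicXsubC t)) -qE map_monic.
have [|F2 [i2 [rs rsE]]] := IH _ q _ q_mon.
  have := size_Mmonic (monic_neq0 q_mon) (monicXsubC t).
  rewrite -qE size_map_poly size_XsubC addn2 /= => pE.
  by rewrite -ltnS -pE.
exists F2, (i2 \o i), (i2 t :: rs); rewrite map_poly_comp qE rmorphM /= rsE.
by rewrite big_cons mulrC rmorphB /= map_polyX map_polyC.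
Qed.

Lemma map_poly_killed (S : comNzRingType) (K F : fieldType)
    (kap : {rmorphism S -> K}) (sig : {rmorphism S -> F}) (P : {poly S}) :
  (forall s, kap s = 0 -> sig s = 0) -> map_poly kap P = 0 -> map_poly sig P = 0.
Proof.
move=> ker P0; apply/polyP => i; rewrite coef_map coef0 /= ker //.
by rewrite -coef_map P0 coef0.
Qed.

(** * Specializing one algebraic generator *)

Section Specialization.
Variables (S : comNzRingType) (K : fieldType) (kap : {rmorphism S -> K}) (c : K).
Variable (P0 : {poly S}).
Hypothesis lc0 : kap (lead_coef P0) != 0.
Hypothesis P0c : (map_poly kap P0).[c] = 0.
Hypothesis P0_min : forall Q, (size (map_poly kap Q) < size P0)%N ->
  (map_poly kap Q).[c] = 0 -> map_poly kap Q = 0.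

(** What [kap] and [c] may degenerate to: [sig] factors through the image of [kap], and [t] is the
    image of [c]. *)
Let admissible (F : fieldType) (sig : {rmorphism S -> F}) t :=
  [/\ forall s, kap s = 0 -> sig s = 0, sig (lead_coef P0) != 0 &
      (map_poly sig P0).[t] = 0].

Let size_map_le (F : fieldType) (sig : {rmorphism S -> F}) (P : {poly S}) :
  (size (map_poly sig P) <= size P)%N.
Proof. exact: size_poly. Qed.

Let division (F : fieldType) (sig : {rmorphism S -> F}) t (P D : {poly S}) :
  sig (lead_coef D) ^+ Pdiv.Ring.rscalp P D * (map_poly sig P).[t] =
  (map_poly sig (Pdiv.Ring.rdivp P D)).[t] * (map_poly sig D).[t] +
  (map_poly sig (Pdiv.Ring.rmodp P D)).[t].
Proof.
have := congr1 (fun Q => (map_poly sig Q).[t]) (Pdiv.ComRing.rdivp_eq D P).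
by rewrite /= map_polyZ rmorphD rmorphM /= hornerZ hornerD hornerM rmorphXn.
Qed.

(** In the pseudo-division of [P] by [P0], the remainder vanishes at [c] and is shorter than [P0];
    by minimality [kap] kills it, hence so does [sig], and [sig] keeps the leading coefficient
    invertible. *)
Lemma specialize_null (F : fieldType) (sig : {rmorphism S -> F}) t P :
  admissible sig t -> (map_poly kap P).[c] = 0 -> (map_poly sig P).[t] = 0.
Proof.
move=> adm Pc; have [_ sl0 P0t] := adm.
have D0 : P0 != 0 by apply: contraNneq lc0 => ->; rewrite lead_coef0 rmorph0.
have := division sig t P P0; rewrite P0t mulr0 add0r.
rewrite (_ : map_poly sig (Pdiv.Ring.rmodp P P0) = 0) ?horner0.
  by move/eqP; rewrite mulf_eq0 expf_eq0 (negPf sl0) andbF => /eqP.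
apply: map_poly_killed (let: And3 ker _ _ := adm in ker) _; apply: P0_min.
  exact: leq_ltn_trans (size_map_le _ _) (Pdiv.Ring.ltn_rmodpN0 _ D0).
by have := division kap c P P0; rewrite P0c Pc !mulr0 add0r => <-.
Qed.

(* Euclidean division of [P0] by [w]: the remainders shrink to a constant [r]. *)
Lemma specialize_neq0 w : (map_poly kap w).[c] != 0 ->
  exists2 r, kap r != 0 &
    forall (F : fieldType) (sig : {rmorphism S -> F}) t,
      admissible sig t -> sig r != 0 -> (map_poly sig w).[t] != 0.
Proof.
have [n] := ubnP (size w); elim: n w => // n IH w; rewrite ltnS => wn wc.
have w0 : w != 0 by apply: contraNneq wc => ->; rewrite rmorph0 horner0.
have D0 : P0 != 0 by apply: contraNneq lc0 => ->; rewrite lead_coef0 rmorph0.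
(* A leading coefficient killed by [kap] is killed by every admissible [sig], so that [w] can be
   truncated. *)
have [lw0|lw0] := eqVneq (kap (lead_coef w)) 0.
  pose v := take_poly (size w).-1 w.
  have vE (F : fieldType) (sig : {rmorphism S -> F}) :
      sig (lead_coef w) = 0 -> map_poly sig w = map_poly sig v.
    move=> sl; apply/polyP => j; rewrite !coef_map coef_take_poly.
    case: ltnP => // jw; rewrite /= rmorph0; move: jw; rewrite leq_eqVlt.
    case/predU1P => [<-|jw]; first by rewrite -lead_coefE.
    by rewrite nth_default ?rmorph0 //; case: (size w) jw.
  have [||r r0 rP] := IH v.
  - apply: leq_trans wn; apply: leq_ltn_trans (size_take_poly _ _) _.
    by rewrite ltn_predL size_poly_gt0.
  - by rewrite -vE.
  exists r => // F sig t adm sr; rewrite vE; first exact: rP.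
  by case: adm => ker _ _; apply: ker.
have [wP0|wP0] := leqP (size P0) (size w).
  have lt := Pdiv.Ring.ltn_rmodpN0 w D0.
  have [||r r0 rP] := IH (Pdiv.Ring.rmodp w P0).
  - exact: leq_trans (leq_trans lt wP0) wn.
  - have := division kap c w P0; rewrite P0c mulr0 add0r => <-.
    by rewrite mulf_neq0 // expf_neq0.
  exists r => // F sig t adm sr; have := rP _ _ _ adm sr.
  have := division sig t w P0; have [_ _ ->] := adm; rewrite mulr0 add0r => <-.
  by rewrite mulf_eq0 => /norP[].
have [w1|w1] := leqP (size w) 1%N.
  exists (lead_coef w) => // F sig t _; rewrite (size1_polyC w1).
  by rewrite lead_coefC map_polyC hornerC.
have lt := Pdiv.Ring.ltn_rmodpN0 P0 w0.
have e := division kap c P0 w; rewrite P0c mulr0 in e.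
have [r0c|r0c] := eqVneq (map_poly kap (Pdiv.Ring.rmodp P0 w)).[c] 0; last first.
  have [|r r0 rP] := IH _ _ r0c; first exact: leq_trans lt wn.
  exists r => // F sig t adm sr; have := rP _ _ _ adm sr.
  have := division sig t P0 w; have [_ _ ->] := adm; rewrite mulr0.
  move=> e'; apply: contraNneq => wt; move: e'; rewrite wt mulr0 add0r.
  by move->.
(* The remaining case is contradictory: up to a nonzero scalar [w] divides [P0] over [K], the
   quotient vanishes at [c] because [w] does not, and it is nonzero and shorter than [P0]. *)
have rm0 : map_poly kap (Pdiv.Ring.rmodp P0 w) = 0.
  apply: P0_min r0c; apply: leq_ltn_trans (size_map_le _ _) _.
  exact: ltn_trans wP0.
have Qc : (map_poly kap (Pdiv.Ring.rdivp P0 w)).[c] = 0.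
  move/eqP: e; rewrite r0c addr0 eq_sym mulf_eq0 (negPf wc) orbF.
  by move/eqP.
have e' := congr1 (map_poly kap) (Pdiv.ComRing.rdivp_eq w P0).
rewrite /= map_polyZ rmorphD rmorphM /= rm0 addr0 rmorphXn in e'.
have sP0 : size (map_poly kap P0) = size P0.
  by rewrite size_map_poly_id0.
have sw : size (map_poly kap w) = size w by rewrite size_map_poly_id0.
have kw0 : map_poly kap w != 0 by rewrite -size_poly_gt0 sw size_poly_gt0.
have Q0 : map_poly kap (Pdiv.Ring.rdivp P0 w) != 0.
  apply: contraNneq D0 => Q0; move/eqP: e'; rewrite Q0 mul0r scaler_eq0.
  rewrite expf_eq0 (negPf lw0) andbF => /eqP h.
  by rewrite -size_poly_eq0 -sP0 h size_poly0.
move: (Q0); rewrite P0_min ?eqxx //.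
have := congr1 (fun p : {poly K} => size p) e'.
rewrite /= size_scale ?expf_neq0 // size_mul // sP0 sw => ->.
by case: (size w) w1 => [|[|m]] // _; rewrite !addnS /= ltnS leq_addr.
Qed.

End Specialization.

(* The Nullstellensatz for the finitely generated subalgebra [k[cs]] of [K]:
   [S] is a polynomial ring over [k] that maps onto it. *)
Lemma specialization (k K : fieldType) (i : {rmorphism k -> K}) (cs : seq K) :
  exists (S : comNzRingType) (iS : {rmorphism k -> S}) (kap : {rmorphism S -> K}),
    [/\ forall c, kap (iS c) = i c, forall c, c \in cs -> exists s, kap s = c &
      forall w, kap w != 0 -> exists (k' : fieldType) (i' : {rmorphism k -> k'})
        (sig : {rmorphism S -> k'}),
        [/\ algebraic_extension i', forall c, sig (iS c) = i' c, sig w != 0 &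
            forall s, kap s = 0 -> sig s = 0]].
Proof.
elim: cs => [|c cs [S [iS [kap [kapi kapcs H]]]]].
  exists k, idfun, i; split=> // w w0; exists k, idfun, idfun; split=> //.
  - by move=> x; exact: (algebraic_id idfun).
  - by apply: contraNneq w0 => /= ->; rewrite rmorph0.
  - by move=> s /eqP; rewrite fmorph_eq0 => /eqP.
have comm (F : fieldType) (f : {rmorphism S -> F}) t : commr_rmorph f t.
  by move=> x; apply: mulrC.
exists {poly S}, (polyC \o iS), (horner_morph (comm _ kap c)); split.
- by move=> x; rewrite /= /horner_morph map_polyC hornerC /= kapi.
- move=> x; rewrite inE => /predU1P[->|/kapcs[s <-]].
    by exists 'X; rewrite /= /horner_morph map_polyX hornerX.
  by exists s%:P; rewrite /= /horner_morph map_polyC hornerC.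
rewrite /= /horner_morph => w wc.
have [[P PP]|noP] := pselect (exists P : {poly S},
    map_poly kap P != 0 /\ (map_poly kap P).[c] = 0).
  pose good n := `[< exists P : {poly S}, [/\ size (map_poly kap P) = n,
    map_poly kap P != 0 & (map_poly kap P).[c] = 0] >].
  have [|m /asboolP[P1 [P1s P1n P1c]] minm] := @ex_minnP good.
    by exists (size (map_poly kap P)); apply/asboolP; exists P; case: PP.
  (* Truncation discards only coefficients killed by [kap], so that the leading coefficient of [P0]
     survives. *)
  pose P0 := take_poly m P1.
  have P01 : map_poly kap P0 = map_poly kap P1.
    apply/polyP => j; rewrite !coef_map coef_take_poly -coef_map /=.
    case: ltnP => [|mj]; first by rewrite coef_map.
    by rewrite rmorph0 nth_default // P1s.
  have P0s : size P0 = m.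
    apply/eqP; rewrite eqn_leq size_take_poly -{1}P1s -P01.
    exact: size_poly.
  have lc0 : kap (lead_coef P0) != 0.
    rewrite lead_coefE -coef_map P01 P0s -P1s -lead_coefE lead_coef_eq0.
    exact: P1n.
  have P0c : (map_poly kap P0).[c] = 0 by rewrite P01.
  have P0min Q : (size (map_poly kap Q) < size P0)%N ->
      (map_poly kap Q).[c] = 0 -> map_poly kap Q = 0.
    rewrite P0s => Qm Qc; apply: contrapT => /eqP Q0.
    have : (m <= size (map_poly kap Q))%N by apply: minm; apply/asboolP; exists Q.
    by rewrite leqNgt Qm.
  have [r r0 rP] := specialize_neq0 lc0 P0c P0min wc.
  have [|k' [i' [sig [alg sigi sigw ker]]]] := H (lead_coef P0 * r).
    by rewrite rmorphM mulf_neq0.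
  move: sigw; rewrite rmorphM mulf_eq0 => /norP[sl sr].
  have [|k2 [j [algj [t tP]]]] := @root_extension _ (map_poly sig P0).
    rewrite size_map_poly_id0 // P0s ltnNge; apply/negP => m1.
    have sP1 : (size (map_poly kap P1) <= 1)%N by rewrite P1s.
    move: P1c P1n; rewrite (size1_polyC sP1) hornerC => ->.
    by rewrite eqxx.
  have adm : [/\ forall s, kap s = 0 -> (j \o sig) s = 0,
      (j \o sig) (lead_coef P0) != 0 & (map_poly (j \o sig) P0).[t] = 0].
    split=> [s /ker /= ->||]; rewrite ?rmorph0 //= ?fmorph_eq0 //.
    by rewrite map_poly_comp; apply/rootP.
  exists k2, (j \o i'), (horner_morph (comm _ (j \o sig) t)); split.
  - exact: algebraic_trans.
  - by move=> x; rewrite /= /horner_morph map_polyC hornerC /= sigi.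
  - by rewrite /= /horner_morph; apply: rP adm _; rewrite /= fmorph_eq0.
  - rewrite /= /horner_morph => s; exact: (specialize_null lc0 P0c P0min adm).
have {}noP (P : {poly S}) : (map_poly kap P).[c] = 0 -> map_poly kap P = 0.
  by move=> Pc; apply: contrapT => /eqP P0; apply: noP; exists P.
have w0 : map_poly kap w != 0 by apply: contraNneq wc => ->; rewrite horner0.
(* Here [c] is transcendental over the image of [kap]. Keeping the top surviving coefficient of [w]
   keeps [map_poly sig w] nonzero, and [t] only has to avoid its roots. *)
have [|k' [i' [sig [alg sigi sigw ker]]]] := H w`_(size (map_poly kap w)).-1.
  by rewrite -coef_map -lead_coefE lead_coef_eq0.
pose q := map_poly sig w.
have q0 : q != 0.
  by apply: contraNneq sigw => q0; rewrite -coef_map -/q q0 coef0.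
have sq : size (q * 'X - 1) = (size q).+1.
  rewrite size_polyDl size_mulX // size_polyN size_poly1 ltnS.
  by rewrite size_poly_gt0.
(* A root [t] of [q * 'X - 1] satisfies [q.[t] != 0]. It is sought in an extension because [k'] may
   be finite and consist of roots of [q]. *)
have [|k2 [j [algj [t tP]]]] := @root_extension _ (q * 'X - 1).
  by rewrite sq ltnS size_poly_gt0.
exists k2, (j \o i'), (horner_morph (comm _ (j \o sig) t)); split.
- exact: algebraic_trans.
- by move=> x; rewrite /= /horner_morph map_polyC hornerC /= sigi.
- rewrite /= /horner_morph map_poly_comp -/q.
  apply/eqP => qt; move/rootP: tP.
  rewrite rmorphB rmorphM rmorph1 /= map_polyX hornerD hornerN hornerMX qt.
  by rewrite mul0r hornerC add0r => /eqP; rewrite oppr_eq0 oner_eq0.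
- rewrite /= /horner_morph => s /noP s0; rewrite (map_poly_killed _ s0) ?horner0 //.
  by move=> x /ker /= ->; rewrite rmorph0.
Qed.

(** * Local rings at closed points *)

Section Ideals.
Variable R : comNzRingType.
Implicit Types (I y : set R) (a b : R).

Lemma ideal_zero I : is_ideal I -> I 0. Proof. by case. Qed.

Lemma ideal_mull I a b : is_ideal I -> I b -> I (a * b).
Proof. by case=> _ _; apply. Qed.

Lemma ideal_mulr I a b : is_ideal I -> I a -> I (a * b).
Proof. by rewrite mulrC; apply: ideal_mull. Qed.

Lemma ideal_sub I a b : is_ideal I -> I a -> I b -> I (a - b).
Proof. by case=> _ ID IM Ia Ib; apply: ID => //; rewrite -mulN1r; apply: IM. Qed.

Lemma ideal_sum I (T : Type) (s : seq T) (P : pred T) (F : T -> R) : is_ideal I ->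
  (forall t, P t -> I (F t)) -> I (\sum_(t <- s | P t) F t).
Proof. by move=> [I0 ID _] IF; apply: big_ind. Qed.

Lemma maximal_ideal_exists I : is_ideal I -> ~ I 1 ->
  exists y, maximal_ideal y /\ I `<=` y.
Proof.
move=> idI I1.
have [||y [[idy Iy y1] maxy]] :=
  @Zorn_nonempty _ [set J | [/\ is_ideal J, I `<=` J & ~ J 1]] I.
- by split.
- move=> F FP totF [X0 FX0]; split.
  + split=> [|a b [X FX Xa] [Y FY Yb]|a b [X FX Xb]].
    * by exists X0 => //; have [/ideal_zero] := FP _ FX0.
    * have [XY|YX] := totF _ _ FX FY.
        exists Y => //; have [[_ h _] _ _] := FP _ FY; apply: h => //; exact: XY.
      exists X => //; have [[_ h _] _ _] := FP _ FX; apply: h => //; exact: YX.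
    * by exists X => //; have [idX _ _] := FP _ FX; apply: ideal_mull.
  + by move=> a Ia; exists X0 => //; have [_ h _] := FP _ FX0; apply: h.
  + by case=> X FX X1; have [_ _] := FP _ FX.
exists y; split=> //; split=> // J idJ yJ.
have [J1|J1] := pselect (J 1); last first.
  by left; apply: maxy => //; split=> //; apply: subset_trans yJ.
by right; apply/seteqP; split=> // a _; rewrite -[a]mulr1; apply: ideal_mull.
Qed.

Lemma maximal_inverse y a : maximal_ideal y -> ~ y a -> exists b, y (1 - a * b).
Proof.
move=> [idy y1 maxy] ya; pose J := [set x | exists b c, y c /\ x = a * b + c].
have idJ : is_ideal J.
  split=> [|_ _ [b1 [c1 [y1' ->]]] [b2 [c2 [y2 ->]]]|e _ [b1 [c1 [y1' ->]]]].
  - by exists 0, 0; rewrite mulr0 addr0; split=> //; apply: ideal_zero.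
  - exists (b1 + b2), (c1 + c2); split; first by case: idy => _ + _; apply.
    by rewrite mulrDr addrACA.
  - by exists (e * b1), (e * c1); split; [apply: ideal_mull|rewrite mulrDr mulrCA].
have [|JE|JT] := maxy J idJ.
- by move=> c yc; exists 0, c; rewrite mulr0 add0r.
- case: ya; rewrite -JE; exists 1, 0; rewrite mulr1 addr0; split=> //.
  exact: ideal_zero.
have [b [c [yc E]]] : J 1 by rewrite JT.
by exists b; rewrite E addrC addKr.
Qed.

Lemma maximal_prime y : maximal_ideal y -> prime_ideal y.
Proof.
move=> maxy; have [idy y1 _] := maxy; split=> // a b yab.
have [ya|ya] := pselect (y a); [by left|right].
have [c yc] := maximal_inverse maxy ya.
rewrite (_ : b = (1 - a * c) * b + c * (a * b)); last by ring.
by case: (idy) => _ + _; apply; [apply: ideal_mulr|apply: ideal_mull].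
Qed.

End Ideals.

Section LocalRing.
Variables (R : idomainType) (y : set R).
Hypothesis yP : prime_ideal y.
Implicit Types (h u pi : {fraction R}).

Notation O := (local_ring y).
Notation M := (local_max y).

Lemma notin_prime_neq0 s : ~ y s -> s != 0.
Proof. by move=> ys; apply/eqP => s0; apply: ys; rewrite s0; case: yP => /ideal_zero. Qed.

Lemma notin_prime_mul s t : ~ y s -> ~ y t -> ~ y (s * t).
Proof. by case: yP => _ _ yM ys yt /yM[]. Qed.

Lemma local_ring_tofrac a : O (tofrac a).
Proof. by exists a, 1; rewrite tofrac1 divr1; split=> //; case: yP. Qed.

Lemma local_ringM h1 h2 : O h1 -> O h2 -> O (h1 * h2).
Proof.
move=> [a [s [ys ->]]] [b [t [yt ->]]]; exists (a * b), (s * t).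
by split; [apply: notin_prime_mul|rewrite mulf_div !tofracM].
Qed.

Lemma local_ringX h n : O h -> O (h ^+ n).
Proof.
move=> Oh; elim: n => [|n IH]; last by rewrite exprS; apply: local_ringM.
by rewrite expr0 -tofrac1; apply: local_ring_tofrac.
Qed.

Lemma local_max_ring h : M h -> O h.
Proof. by case=> a [s [_ ys ->]]; exists a, s. Qed.

Lemma local_maxM h1 h2 : O h1 -> M h2 -> M (h1 * h2).
Proof.
move=> [a [s [ys ->]]] [b [t [yb yt ->]]]; exists (a * b), (s * t).
split; [by apply: ideal_mull => //; case: yP|exact: notin_prime_mul|].
by rewrite mulf_div !tofracM.
Qed.

Lemma local_maxD h1 h2 : M h1 -> M h2 -> M (h1 + h2).
Proof.
move=> [a [s [ya ys ->]]] [b [t [yb yt ->]]]; exists (a * t + b * s), (s * t).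
split; [|exact: notin_prime_mul|].
  by case: yP => -[_ + _] _ _; apply; apply: ideal_mulr => //; case: yP.
by rewrite addf_div ?tofrac_eq0 ?notin_prime_neq0 // !(tofracM, tofracD).
Qed.

Lemma local_max_tofrac a : M (tofrac a) <-> y a.
Proof.
split=> [[b [s [yb ys /eqP]]]|ya]; last first.
  by exists a, 1; rewrite tofrac1 divr1; split=> //; case: yP.
rewrite -[X in X == _]divr1 -tofrac1 => /eqP/frac_eq E.
have := E (oner_neq0 _) (notin_prime_neq0 ys); rewrite mulr1 => as_b.
by case: yP => _ _ yM; have /yM[] : y (a * s) by rewrite as_b.
Qed.

Lemma local_max1 : ~ M 1.
Proof. by rewrite -tofrac1 => /local_max_tofrac; case: yP. Qed.

Lemma local_unit h : O h -> ~ M h -> h != 0 /\ O h^-1.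
Proof.
move=> [a [s [ys hE]]] Mh.
have ya : ~ y a by move=> ya; apply: Mh; exists a, s.
split; first by rewrite hE mulf_neq0 ?invr_eq0 ?tofrac_eq0 ?notin_prime_neq0.
by exists s, a; split=> //; rewrite hE invf_div.
Qed.

Definition vunit u : Prop := [/\ u != 0, O u & O u^-1].

Lemma vunit1 : vunit 1.
Proof.
by split; rewrite ?invr1 ?oner_neq0 // -tofrac1; apply: local_ring_tofrac.
Qed.

Lemma vunitV u : vunit u -> vunit u^-1.
Proof. by case=> u0 Ou OV; split; rewrite ?invr_eq0 ?invrK. Qed.

Lemma vunitM u v : vunit u -> vunit v -> vunit (u * v).
Proof.
move=> [u0 Ou OuV] [v0 Ov OvV].
by split; rewrite ?mulf_neq0 ?invfM //; apply: local_ringM.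
Qed.

Lemma vunit_notM u : vunit u -> ~ M u.
Proof.
case=> u0 _ OV Mu; apply: local_max1; rewrite -(mulVf u0).
exact: local_maxM.
Qed.

Lemma vunitX u (n : int) : vunit u -> vunit (u ^ n).
Proof.
move=> uu; case: n => n; rewrite ?NegzE -?exprnP ?exprnN; last apply: vunitV.
  by elim: n => [|n IH]; rewrite ?expr0 ?exprS; [exact: vunit1|exact: vunitM].
by elim: n.+1 => [|m IH]; rewrite ?expr0 ?exprS; [exact: vunit1|exact: vunitM].
Qed.

Section Uniformizer.
Hypothesis y_neq0 : exists2 a, a != 0 & y a.
Variable pi : {fraction R}.
Hypothesis piP : uniformizer y pi.

Lemma uniformizer_neq0 : pi != 0.
Proof.
apply/eqP => pi0; have [a a0 /local_max_tofrac/piP.2[u _]] := y_neq0.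
by rewrite pi0 mulr0 => /eqP; rewrite tofrac_eq0; apply/negP.
Qed.

Lemma uniformizer_notunit : ~ O pi^-1.
Proof.
move=> OV; apply: local_max1; rewrite -(mulVf uniformizer_neq0).
by apply: local_maxM => //; case: piP.
Qed.

Lemma vunit_pow_eq u v (m n : int) : vunit u -> vunit v ->
  u * pi ^ m = v * pi ^ n -> m = n.
Proof.
have pi0 := uniformizer_neq0.
have aux (a b : {fraction R}) (l1 l2 : int) : vunit a -> vunit b ->
    a * pi ^ l1 = b * pi ^ l2 -> (l1 <= l2)%R.
  move=> ua ub e; rewrite leNgt; apply/negP => lt.
  have /vunit_notM : vunit (b / a) by apply: vunitM => //; apply: vunitV.
  apply; have [a0 _ _] := ua.
  have -> : b / a = pi ^ (l1 - l2).
    apply: (mulIf (expfz_neq0 l2 pi0)); rewrite -expfzDr // subrK.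
    by rewrite mulrAC -e [a * _]mulrC mulfK.
  have : 0 < l1 - l2 by rewrite subr_gt0.
  case: (l1 - l2) => // -[|l] // _; rewrite -exprnP exprSr.
  apply: local_maxM; last by case: piP.
  by apply/local_ringX/local_max_ring; case: piP.
by move=> uu uv e; apply/eqP; rewrite eq_le (aux _ _ _ _ uu uv e) (aux _ _ _ _ uv uu (esym e)).
Qed.

Lemma uniformizer_assoc pi' : uniformizer y pi' -> exists2 w, vunit w & pi' = w * pi.
Proof.
move=> pi'P; have [w Ow E] := piP.2 _ pi'P.1.
have [w' Ow' E'] := pi'P.2 _ piP.1.
exists w => //; have w'w : w' * w = 1.
  by apply: (mulIf uniformizer_neq0); rewrite mul1r -mulrA -E -E'.
have w0 : w != 0 by apply: contraTneq isT => w0; move/eqP: w'w; rewrite w0 mulr0 eq_sym oner_eq0.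
by split=> //; rewrite -[w^-1]mul1r -w'w mulfK.
Qed.

Lemma ordE u n : vunit u -> ord y (u * pi ^ n) = n.
Proof.
move=> uu; rewrite /ord; case: xgetP => [m _ [pi' [v [pi'P v0 Ov OV E]]]|/(_ n)].
  have [w ww wE] := uniformizer_assoc pi'P.
  apply/esym/(vunit_pow_eq uu (v := v * w ^ m)); last first.
    by rewrite E wE expfzMl mulrA.
  by apply: vunitM; [split|apply: vunitX].
by case; exists pi, u; case: uu.
Qed.

End Uniformizer.

(** A uniformizer only makes the maximal ideal principal. The factorization makes the local ring a
    discrete valuation ring, of which [ord] is then the valuation. *)
Definition regular_point : Prop :=
  (exists2 a, a != 0 & y a) /\ exists2 pi, uniformizer y pi &
    forall h, h != 0 -> exists2 u, vunit u & exists n : int, h = u * pi ^ n.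

(* In dimension one [\bigcap_n pi^n O] is a prime strictly below [y], hence 0. *)
Lemma dim1_regular pi : (exists2 a, a != 0 & y a) -> uniformizer y pi ->
  (forall P, prime_ideal P -> P `<=` y -> (exists2 a, a != 0 & P a) -> P = y) ->
  regular_point.
Proof.
move=> y0 piP dim1; split=> //; exists pi => //.
have pi0 := uniformizer_neq0 y0 piP.
pose P := [set a | forall n : nat, O (tofrac a / pi ^+ n)].
have decomp a : ~ P a -> exists2 u, vunit u & exists n : nat, tofrac a = u * pi ^+ n.
  move=> /existsNP Pa.
  have [|n /asboolP na minn] :=
      @ex_minnP (fun n => `[< ~ O (tofrac a / pi ^+ n) >]).
    by case: Pa => n na; exists n; apply/asboolP.
  case: n na minn => [|n] na minn.
    by case: na; rewrite expr0 divr1; apply: local_ring_tofrac.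
  have On : O (tofrac a / pi ^+ n).
    by apply: contrapT => /asboolP/minn; rewrite ltnn.
  exists (tofrac a / pi ^+ n); last by exists n; rewrite divfK ?expf_neq0.
  have [|u0 uV] := local_unit On; last by split.
  move=> /piP.2[w Ow E]; apply: na.
  by rewrite exprSr invfM mulrA E mulfK.
have Py : P `<=` y.
  move=> a /(_ 1) /[!expr1] Oa; apply/local_max_tofrac.
  by rewrite -(divfK pi0 (tofrac a)); apply: local_maxM => //; case: piP.
have PP : prime_ideal P.
  split=> [||a b Pab].
  - split=> [n|a b Pa Pb n|a b Pb n].
    + by rewrite tofrac0 mul0r -tofrac0; apply: local_ring_tofrac.
    + rewrite tofracD mulrDl; have [c [s [ys ->]]] := Pa n.
      have [e [t [yt ->]]] := Pb n.
      rewrite addf_div ?tofrac_eq0 ?notin_prime_neq0 // -!tofracM -tofracD.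
      by eexists _, _; split; last reflexivity; apply: notin_prime_mul.
    + by rewrite tofracM -mulrA; apply: local_ringM (local_ring_tofrac _) _.
  - by move=> /Py; case: yP.
  apply: contrapT => /not_orP[/decomp[u uu [m ae]] /decomp[v vv [n be]]].
  have := Pab (m + n).+1; rewrite tofracM ae be mulrACA -exprD exprS invfM.
  rewrite [pi^-1 * _]mulrC mulrA mulfK ?expf_neq0 // => Ouv.
  apply: (uniformizer_notunit y0 piP).
  have [uv0 _ OV] := vunitM uu vv.
  by rewrite -(mulKf uv0 pi^-1); apply: local_ringM.
have P0 a : P a -> a = 0.
  move=> Pa; apply: contrapT => /eqP a0.
  have PE : P = y by apply: dim1 => //; exists a.
  (* The numerator [b] of [pi] lies in [y]. If it also lay in [P], it would be divisible by
     [pi ^+ 2], and the denominator [s] would be in [y]. *)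
  have [b [s [yb ys E]]] := piP.1.
  have s0 := notin_prime_neq0 ys.
  have := yb; rewrite -PE => /(_ 2); rewrite (_ : tofrac b = pi * tofrac s); last first.
    by rewrite E divfK ?tofrac_eq0.
  rewrite expr2 invfM mulrA [pi * _]mulrC mulfK // => Os; apply: ys.
  apply/local_max_tofrac; rewrite -(divfK pi0 (tofrac s)).
  by apply: local_maxM => //; case: piP.
have decomp0 a : a != 0 -> exists2 u, vunit u & exists n : nat, tofrac a = u * pi ^+ n.
  by move=> a0; apply: decomp => /P0/eqP; apply/negP.
move=> h; have [a [b [b0 ->]]] := fracP h.
rewrite mulf_eq0 invr_eq0 !tofrac_eq0 (negPf b0) orbF => a0.
have [u uu [m ->]] := decomp0 _ a0; have [v vv [n ->]] := decomp0 _ b0.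
exists (u / v); first by apply: vunitM => //; apply: vunitV.
by exists (m%:Z - n%:Z); rewrite invfM mulrACA expfzDr // -invr_expz.
Qed.

Section RegularPoint.
Hypothesis regy : regular_point.

Lemma regular_decomp h : h != 0 -> exists pi u,
  [/\ uniformizer y pi, vunit u & h = u * pi ^ (ord y h)].
Proof.
move=> h0; have [y0 [pi piP dec]] := regy.
by have [u uu [n ->]] := dec h h0; exists pi, u; rewrite (ordE y0 piP).
Qed.

Lemma ord_vunit u : vunit u -> ord y u = 0.
Proof.
move=> uu; have [y0 [pi piP _]] := regy.
by rewrite -[u in LHS]mulr1 -(expr0z pi) (ordE y0 piP).
Qed.

Lemma ordM h1 h2 : h1 != 0 -> h2 != 0 -> ord y (h1 * h2) = ord y h1 + ord y h2.
Proof.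
move=> h10 h20; have [y0 [pi piP dec]] := regy.
have [u uu [m ->]] := dec h1 h10; have [v vv [n ->]] := dec h2 h20.
rewrite mulrACA -expfzDr ?(uniformizer_neq0 y0 piP) //.
by rewrite !(ordE y0 piP) //; apply: vunitM.
Qed.

Lemma ordXz h (n : int) : h != 0 -> ord y (h ^ n) = n * ord y h.
Proof.
move=> h0; have [y0 [pi piP dec]] := regy.
have [u uu [m ->]] := dec h h0; rewrite expfzMl.
rewrite exprz_exp (ordE y0 piP) ?(ordE y0 piP) 1?mulrC //; exact: vunitX.
Qed.

Lemma ordV h : h != 0 -> ord y h^-1 = - ord y h.
Proof. by move=> h0; rewrite -exprN1 ordXz // mulN1r. Qed.

Lemma ordX h (n : nat) : h != 0 -> ord y (h ^+ n) = n%:Z * ord y h.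
Proof. by move=> h0; rewrite exprnP ordXz. Qed.

Lemma ord_ge0 h : h != 0 -> (0 <= ord y h) <-> O h.
Proof.
move=> h0; have [y0 [pi piP dec]] := regy.
have [u uu [n ->]] := dec h h0; rewrite (ordE y0 piP) //; have [u0 Ou OV] := uu.
split.
  case: n => // n _; rewrite -exprnP; apply: local_ringM => //.
  by apply/local_ringX/local_max_ring; case: piP.
case: n => // n On; exfalso; apply: (uniformizer_notunit y0 piP).
have -> : pi^-1 = u^-1 * (u * pi ^ Negz n) * pi ^+ n.
  rewrite mulKf // NegzE -exprnN exprS invfM divfK //.
  by rewrite expf_neq0 // (uniformizer_neq0 y0 piP).
apply: local_ringM; first exact: local_ringM.
by apply/local_ringX/local_max_ring; case: piP.
Qed.

Lemma ord_notin a : ~ y a -> ord y (tofrac a) = 0.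
Proof.
move=> ya; apply: ord_vunit; split; last by exists 1, a; rewrite tofrac1 div1r.
  by rewrite tofrac_eq0; apply: notin_prime_neq0.
exact: local_ring_tofrac.
Qed.

End RegularPoint.
End LocalRing.

(** * Smooth curves and their base changes *)

Definition regular_ring (R : idomainType) : Prop :=
  forall y : set R, maximal_ideal y -> regular_point y.

(** The denominators of [x] form an ideal. If it is proper, it lies in a maximal [y] at which [x]
    has negative order; dividing the monic equation by [x ^+ n] then writes 1 as a sum of elements
    of the maximal ideal at [y]. *)
Lemma integrally_closed (R : idomainType) (x : {fraction R}) : regular_ring R ->
  integralOver (@FracField.tofrac R) x -> exists a, x = tofrac a.
Proof.
move=> regR [p p_mon px]; pose I := [set b : R | exists a, tofrac b * x = tofrac a].
have idI : is_ideal I.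
  split=> [|a b [a' E] [b' E']|a b [b' E]].
  - by exists 0; rewrite tofrac0 mul0r.
  - by exists (a' + b'); rewrite !tofracD mulrDl E E'.
  - by exists (a * b'); rewrite !tofracM -E mulrA.
have [[a]|I1] := pselect (I 1); first by rewrite tofrac1 mul1r => xa; exists a.
have [y [maxy Iy]] := maximal_ideal_exists idI I1.
have yP := maximal_prime maxy.
have [x0|x0] := eqVneq x 0; first by exists 0; rewrite x0 tofrac0.
suff [a [s [ys xE]]] : local_ring y x.
  case: ys; apply: Iy; exists a; rewrite xE mulrC divfK // tofrac_eq0.
  by apply/eqP => s0; apply: I1; exists 0; move: x0; rewrite xE s0 tofrac0 invr0 mulr0 eqxx.
apply: contrapT => Ox; have regy := regR _ maxy.
have ordx : ord y x < 0 by rewrite ltNge; apply/negP => /(ord_ge0 yP regy x0).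
have xV : local_max y x^-1.
  have [pi [u [piP [u0 Ou OV] E]]] := regular_decomp yP regy x0.
  move: ordx E; case: (ord y x) => // n _ ->.
  rewrite NegzE -exprnN invfM invrK exprSr mulrA; apply: local_maxM => //.
    apply: local_ringM => //; apply/local_ringX/local_max_ring => //.
    by case: piP.
  by case: piP.
have ps : size (map_poly (@FracField.tofrac R) p) = size p.
  by rewrite size_map_poly_id0 // (monicP p_mon) tofrac1 oner_neq0.
move/rootP: px; rewrite horner_coef ps.
have p0 : (0 < size p)%N by rewrite size_poly_gt0 monic_neq0.
case pn: (size p) p0 => [|n] // _.
rewrite big_ord_recr /= coef_map /=.
have -> : p`_n = 1 by move/monicP: p_mon; rewrite lead_coefE pn.
rewrite tofrac1 mul1r => /eqP; rewrite addrC addr_eq0 => /eqP E.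
apply: (local_max1 yP).
have -> : 1 = \sum_(i < n) tofrac (- p`_i) * x^-1 ^+ (n - i).
  rewrite -[LHS](mulfV (expf_neq0 n x0)) {1}E -sumrN mulr_suml.
  apply: eq_bigr => i _; rewrite coef_map tofracN !mulNr -mulrA; congr (- (_ * _)).
  rewrite exprVn -[X in _ / x ^+ X](subnKC (ltnW (ltn_ord i))) exprD invfM mulVKf //.
  exact: expf_neq0.
elim/big_ind: _; [|exact: local_maxD|].
  by rewrite -tofrac0; apply/local_max_tofrac => //; apply: ideal_zero; case: yP.
move=> i _; apply: local_maxM => //; first exact: local_ring_tofrac.
rewrite -(subnSK (ltn_ord i)) exprSr; apply: local_maxM => //.
by apply: local_ringX => //; apply: local_max_ring.
Qed.

Lemma prime0 (R : idomainType) : prime_ideal [set 0 : R].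
Proof.
split.
- split=> //= [a b -> ->|a b ->]; [exact: addr0|exact: mulr0].
- by apply/eqP; rewrite oner_eq0.
- by move=> a b /eqP; rewrite mulf_eq0 => /orP[]/eqP; [left|right].
Qed.

Lemma prime_preimage (R S : comNzRingType) (f : {rmorphism R -> S}) (P : set S) :
  prime_ideal P -> prime_ideal (f @^-1` P).
Proof.
move=> [[P0 PD PM] P1 PP]; split.
- split=> [|a b|a b]; rewrite /= ?rmorph0 ?rmorphD ?rmorphM //; first exact: PD.
  exact: PM.
- by rewrite /= rmorph1.
- by move=> a b; rewrite /= rmorphM => /PP.
Qed.

Lemma krull_dim1_maximal (R : idomainType) (y : set R) :
  krull_dim1 R -> maximal_ideal y -> (exists2 a, a != 0 & y a) /\
  forall P, prime_ideal P -> P `<=` y -> (exists2 a, a != 0 & P a) -> P = y.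
Proof.
move=> [[P1 [P2 [P1P P2P [P12 P21]]]] no3] maxy.
have yP := maximal_prime maxy; have [idy y1 maxi] := maxy.
split=> [|P PP Py [a a0 Pa]].
  apply: contrapT => noy.
  have y0 : y `<=` [set 0].
    by move=> b yb; apply: contrapT => /eqP b0; apply: noy; exists b.
  have [b P2b P1b] : exists2 b, P2 b & ~ P1 b.
    by apply: contrapT => h; apply: P21 => b P2b; apply: contrapT => ?; apply: h; exists b.
  have [||E|E] := maxi P2; first by case: P2P.
  - by move=> c /y0 ->; apply: ideal_zero; case: P2P.
  - have := P2b; rewrite E => /y0 b0; apply: P1b; rewrite b0.
    by apply: ideal_zero; case: P1P.
  - by case: P2P => _ + _; apply; rewrite E.
apply/seteqP; split=> //; apply: contrapT => yP'; apply: no3.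
exists [set 0], P, y; split=> //; first exact: prime0.
split=> [c ->|h]; first by apply: ideal_zero; case: PP.
by have /= := h _ Pa; apply/eqP.
Qed.

(** * Ideals in integral extensions *)

Section IntegralExtension.
Variables (R : comNzRingType) (B : idomainType) (j : {rmorphism R -> B}).
Hypothesis intj : integralRange j.

(** Take a monic polynomial of least degree whose value at [b] lies in [P]. Its constant term [a]
    stays outside [P], otherwise division by ['X] would give a shorter one. With [P] zero, nonzero
    ideals meet the base ring; in general, this yields incomparability. *)
Lemma integral_prime_relation (P : set B) (b : B) : prime_ideal P -> ~ P b ->
  exists a c, ~ P (j a) /\ P (j a + b * c).
Proof.
move=> PP Pb; have [idP P1 PM] := PP.
have [p p_mon pb] := intj b.
pose good n := `[< exists p : {poly R},
   [/\ size p = n, p \is monic & P (map_poly j p).[b]] >].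
have [|n /asboolP[{pb}p' [pn p'_mon pb]] minn] := @ex_minnP good.
  exists (size p); apply/asboolP; exists p; split=> //.
  by rewrite (rootP pb); apply: ideal_zero.
have p'0 := monic_neq0 p'_mon.
have [q [a pE]] : exists q a, p' = q * 'X + a%:P.
  by exists (drop_poly 1 p'), p'`_0; rewrite -[LHS](poly_take_drop 1) addrC
    expr1; congr (_ + _); apply/polyP => i; rewrite coef_take_poly coefC; case: i.
have pbE : (map_poly j p').[b] = j a + b * (map_poly j q).[b].
  rewrite pE rmorphD rmorphM /= map_polyX map_polyC hornerD hornerMX hornerC /=.
  by rewrite addrC mulrC.
rewrite pbE in pb; exists a, (map_poly j q).[b]; split=> // Pa.
have q0 : q != 0.
  apply: contra_notN P1 => /eqP q0; move: p'_mon Pa.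
  by rewrite pE q0 mul0r add0r monicE lead_coefC => /eqP ->; rewrite rmorph1.
have /PM[//|Pq] : P (b * (map_poly j q).[b]).
  by rewrite -[_ * _](addKr (j a)) addrC; apply: ideal_sub.
have sp : size p' = (size q).+1.
  rewrite pE size_polyDl size_mulX // size_polyC ltnS.
  by apply: leq_trans (leq_b1 _) _; rewrite size_poly_gt0.
have q_mon : q \is monic.
  move: p'_mon; rewrite !monicE !lead_coefE sp pE coefD coefMX coefC /=.
  by rewrite eqn0Ngt size_poly_gt0 q0 /= addr0.
have : (n <= size q)%N by apply: minn; apply/asboolP; exists q.
by rewrite -pn sp ltnn.
Qed.

Lemma integral_ideal_neq0 (I : set B) b : is_ideal I -> I b -> b != 0 ->
  exists2 a, j a != 0 & I (j a).
Proof.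
move=> idI Ib b0.
have [|a [c [ja0 E]]] := integral_prime_relation (prime0 B) (b := b).
  exact/eqP.
exists a; first exact/eqP.
have -> : j a = b * - c by rewrite mulrN; apply/eqP; rewrite -addr_eq0; apply/eqP.
exact: ideal_mulr.
Qed.

Lemma integral_incomparable (P z : set B) : prime_ideal P -> prime_ideal z ->
  P `<=` z -> j @^-1` P = j @^-1` z -> P = z.
Proof.
move=> PP zP Pz E; apply/seteqP; split=> // b zb; apply: contrapT => Pb.
have [a [c [Pa Pac]]] := integral_prime_relation PP Pb.
have idz : is_ideal z by case: zP.
apply: Pa; suff : (j @^-1` z) a by rewrite -E.
rewrite /= -[j a](addrK (b * c)).
by apply: ideal_sub (Pz _ Pac) _ => //; apply: ideal_mulr.
Qed.

Lemma integral_preimage_maximal (z : set B) :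
  maximal_ideal z -> maximal_ideal (j @^-1` z).
Proof.
move=> maxz; have zP := maximal_prime maxz; have yP := prime_preimage j zP.
have [idy y1 _] := yP; split=> // J idJ yJ.
have [JE|/existsNP[r /not_implyP[Jr yr]]] := pselect (J `<=` j @^-1` z).
  by left; apply/seteqP.
have [b zb] := maximal_inverse maxz yr.
right; have [p p_mon pb] := intj b.
suff J1 : J 1 by apply/seteqP; split=> // a _; rewrite -[a]mulr1; apply: ideal_mull.
have p0 : (0 < size p)%N by rewrite size_poly_gt0 monic_neq0.
pose n := (size p).-1.
have pn : p`_n = 1 by move/monicP: p_mon; rewrite lead_coefE.
(* The equation of [b] multiplied by [r ^+ n], where [j r * b] is replaced by 1, to which it is
   congruent modulo [z]. In the resulting sum the top term is 1 and all others are multiples of [r],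
   which forces [J 1]. *)
have ys : (j @^-1` z) (\sum_(i < n.+1) p`_i * r ^+ (n - i)).
  rewrite /= rmorph_sum /=.
  have -> : \sum_(i < n.+1) j (p`_i * r ^+ (n - i)) =
      \sum_(i < n.+1) j (p`_i * r ^+ (n - i)) * (1 - (j r * b) ^+ i).
    under [RHS]eq_bigr do rewrite mulrBr mulr1.
    rewrite sumrB [X in _ - X](_ : _ = 0) ?subr0 //.
    transitivity (j r ^+ n * (map_poly j p).[b]); last first.
      by rewrite (rootP pb) mulr0.
    rewrite horner_coef size_map_poly_id0 ?(monicP p_mon) ?rmorph1 ?oner_neq0 //.
    rewrite -(prednK p0) mulr_sumr; apply: eq_bigr => i _.
    have ni : (i <= n)%N by rewrite -ltnS.
    rewrite coef_map /= rmorphM rmorphXn exprMn -[X in _ = j r ^+ X * _](subnK ni).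
    by rewrite exprD /=; ring.
  have idz : is_ideal z by case: zP.
  apply: ideal_sum => // i _; apply: ideal_mull => //.
  rewrite -opprB subrX1 -mulNr opprB; exact: ideal_mulr.
have := yJ _ ys; rewrite big_ord_recr /= pn subnn expr0 mulr1 => Js.
set S := \sum_(_ < _) _ in Js; rewrite -(addKr S 1) addrC; apply: ideal_sub => //.
apply: ideal_sum => // i _; rewrite -(subnSK (ltn_ord i)) exprS mulrCA.
exact: ideal_mulr.
Qed.

End IntegralExtension.

Lemma tensor_integral (k K : fieldType) (A B : comNzRingType)
    (iA : {rmorphism k -> A}) (i : {rmorphism k -> K})
    (jA : {rmorphism A -> B}) (jK : {rmorphism K -> B}) :
  is_tensor_product iA i jA jK -> algebraic_extension i -> integralRange jA.
Proof.
move=> tens alg b; have [s ->] := tensor_span tens b.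
apply: (big_ind (integralOver jA)); [exact: integral0|exact: integral_add|].
move=> [a c] _ /=; apply: integral_mul; first exact: integral_id.
have /integral_algebraic[p p_mon pc] := alg c.
exists (map_poly iA p); first exact: monic_map.
rewrite -map_poly_comp (eq_map_poly (g := jK \o i)); last by move=> x; apply: tens.1.
by rewrite map_poly_comp; apply: rmorph_root.
Qed.

Lemma tensor_base (k : fieldType) (A : comNzRingType) (iA : {rmorphism k -> A}) :
  is_tensor_product (k := k) iA idfun idfun iA.
Proof.
by split=> // E f g fg; exists f; split.
Qed.

Section SmoothCurve.
Variables (k : fieldType) (C : affine_scheme k).
Hypothesis smC : smooth_curve C.

Lemma smooth_curve_regular : regular_ring C.
Proof.
move=> y maxy; have [[_ _ dimC] sm] := smC.
have [pi piP] := sm _ _ _ _ _ (tensor_base (structure_map C)) y maxy.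
have [y0 ydim] := krull_dim1_maximal dimC maxy.
exact (dim1_regular (maximal_prime maxy) y0 piP ydim).
Qed.

Variables (K : fieldType) (i : {rmorphism k -> K}) (B : idomainType).
Variables (j : {rmorphism C -> B}) (jK : {rmorphism K -> B}).
Hypothesis alg : algebraic_extension i.
Hypothesis tens : is_tensor_product (structure_map C) i j jK.

(** Smoothness provides the uniformizer. Dimension one is not given for [B]: that no nonzero prime
    lies strictly below [z] is inherited from [C] by incomparability, since [B] is integral over
    [C]. *)
Lemma smooth_curve_base_change_regular : regular_ring B.
Proof.
move=> z maxz; have [[_ _ dimC] sm] := smC.
have intj := tensor_integral tens alg.
have [pi piP] := sm _ _ _ _ _ tens z maxz.
have [[a a0 ya] ydim] := krull_dim1_maximal dimC (integral_preimage_maximal intj maxz).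
have zP := maximal_prime maxz.
refine (dim1_regular zP _ piP _).
  by exists (j a) => //; apply: rmorph_neq0 a0; apply: tensor_inl_inj tens.
move=> P PP Pz [b b0 Pb]; apply: (integral_incomparable intj) => //.
apply: ydim; [exact: prime_preimage| |].
  by move=> c /= /Pz.
have [|c jc0 Pc] := integral_ideal_neq0 intj _ Pb b0; first by case: PP.
by exists c => //; apply: contraNneq jc0 => ->; rewrite rmorph0.
Qed.

End SmoothCurve.

(** * Orders under pullback *)

Section Ramification.
Variables (R S : idomainType) (j : {rmorphism R -> S}) (z : set S).
Hypotheses (j_inj : injective j) (zP : prime_ideal z).
Notation y := (j @^-1` z).
Hypotheses (regy : regular_point y) (regz : regular_point z).

(** Units at [y] go to units at [z], so the order upstairs is determined by its value at a
    uniformizer. That value is a natural number, the same for all uniformizers, so [ramification]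
    does not take its default value. *)
Lemma ord_frac_map h : h != 0 ->
  ord z (frac_map j h) = (ramification j z)%:Z * ord y h.
Proof.
move=> h0; have yP := prime_preimage j zP.
have [Phi [PhiE PhiF]] := frac_map_morphism j_inj.
have PhiO x : local_ring y x -> local_ring z (Phi x).
  move=> [a [s [ys ->]]]; exists (j a), (j s); split=> //.
  by rewrite fmorph_div !PhiF.
have PhiU u : vunit y u -> vunit z (Phi u).
  move=> [u0 Ou OV]; split; rewrite ?fmorph_eq0 -?fmorphV //; exact: PhiO.
have [pi [u [piP uu E]]] := regular_decomp yP regy h0.
have [y0 [pi0 pi0P _]] := regy.
have [e eE] : exists e : nat, ord z (frac_map j pi) = e%:Z.
  have n0 := uniformizer_neq0 yP y0 piP.
  have : 0 <= ord z (frac_map j pi).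
    rewrite -PhiE; apply/ord_ge0; rewrite ?fmorph_eq0 //.
    by apply/PhiO/local_max_ring; case: piP.
  by case: (ord z _) => // e _; exists e.
rewrite /ramification; case: xgetP => [e' _ [pi' [pi'P e'E]]|/(_ e)]; last first.
  by case; exists pi.
have [w ww piE] := uniformizer_assoc yP y0 pi'P piP.
have pi'0 := uniformizer_neq0 yP y0 pi'P.
have [[w0 _ _] [u0 _ _]] := (ww, uu).
rewrite -e'E -!PhiE; move: E; move: (ord _ h) => n ->; rewrite piE.
rewrite expfzMl !rmorphM !fmorphXz !(ordM zP regz) ?mulf_neq0 ?expfz_neq0 ?fmorph_eq0 //.
rewrite !(ordXz zP regz) ?fmorph_eq0 // (ord_vunit zP regz (PhiU _ uu)).
by rewrite (ord_vunit zP regz (PhiU _ ww)) mulr0 !add0r mulrC.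
Qed.

End Ramification.

(** * Noetherian rings *)

Section Noetherian.

(** Finite generation, with the ideal generated by [s] described from above as contained in every
    ideal through [s], which avoids explicit linear combinations. *)
Definition noetherian (R : comNzRingType) : Prop := forall I : set R, is_ideal I ->
  exists s : seq R, (forall x, x \in s -> I x) /\
    forall J, is_ideal J -> (forall x, x \in s -> J x) -> I `<=` J.

Lemma noetherian_field (k : fieldType) : noetherian k.
Proof.
move=> I idI; have [[a [a0 Ia]]|noa] := pselect (exists a, a != 0 /\ I a).
  exists [:: a]; split=> [x|J idJ aJ x _]; first by rewrite inE => /eqP ->.
  by rewrite -(divfK a0 x); apply: ideal_mull => //; apply: aJ; rewrite inE.
exists [::]; split=> // J idJ _ x Ix; suff -> : x = 0 by apply: ideal_zero.
by apply: contrapT => /eqP x0; apply: noa; exists x.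
Qed.

Lemma noetherian_image (S R : comNzRingType) (f : {rmorphism S -> R}) :
  (forall x, exists y, f y = x) -> noetherian S -> noetherian R.
Proof.
move=> surj noeS I idI.
have [|s [sI gen]] := noeS (f @^-1` I).
  split=> [|a b|a b]; rewrite /= ?rmorph0 ?rmorphD ?rmorphM; first exact: ideal_zero.
    by case: idI => _ + _; apply.
  exact: ideal_mull.
exists (map f s); split=> [x /mapP[y /sI ? ->] //|J idJ sJ x].
have [y <-] := surj x; apply: (gen (f @^-1` J)).
  split=> [|a b|a b]; rewrite /= ?rmorph0 ?rmorphD ?rmorphM; first exact: ideal_zero.
    by case: idJ => _ + _; apply.
  exact: ideal_mull.
by move=> z zs; apply/sJ/map_f.
Qed.

(** Hilbert's basis theorem. The ideals [L I n] of coefficients in degree [n] stabilize at some [N],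
    and finitely many lifts serve the degrees up to [N]. The extra argument [J] of [L] is there
    because generation is tested against arbitrary ideals. *)
Lemma noetherian_poly (S : comNzRingType) : noetherian S -> noetherian {poly S}.
Proof.
move=> noeS I idI.
pose L (J : set {poly S}) n := [set a | exists f : {poly S},
  [/\ J f, I f, (size f <= n.+1)%N & f`_n = a]].
have idL J n : is_ideal J -> is_ideal (L J n).
  move=> idJ; split=> [|_ _ [f [Jf If sf <-]] [g [Jg Ig sg <-]]|a _ [f [Jf If sf <-]]].
  - by exists 0; rewrite size_poly0 coef0; split=> //; apply: ideal_zero.
  - exists (f + g); rewrite coefD; split=> //; try by case: (idJ) (idI) => [_ + _] [_ + _]; auto.
    by rewrite (leq_trans (size_polyD _ _)) // geq_max sf.
  - exists (a%:P * f); rewrite coefCM mul_polyC; split=> //.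
    + by rewrite -mul_polyC; apply: ideal_mull.
    + by rewrite -mul_polyC; apply: ideal_mull.
    + exact: leq_trans (size_scale_leq _ _) sf.
have Lmono J m n : is_ideal J -> (m <= n)%N -> L J m `<=` L J n.
  move=> idJ mn _ [f [Jf If sf <-]]; exists (f * 'X^(n - m)).
  rewrite coefMXn ltnNge leq_subr /= subKn //; split=> //; [exact: ideal_mulr..|].
  have [->|f0] := eqVneq f 0; first by rewrite mul0r size_poly0.
  by rewrite size_mulXn // -(leq_add2l (n - m)) addnS subnK in sf *.
have lift (n : nat) (s : seq S) : (forall a, a \in s -> L I n a) ->
    exists G : seq {poly S}, (forall f, f \in G -> I f) /\
      forall J, is_ideal J -> (forall f, f \in G -> J f) ->
        forall a, a \in s -> L J n a.
  elim: s => [|a s IH] sL; first by exists [::].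
  have [b bs|G [GI GJ]] := IH; first by apply: sL; rewrite inE bs orbT.
  have [|f [_ If sf fa]] := sL a; first by rewrite inE eqxx.
  exists (f :: G); split=> [g|J idJ fGJ b].
    by rewrite inE => /predU1P[->|/GI].
  rewrite inE => /predU1P[->|]; last first.
    by apply: GJ => // g gG; apply: fGJ; rewrite inE gG orbT.
  by exists f; split=> //; apply: fGJ; rewrite inE eqxx.
pose Linf := [set a | exists n, L I n a].
have idLinf : is_ideal Linf.
  split=> [|a b [m ma] [n nb]|a b [n nb]].
  - by exists 0%N; apply: ideal_zero; apply: idL.
  - exists (maxn m n); have [_ D _] := idL I (maxn m n) idI; apply: D.
      by apply: Lmono ma => //; apply: leq_maxl.
    by apply: Lmono nb => //; apply: leq_maxr.
  - by exists n; apply: ideal_mull => //; apply: idL.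
have [s [sL gens]] := noeS Linf idLinf.
have [N sN] : exists N, forall a, a \in s -> L I N a.
  elim: (s) sL => [|a t IH] tL; first by exists 0%N.
  have [b bt|N tN] := IH; first by apply: tL; rewrite inE bt orbT.
  have [|m ma] := tL a; first by rewrite inE eqxx.
  exists (maxn N m) => b; rewrite inE => /predU1P[->|/tN Nb].
    by apply: Lmono ma => //; apply: leq_maxr.
  by apply: Lmono Nb => //; apply: leq_maxl.
have [G [GI GJ]] : exists G : seq {poly S}, (forall f, f \in G -> I f) /\
    forall n, (n < N)%N -> forall J, is_ideal J -> (forall f, f \in G -> J f) ->
      L I n `<=` L J n.
  elim: (N) => [|M [G [GI GJ]]]; first by exists [::].
  have [t [tL gent]] := noeS _ (idL I M idI).
  have [H [HI HJ]] := lift M t tL.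
  exists (G ++ H); split=> [f|n].
    by rewrite mem_cat => /orP[/GI|/HI].
  rewrite ltnS leq_eqVlt => /predU1P[-> | nM] J idJ GHJ.
    apply: gent; first exact: idL.
    by apply: HJ => // f fH; apply: GHJ; rewrite mem_cat fH orbT.
  by apply: GJ => // f fG; apply: GHJ; rewrite mem_cat fG.
have [H [HI HJ]] := lift N s sN.
exists (G ++ H); split=> [f|J idJ GHJ f].
  by rewrite mem_cat => /orP[/GI|/HI].
have GJ' f' : f' \in G -> J f' by move=> ?; apply: GHJ; rewrite mem_cat; apply/orP; left.
have HJ' f' : f' \in H -> J f' by move=> ?; apply: GHJ; rewrite mem_cat; apply/orP; right.
have LJ n : L I n `<=` L J n.
  have [nN|nN] := ltnP n N; first exact: GJ.
  move=> a na; apply: (gens (L J n)) => //; [exact: idL| |by exists n].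
  by move=> b bs; apply: Lmono nN _ _ => //; apply: HJ.
have [n] := ubnP (size f); elim: n f => // n IH f; rewrite ltnS => fn If.
have [f0|f0] := eqVneq f 0; first by rewrite f0; apply: ideal_zero.
have sf : size f = (size f).-1.+1 by rewrite prednK // size_poly_gt0.
have [|g [Jg Ig sg gE]] := LJ (size f).-1 f`_(size f).-1.
  by exists f; rewrite -sf.
rewrite -(subrK g f); case: (idJ) => _ + _; apply=> //.
apply: IH; last exact: ideal_sub.
apply: leq_trans fn; rewrite sf ltnS; apply/leq_sizeP => i.
rewrite leq_eqVlt => /predU1P[<-|fi]; first by rewrite coefB gE subrr.
rewrite coefB !nth_default ?subrr //; first exact: leq_trans sg fi.
by rewrite sf.
Qed.

Lemma finite_type_noetherian (k : fieldType) (A : affine_scheme k) :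
  finite_type A -> noetherian A.
Proof.
case=> s gen.
have [S [f [noeS kf sf]]] : exists (S : comNzRingType) (f : {rmorphism S -> A}),
    [/\ noetherian S, forall c, exists x, f x = structure_map A c &
        forall a, a \in s -> exists x, f x = a].
  elim: s {gen} => [|a s [S [f [noeS kf sf]]]].
    exists k, (structure_map A); split=> //; first exact: noetherian_field.
    by move=> c; exists c.
  have comm : commr_rmorph f a by move=> x; apply: mulrC.
  exists {poly S}, (horner_morph comm); split.
  - exact: noetherian_poly.
  - move=> c; have [x <-] := kf c; exists x%:P.
    by rewrite /= /horner_morph map_polyC hornerC.
  - move=> b; rewrite inE => /predU1P[->|/sf[x <-]].
      by exists 'X; rewrite /= /horner_morph map_polyX hornerX.
    by exists x%:P; rewrite /= /horner_morph map_polyC hornerC.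
apply: (noetherian_image (f := f)) noeS => x.
suff : [set a | exists y, f y = a] x by case=> y; exists y.
rewrite (gen [set a | exists y, f y = a]) //.
- by move=> _ _ [a <-] [b <-]; exists (a - b); rewrite rmorphB.
- by move=> _ _ [a <-] [b <-]; exists (a * b); rewrite rmorphM.
Qed.

Lemma chain_finite (T : eqType) (F : set (set T)) (s : seq T) : F !=set0 ->
  total_on F subset -> (forall x, x \in s -> (\bigcup_(X in F) X) x) ->
  exists2 X, F X & forall x, x \in s -> X x.
Proof.
move=> [X0 FX0] totF; elim: s => [|a s IH] sF; first by exists X0.
have [x xs|X FX sX] := IH; first by apply: sF; rewrite inE xs orbT.
have [|Y FY Ya] := sF a; first by rewrite inE eqxx.
have [XY|YX] := totF _ _ FX FY.
  by exists Y => // x; rewrite inE => /predU1P[->|/sX/XY].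
by exists X => // x; rewrite inE => /predU1P[->|/sX //]; apply: YX.
Qed.

(** Noetherian induction: an ideal containing [r] that is maximal among those lying in infinitely
    many maximal ideals is prime. As it contains [r] it is itself maximal, and so lies in only
    one. *)
Lemma finite_maximal_ideals (R : comNzRingType) (Nz : set R) : noetherian R ->
  (forall P, prime_ideal P -> (exists2 a, Nz a & P a) -> maximal_ideal P) ->
  forall r, Nz r -> finite_set [set y : set R | maximal_ideal y /\ y r].
Proof.
move=> noeR dim1 r Nr; apply: contrapT => inf.
pose over (I : set R) := [set y : set R | maximal_ideal y /\ I `<=` y].
pose bad := [set I : set R | [/\ is_ideal I, I r & ~ finite_set (over I)]].
pose Ir := [set a : R | exists b, a = b * r].
have idIr : is_ideal Ir.
  split=> [|_ _ [a ->] [b ->]|a _ [b ->]]; first by exists 0; rewrite mul0r.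
  - by exists (a + b); rewrite mulrDl.
  - by exists (a * b); rewrite mulrA.
have badr : bad Ir.
  split=> //; first by exists 1; rewrite mul1r.
  apply: contra_not inf; apply: sub_finite_set => y [maxy yr]; split=> //.
  by move=> _ [b ->]; apply: ideal_mull => //; case: maxy.
have [|I [[idI Ir' infI] maxI]] := Zorn_nonempty badr.
  move=> F Fbad totF F0.
  pose U := \bigcup_(X in F) X.
  have idU : is_ideal U.
    have [X0 FX0] := F0; split=> [|a b [X FX Xa] [Y FY Yb]|a b [X FX Xb]].
    - by exists X0 => //; have [/ideal_zero] := Fbad _ FX0.
    - have [XY|YX] := totF _ _ FX FY.
        exists Y => //; have [[_ h _] _ _] := Fbad _ FY; apply: h => //; exact: XY.
      exists X => //; have [[_ h _] _ _] := Fbad _ FX; apply: h => //; exact: YX.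
    - by exists X => //; have [idX _ _] := Fbad _ FX; apply: ideal_mull.
  (* The union of the chain is finitely generated, hence equal to a member of the chain. *)
  have [s [sU genU]] := noeR U idU.
  have [X FX sX] := chain_finite F0 totF sU.
  have [idX _ _] := Fbad _ FX.
  have UX : U = X by apply/seteqP; split; [exact: genU|move=> x Xx; exists X].
  by rewrite -/U UX; apply: Fbad.
have grow a : ~ I a -> finite_set [set y : set R | maximal_ideal y /\ I `<=` y /\ y a].
  move=> Ia; apply: contrapT => infa.
  pose J := [set x | exists b c, I c /\ x = b * a + c].
  have idJ : is_ideal J.
    split=> [|_ _ [b1 [c1 [I1 ->]]] [b2 [c2 [I2 ->]]]|e _ [b1 [c1 [I1 ->]]]].
    - by exists 0, 0; rewrite mul0r addr0; split=> //; apply: ideal_zero.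
    - exists (b1 + b2), (c1 + c2); split; first by case: idI => _ + _; apply.
      by rewrite mulrDl addrACA.
    - by exists (e * b1), (e * c1); split; [apply: ideal_mull|rewrite mulrDr mulrA].
  have IJ : I `<=` J by move=> c Ic; exists 0, c; rewrite mul0r add0r.
  have Ja : J a by exists 1, 0; rewrite mul1r addr0; split=> //; apply: ideal_zero.
  apply: Ia; rewrite -(maxI J) //; split=> //; first exact: IJ.
  apply: contra_not infa; apply: sub_finite_set => y [maxy [Iy ya]]; split=> //.
  move=> _ [b [c [Ic ->]]]; have [idy _ _] := maxy; case: (idy) => _ + _; apply.
    exact: ideal_mull.
  exact: Iy.
have I1 : ~ I 1.
  move=> I1; apply: infI; apply: (sub_finite_set (B := set0)) => // y [[_ y1 _] Iy].
  by apply: y1; apply: Iy.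
have PI : prime_ideal I.
  split=> // a b Iab; apply: contrapT => /not_orP[Ia Ib]; apply: infI.
  have fin : finite_set ([set y : set R | maximal_ideal y /\ I `<=` y /\ y a] `|`
      [set y : set R | maximal_ideal y /\ I `<=` y /\ y b]).
    by rewrite finite_setU; split; apply: grow.
  apply: sub_finite_set fin => y [maxy Iy].
  by have [_ _ yM] := maximal_prime maxy; have [ya|yb] := yM _ _ (Iy _ Iab); [left|right].
have [_ _ maxI'] : maximal_ideal I by apply: dim1 => //; exists r.
apply: infI; apply: (sub_finite_set (B := [set I])) => [y [[idy y1 _] Iy]|]; last first.
  exact: finite_set1.
by have [//|yT] := maxI' y idy Iy; case: y1; rewrite yT.
Qed.

End Noetherian.

(** * Radicands without roots *)

Lemma domain_model (B : comNzRingType) : integral_domain B ->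
  exists (D : idomainType) (f : {rmorphism B -> D}), bijective f.
Proof.
move=> domB; have [|| f fE] := @rmorphism_ex B (domain_of domB) (fun x => x) => //.
by exists (domain_of domB), f; exists (fun x => x) => x; rewrite fE.
Qed.

Lemma tensor_transport (k A C B D : comNzRingType) (iA : {rmorphism k -> A})
    (iC : {rmorphism k -> C}) (jA : {rmorphism A -> B}) (jC : {rmorphism C -> B})
    (f : {rmorphism B -> D}) :
  is_tensor_product iA iC jA jC -> bijective f ->
  is_tensor_product iA iC (f \o jA) (f \o jC).
Proof.
move=> [comm UP] /rmorphism_inverse[g [fK gK]]; split=> [c|E u v uv].
  by rewrite /= comm.
have [h [hA hC uniq]] := UP E u v uv.
exists (h \o g); split=> [a|c|h' h'A h'C b] /=; rewrite ?fK //.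
by rewrite -[b]gK fK; apply: (uniq (h' \o f)).
Qed.

Lemma base_change (k : fieldType) (C : affine_scheme k) : geometrically_integral C ->
  forall (K : fieldType) (i : {rmorphism k -> K}),
  exists (B : idomainType) (j : {rmorphism C -> B}) (jK : {rmorphism K -> B}),
    is_tensor_product (structure_map C) i j jK.
Proof.
move=> gi K i; have [j [jK [tens _]]] := tensor_existence (structure_map C) i.
have [D [f bijf]] := domain_model (gi _ _ _ _ _ tens).
by exists D, (f \o j), (f \o jK); apply: tensor_transport.
Qed.

(** This is [lam (x) id], from [A (x) C] to [k (x) C = C]. *)
Lemma tensor_contraction (k : fieldType) (A C B : comNzRingType)
    (iA : {rmorphism k -> A}) (iC : {rmorphism k -> C})
    (jA : {rmorphism A -> B}) (jC : {rmorphism C -> B}) lam :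
  is_tensor_product iA iC jA jC -> functional iA lam ->
  exists Lam : B -> C, (forall a b, Lam (a + b) = Lam a + Lam b) /\
    forall s, Lam (\sum_(x <- s) jA x.1 * jC x.2) = contract iC lam s.
Proof.
move=> tens lamP; pose Lam b := contract iC lam (projT1 (cid (tensor_span tens b))).
have LamE s : Lam (\sum_(x <- s) jA x.1 * jC x.2) = contract iC lam s.
  rewrite /Lam; case: cid => t /= st.
  have /(tensor_nullP tens) : \sum_(x <- t ++ tensor_opp s) jA x.1 * jC x.2 = 0.
    rewrite big_cat /= -st big_map /= -[X in _ + X]opprK -sumrN.
    rewrite [X in _ - X](eq_bigr (fun x => jA x.1 * jC x.2)) ?subrr // => x _.
    by rewrite rmorphN mulNr opprK.
  move/(_ lam lamP); rewrite contract_cat (contract_opp _ _ lamP) => /eqP.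
  by rewrite subr_eq0 => /eqP.
exists Lam; split=> // a b; have [s ->] := tensor_span tens a.
by have [t ->] := tensor_span tens b; rewrite -big_cat !LamE contract_cat.
Qed.

Section GoodRadicand.
Variables (k : fieldType) (C : affine_scheme k) (d : nat).

(** The exponents are divisors of [d] because a homogeneous [e]-th root of a unit of degree [d] has
    a degree [m] with [m * e = d]. *)
Definition good_radicand (r : C) : Prop := r != 0 /\
  forall (K : fieldType) (i : {rmorphism k -> K}), algebraic_extension i ->
  forall (B : idomainType) (j : {rmorphism C -> B}) (jK : {rmorphism K -> B}),
    is_tensor_product (structure_map C) i j jK ->
  forall (e : nat) (h : {fraction B}), (2 <= e)%N -> (e %| d)%N ->
    h ^+ e <> tofrac (j r).

Lemma root_num_den (B : idomainType) (e : nat) (x : B) (h : {fraction B}) :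
  h ^+ e = tofrac x -> exists b1 b2, b2 != 0 /\ b1 ^+ e = x * b2 ^+ e.
Proof.
have [b1 [b2 [b20 ->]]] := fracP h => E; exists b1, b2; split=> //.
move: E; rewrite exprMn exprVn -!tofracXn -[RHS]divr1 -tofrac1.
by move/(frac_eq _ _ (expf_neq0 e b20) (oner_neq0 _)).1; rewrite mulr1.
Qed.

(** A root [b1 / b2] involves finitely many scalars of [K]. Specializing them to an algebraic
    extension of [k] preserves the equation [b1 ^+ e = r * b2 ^+ e]; the point is to keep [b2]
    nonzero. *)
Lemma good_radicand_any_extension (r : C) : geometrically_integral C ->
    good_radicand r ->
  forall (K : fieldType) (i : {rmorphism k -> K}) (B : idomainType)
    (j : {rmorphism C -> B}) (jK : {rmorphism K -> B}),
    is_tensor_product (structure_map C) i j jK ->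
  forall (e : nat) (h : {fraction B}), (2 <= e)%N -> (e %| d)%N ->
    h ^+ e <> tofrac (j r).
Proof.
move=> gi [r0 good] K i B j jK tens e h e2 ed /root_num_den[b1 [b2 [b20 E]]].
have [s1 b1E] := tensor_span tens b1; have [s2 b2E] := tensor_span tens b2.
have [S [iS [kap [kapi kapcs spec]]]] := specialization i [seq x.2 | x <- s1 ++ s2].
have lift s : {subset s <= s1 ++ s2} ->
    exists t : seq (C * S), s = [seq (x.1, kap x.2) | x <- t].
  elim: s => [|[a c] s IH] ss; first by exists [::].
  have [x xs|t ->] := IH; first by apply: ss; rewrite inE xs orbT.
  have [|c' <-] := kapcs c.
    by apply/mapP; exists (a, c) => //; apply: ss; rewrite inE eqxx.
  by exists ((a, c') :: t).
have [t1 s1E] : exists t, s1 = [seq (x.1, kap x.2) | x <- t].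
  by apply: lift => x xs; rewrite mem_cat xs.
have [t2 s2E] : exists t, s2 = [seq (x.1, kap x.2) | x <- t].
  by apply: lift => x xs; rewrite mem_cat xs orbT.
(* A nonzero contraction witnesses [b2 != 0]. It is the image of an element of [S], and this is the
   element that [sig] is asked not to kill. *)
have [lam lamP lam2] : exists2 lam, functional (structure_map C) lam &
    contract i lam s2 != 0.
  apply: contrapT => no; move/eqP: b20; apply; rewrite b2E.
  apply/(tensor_nullP tens) => lam lamP; apply: contrapT => /eqP ?.
  by apply: no; exists lam.
have [|k' [i' [sig [alg sigi sigw ker]]]] := spec (contract iS lam t2).
  rewrite rmorph_sum; move: lam2; rewrite s2E /contract big_map.
  by under eq_bigr do rewrite /= -kapi -rmorphM.
have [B' [j' [jK' tens']]] := base_change gi i'.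
(* [C (x) S] maps to both base changes: by [u] to [B] through [kap], by [v] to [B'] through
   [sig]. *)
have [jS [jS' [tensS _]]] := tensor_existence (structure_map C) iS.
pose elt t := \sum_(x <- t) jS x.1 * jS' x.2.
have [|u [uA uS _]] := tensS.2 B j (jK \o kap).
  by move=> c /=; rewrite kapi tens.1.
have [|v [vA vS _]] := tensS.2 B' j' (jK' \o sig).
  by move=> c /=; rewrite sigi tens'.1.
have u_elt t : u (elt t) = \sum_(x <- t) j x.1 * jK (kap x.2).
  by rewrite rmorph_sum; apply: eq_bigr => x _; rewrite rmorphM uA uS.
have v_elt t : v (elt t) = \sum_(x <- t) j' x.1 * jK' (sig x.2).
  by rewrite rmorph_sum; apply: eq_bigr => x _; rewrite rmorphM vA vS.
(* On each contraction, this is the inclusion of the kernel of [kap] in that of [sig]. *)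
have ker_uv b : u b = 0 -> v b = 0.
  have [t ->] := tensor_span tensS b.
  rewrite -/(elt t) u_elt v_elt => ut.
  rewrite -(big_map (fun x => (x.1, sig x.2)) predT (fun y => j' y.1 * jK' y.2)).
  apply/(tensor_nullP tens') => mu muP; rewrite /contract big_map.
  transitivity (sig (\sum_(x <- t) iS (mu x.1) * x.2)).
    by rewrite rmorph_sum; apply: eq_bigr => x _; rewrite rmorphM sigi.
  apply: ker; rewrite rmorph_sum.
  have /(tensor_nullP tens)/(_ mu muP) :
      \sum_(x <- [seq (x.1, kap x.2) | x <- t]) j x.1 * jK x.2 = 0.
    by rewrite big_map.
  rewrite /contract big_map => E3; rewrite -[RHS]E3.
  by apply: eq_bigr => x _; rewrite rmorphM kapi.
have u1 : u (elt t1) = b1 by rewrite u_elt b1E s1E big_map.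
have u2 : u (elt t2) = b2 by rewrite u_elt b2E s2E big_map.
have := ker_uv (elt t1 ^+ e - jS r * elt t2 ^+ e).
rewrite !rmorphB !rmorphM !rmorphXn u1 u2 uA vA E subrr => /(_ erefl)/eqP.
rewrite subr_eq0 => /eqP E'.
have v20 : v (elt t2) != 0.
  apply/eqP; rewrite v_elt.
  rewrite -(big_map (fun x => (x.1, sig x.2)) predT (fun y => j' y.1 * jK' y.2)).
  move/(tensor_nullP tens')/(_ lam lamP); rewrite /contract big_map => E2.
  move/eqP: sigw; apply; rewrite -[RHS]E2 rmorph_sum.
  by apply: eq_bigr => x _; rewrite rmorphM sigi.
apply: (good _ i' alg _ _ _ tens' e (tofrac (v (elt t1)) / tofrac (v (elt t2))) e2 ed).
rewrite expr_div_n -!tofracXn E' tofracM mulfK // tofrac_eq0.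
exact: expf_neq0.
Qed.

End GoodRadicand.

(** * Irreducibility of Kummer polynomials *)

Section KummerIrreducible.
Variables (F : fieldType) (d : nat) (a : F) (rs : seq F).
Hypotheses (d_gt0 : (0 < d)%N) (a0 : a != 0).
Hypothesis rsE : 'X^d - 1 = \prod_(t <- rs) ('X - t%:P).
Hypothesis no_root : forall (e : nat) h, (2 <= e)%N -> (e %| d)%N -> h ^+ e <> a.

(* Over a field that contains the roots of unity, the constant term of a factor
   of degree [m] is a root of unity times [beta ^+ m], up to sign. *)
Lemma kummer_factor_degree (q : {poly F}) : (1 < size q)%N ->
  q %| 'X^d - a%:P -> size q = d.+1.
Proof.
move=> q1 qdiv; have [E [j [_ [beta qb]]]] := root_extension q1.
have bd : beta ^+ d = j a.
  have /dvdpP[q' /(congr1 (map_poly j))] := qdiv.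
  rewrite rmorphB rmorphM /= map_polyXn map_polyC => /(congr1 (horner^~ beta)).
  rewrite hornerM (rootP qb) mulr0 hornerD hornerN hornerXn hornerC /=.
  by move/eqP; rewrite subr_eq0 => /eqP.
have b0 : beta != 0.
  by apply: contraNneq a0 => b0; rewrite -(fmorph_eq0 j) -bd b0 expr0n eqn0Ngt d_gt0.
have srs : size rs = d.
  by apply/eqP; rewrite -eqSS -(size_prod_XsubC rs id) -rsE size_XnsubC.
(* Substituting ['X / beta] in the factorization of ['X^d - 1]. The list [rs] may have repetitions,
   so the characteristic may divide [d]. *)
have fact : 'X^d - (j a)%:P = \prod_(t <- rs) ('X - (j t * beta)%:P).
  have := congr1 (fun p => beta ^+ d *: ((map_poly j p) \Po (beta^-1 *: 'X))) rsE.
  rewrite /= rmorphB rmorph1 /= map_polyXn rmorphB rmorph1 /= comp_Xn_poly.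
  rewrite exprZn exprVn scalerBr scalerA divff ?expf_neq0 // scale1r bd.
  rewrite alg_polyC => ->.
  rewrite !rmorph_prod /= -bd -srs; elim: (rs) => [|t s IH].
    by rewrite !big_nil scale1r.
  rewrite !big_cons /= exprS -IH -scalerA scalerAr scalerAl; congr (_ * _).
  rewrite rmorphB /= map_polyX map_polyC comp_polyB comp_polyX comp_polyC.
  rewrite scalerBr scalerA divff // scale1r -!mul_polyC -polyCM.
  by rewrite [beta * _]mulrC.
have jdiv : map_poly j q %| \prod_(t <- rs) ('X - (j t * beta)%:P).
  by rewrite -fact -(map_polyC j) -(map_polyXn j) -rmorphB dvdp_map.
have [m qE] := dvdp_prod_XsubC jdiv.
pose ts := mask m rs.
have sts : size q = (size ts).+1.
  by rewrite -(size_map_poly j) (eqp_size qE) size_prod_XsubC.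
have ts0 t : t \in ts -> t != 0.
  move=> /mem_mask tr; have : root ('X^d - 1) t by rewrite rsE root_prod_XsubC.
  apply: contraTneq => ->; rewrite rootE hornerD hornerN hornerXn hornerC.
  by rewrite expr0n eqn0Ngt d_gt0 add0r oppr_eq0 oner_eq0.
have [f bm] : exists f, beta ^+ size ts = j f.
  have [c /eqP cE] : exists c, map_poly j q == c *: \prod_(t <- ts) ('X - (j t * beta)%:P).
    by case/eqpP: qE => -[u v] /= /andP[u0 v0] uv; exists (u^-1 * v);
      rewrite -scalerA -uv scalerA mulVf // scale1r.
  have lcE : j (lead_coef q) = c.
    rewrite -lead_coef_map cE lead_coefZ.
    by rewrite (monicP (monic_prod_XsubC _ _ _)) mulr1.
  have := congr1 (horner^~ 0) cE; rewrite -(rmorph0 j) horner_map /= hornerZ.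
  rewrite horner_prod rmorph0.
  have -> : \prod_(t <- ts) ('X - (j t * beta)%:P).[0] =
      j (\prod_(t <- ts) - t) * beta ^+ size ts.
    rewrite rmorph_prod; elim: (ts) => [|t s IH]; first by rewrite !big_nil mulr1.
    by rewrite !big_cons IH hornerXsubC rmorphN /= exprS; ring.
  rewrite -lcE mulrA -rmorphM => E0.
  have n0 : lead_coef q * \prod_(t <- ts) - t != 0.
    rewrite mulf_neq0 // ?lead_coef_eq0 -?size_poly_gt0 1?ltnW //.
    rewrite prodf_seq_neq0; apply/allP => t /ts0.
    by rewrite oppr_eq0.
  exists (q.[0] / (lead_coef q * \prod_(t <- ts) - t)).
  by rewrite fmorph_div E0 mulrAC divff ?mul1r // fmorph_eq0.
rewrite sts; congr _.+1; move: bm sts; move: (size ts) => n bm sn.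
have n0 : (0 < n)%N by rewrite sn in q1.
have nd : (n <= d)%N.
  rewrite -ltnS -sn -(size_XnsubC a d_gt0) dvdp_leq //.
  by rewrite -size_poly_gt0 size_XnsubC.
apply/eqP; rewrite eqn_leq nd leqNgt; apply/negP => ltnd.
(* Both [beta ^+ n] and [beta ^+ d] come from [F], hence by Bezout so does [beta ^+ gcdn n d]. It is
   a root of [a] of exponent [d %/ gcdn n d], which is at least 2 as [n < d]. *)
have [g bg] : exists g, beta ^+ gcdn n d = j g.
  have [km kn km_kn _] := egcdnP d n0.
  exists (f ^+ km / a ^+ kn); rewrite fmorph_div !rmorphXn -bm -bd -!exprM.
  rewrite [(n * _)%N]mulnC [(d * _)%N]mulnC km_kn addnC exprD mulfK //.
  exact: expf_neq0.
have gd := dvdn_gcdr n d.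
apply: (@no_root (d %/ gcdn n d) g).
- rewrite leq_divRL ?gcdn_gt0 ?n0 // mul2n -addnn.
  have [l dE] := dvdnP gd; have gn : (gcdn n d <= n)%N by rewrite dvdn_leq ?dvdn_gcdl.
  rewrite [X in (_ <= X)%N]dE addnn -mul2n leq_mul2r; apply/orP; right.
  move: (leq_ltn_trans gn ltnd); rewrite {2}dE.
  by case: l {dE} => [|[|l]] //; rewrite mul1n ltnn.
- by rewrite -[X in (_ %| X)%N](divnK gd) dvdn_mulr.
- by apply: (fmorph_inj j); rewrite rmorphXn -bg -exprM mulnC divnK.
Qed.

Lemma kummer_irreducible : irreducible_poly ('X^d - a%:P).
Proof.
split=> [|q q1 qdiv]; first by rewrite size_XnsubC.
have p0 : 'X^d - a%:P != 0 by rewrite -size_poly_gt0 size_XnsubC.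
rewrite -dvdp_size_eqp // size_XnsubC // kummer_factor_degree //.
rewrite ltn_neqAle eq_sym q1 size_poly_gt0 /=.
by apply: contraNneq p0 => q0; rewrite -dvd0p -q0.
Qed.

End KummerIrreducible.

Lemma irreducible_poly_map (F E : fieldType) (f : {rmorphism F -> E}) (p : {poly F}) :
  irreducible_poly (map_poly f p) -> irreducible_poly p.
Proof.
case=> p1 irr; split=> [|q q1 qp]; first by rewrite -(size_map_poly f).
by rewrite -(eqp_map f); apply: irr; rewrite ?size_map_poly ?dvdp_map.
Qed.

Lemma good_radicand_irreducible (k : fieldType) (C : affine_scheme k) (d : nat) (r : C) :
    geometrically_integral C -> (0 < d)%N -> good_radicand d r ->
  forall (K : fieldType) (i : {rmorphism k -> K}),
  exists (K2 : fieldType) (i1 : {rmorphism K -> K2}) (B : idomainType)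
    (j : {rmorphism C -> B}) (jK : {rmorphism K2 -> B}),
    is_tensor_product (structure_map C) (i1 \o i) j jK /\
    irreducible_poly ('X^d - (tofrac (j r))%:P).
Proof.
move=> gi d0 good K i; have [r0 _] := good.
have [K2 [i1 [rs rsE]]] := split_extension (monicXnsubC (1 : K) d0).
have [B [j [jK tens]]] := base_change gi (i1 \o i).
exists K2, i1, B, j, jK; split=> //.
pose g0 : {rmorphism K2 -> {fraction B}} := (@FracField.tofrac B) \o jK.
apply: (kummer_irreducible (rs := [seq g0 t | t <- rs])) => //.
- by rewrite tofrac_eq0; apply: rmorph_neq0 r0; apply: tensor_inl_inj tens.
- move: rsE => /(congr1 (map_poly g0)).
  rewrite !rmorphB !rmorphXn /= !map_polyX !map_polyC /= !rmorph1 => ->.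
  rewrite rmorph_prod big_map; apply: eq_bigr => t _.
  by rewrite rmorphB /= map_polyX map_polyC.
- by move=> e h e2 ed; apply: (good_radicand_any_extension gi good tens).
Qed.

Lemma inj_surj_bijective (S T : Type) (f : S -> T) : injective f ->
  (forall y, exists x, f x = y) -> bijective f.
Proof.
move=> injf surj; exists (fun y => projT1 (cid (surj y))) => [x|y]; case: cid => //= x' e.
exact: injf.
Qed.

Lemma lift_rmorphism (R D E : nzRingType) (v : {rmorphism D -> E}) (g : {rmorphism R -> E}) :
  injective v -> (forall x, exists y, v y = g x) ->
  exists f : {rmorphism R -> D}, forall x, v (f x) = g x.
Proof.
move=> injv im; pose f x := projT1 (cid (im x)).
have fE x : v (f x) = g x by rewrite /f; case: cid.
have [|| f' f'E] := @rmorphism_ex _ _ f.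
- by move=> x y; apply: injv; rewrite rmorphB !fE rmorphB.
- split; first by apply: injv; rewrite fE !rmorph1.
  by move=> x y; apply: injv; rewrite rmorphM !fE rmorphM.
by exists f' => x; rewrite f'E.
Qed.

Section SubringDomain.
Variables (L : fieldType) (S : set L).
Hypotheses (S1 : S 1) (SB : forall x y, S x -> S y -> S (x - y)).
Hypothesis (SM : forall x y, S x -> S y -> S (x * y)).

Definition subring_pred : pred L := fun x => `[< S x >].

Fact subring_pred_closed : subring_closed subring_pred.
Proof.
split=> [|x y /asboolP Sx /asboolP Sy|x y /asboolP Sx /asboolP Sy]; apply/asboolP.
- exact: S1.
- exact: SB.
- exact: SM.
Qed.

HB.instance Definition _ :=
  GRing.isSubringClosed.Build L subring_pred subring_pred_closed.

Record subring_type := SubringElt { subring_val : L; _ : subring_val \in subring_pred }.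

HB.instance Definition _ := [isSub for subring_val].
HB.instance Definition _ := [Choice of subring_type by <:].
HB.instance Definition _ := [SubChoice_isSubComNzRing of subring_type by <:].

Lemma subring_domain : exists (D : idomainType) (v : {rmorphism D -> L}),
  injective v /\ forall x, S x <-> exists y, v y = x.
Proof.
have dom : integral_domain subring_type.
  move=> a b /(congr1 val); rewrite rmorphM rmorph0 => /eqP.
  by rewrite mulf_eq0 => /orP[]/eqP h; [left|right]; apply: val_inj; rewrite h rmorph0.
have [D [f /rmorphism_inverse[g [fK gK]]]] := domain_model dom.
exists D, (val \o g); split=> [|x]; first exact: inj_comp val_inj (can_inj gK).
split=> [Sx|[y <-]]; last by apply/asboolP; exact: (valP (g y)).
have xS : x \in subring_pred by apply/asboolP.
by exists (f (SubringElt xS)); rewrite /= fK.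
Qed.

End SubringDomain.

(** This is [F[X] / (X^d - a)], reduced to what is used of it: the coordinates [co x] in the basis
    of powers of [z], and the universal property of the root [z]. *)
Lemma kummer_field (F : fieldType) (d : nat) (a : F) : (1 < d)%N ->
  irreducible_poly ('X^d - a%:P) ->
  exists (L : fieldType) (iota : {rmorphism F -> L}) (z : L) (co : L -> nat -> F),
  [/\ z ^+ d = iota a,
      forall x, x = \sum_(i < d) iota (co x i) * z ^+ i,
      forall (c : nat -> F) (i : 'I_d), co (\sum_(j < d) iota (c j) * z ^+ j) i = c i &
      forall (E : comNzRingType) (f : {rmorphism F -> E}) (b : E), b ^+ d = f a ->
        exists H : {rmorphism L -> E}, (forall c, H (iota c) = f c) /\ H z = b].
Proof.
move=> d1 irr; have d0 := ltnW d1; set p := _ - _ in irr.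
have pm : p \is monic by exact: monicXnsubC.
pose pI : monic_irreducible_poly p := (irr, pm).
pose L : fieldType := {poly %/ p with pI}.
have mkE : mk_monic p = p by exact: (mk_monicE pI).
have sp : size p = d.+1 by rewrite size_XnsubC.
pose toL (q : {poly F}) : L := in_qpoly p q.
have [|| T TE] := @rmorphism_ex _ L toL.
- by move=> x y; rewrite /toL raddfB.
- by split; [exact: in_qpoly1|exact: in_qpolyM].
pose toP (x : L) : {poly F} := polyn (x : {poly %/ p}).
have toPK x : T (toP x) = x.
  rewrite TE; apply/val_inj/in_qpoly_small; exact: size_mk_monic.
have toTK (q : {poly F}) : (size q <= d)%N -> toP (T q) = q.
  by move=> qd; rewrite TE /toP /toL in_qpoly_small // mkE sp ltnS.
have size_toP x : (size (toP x) <= d)%N.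
  by rewrite -ltnS -sp -mkE; exact: (size_mk_monic (x : {poly %/ p})).
have Tp : T p = 0.
  by rewrite TE; apply: val_inj; rewrite /= mkE Pdiv.RingMonic.rmodpp.
exists L, (T \o polyC), (T 'X), (fun x i => (toP x)`_i); split.
- by apply/eqP; rewrite -rmorphXn -subr_eq0 -rmorphB /= Tp.
- move=> x; rewrite -[LHS]toPK -[toP x in LHS]coefK poly_def.
  rewrite (rmorph_sum T) -(big_mkord xpredT (fun i => T ((toP x)`_i *: 'X^i))).
  rewrite (big_nat_widen _ _ d) // big_mkcond /= big_mkord; apply: eq_bigr => i _.
  case: ltnP => [_|si]; first by rewrite -mul_polyC rmorphM rmorphXn.
  by rewrite nth_default // rmorph0 mul0r.
- move=> c i; rewrite (_ : \sum_(j < d) _ = T (\poly_(j < d) c j)).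
    by rewrite toTK ?size_poly // coef_poly ltn_ord.
  by rewrite poly_def rmorph_sum; apply: eq_bigr => j _; rewrite -mul_polyC rmorphM rmorphXn.
move=> E f b bd; pose H0 x := (map_poly f (toP x)).[b].
have H0T q : H0 (T q) = (map_poly f q).[b].
  rewrite [in RHS](Pdiv.RingMonic.rdivp_eq pm q) rmorphD rmorphM /= hornerD hornerM.
  rewrite [(map_poly f p).[b]](_ : _ = 0) ?mulr0 ?add0r.
    by rewrite /H0 TE /toP /= mkE.
  by rewrite rmorphB /= map_polyXn map_polyC hornerD hornerN hornerXn hornerC /= bd subrr.
have [|| H HE] := @rmorphism_ex L E H0.
- by move=> x y; rewrite -[x]toPK -[y]toPK -rmorphB !H0T rmorphB hornerD hornerN.
- split; first by rewrite -(rmorph1 T) H0T rmorph1 hornerC.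
  by move=> x y; rewrite -[x]toPK -[y]toPK -rmorphM !H0T rmorphM hornerM.
exists H; split=> [c|]; rewrite HE H0T /=; first by rewrite map_polyC hornerC.
by rewrite map_polyX hornerX.
Qed.

(** Turns generation tested against submodules, which is easy to assemble degree by degree, into the
    linear combinations that [finite_hom] asks for. *)
Lemma module_span (C D : comNzRingType) (phi : {rmorphism C -> D}) (T : seq D) :
  (forall J : set D, J 0 -> (forall x y, J x -> J y -> J (x + y)) ->
     (forall c x, J x -> J (phi c * x)) -> (forall x, x \in T -> J x) ->
     forall x, J x) ->
  forall x, exists c : nat -> C, x = \sum_(i < size T) phi (c i) * T`_i.
Proof.
move=> gen; apply: gen => [|_ _ [c ->] [e ->]|a _ [c ->]|x xT].
- by exists (fun=> 0); rewrite big1 // => i _; rewrite rmorph0 mul0r.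
- exists (fun i => c i + e i); rewrite -big_split; apply: eq_bigr => i _.
  by rewrite rmorphD mulrDl.
- exists (fun i => a * c i); rewrite mulr_sumr; apply: eq_bigr => i _.
  by rewrite rmorphM mulrA.
have si : (index x T < size T)%N by rewrite index_mem.
exists (fun i => (i == index x T)%:R); rewrite (bigD1 (Ordinal si)) //= eqxx rmorph1 mul1r.
rewrite nth_index // big1 ?addr0 // => i /negPf; rewrite -val_eqE /= => ->.
by rewrite rmorph0 mul0r.
Qed.

(** * Normal curves with a given radicand *)

Lemma integral_expn (R E : comNzRingType) (f : {rmorphism R -> E}) x n : (0 < n)%N ->
  integralOver f (x ^+ n) -> integralOver f x.
Proof.
move=> n0 int; apply: (integral_root_monic (monicXnsubC (x ^+ n) n0)).
  by rewrite rootE hornerD hornerN hornerXn hornerC subrr.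
apply/integral_poly => i; rewrite coefB coefXn coefC.
apply: integral_sub; first exact: integral_nat.
by case: eqP => // _; apply: integral0.
Qed.

Lemma integral_eq (R K : nzRingType) (f g : R -> K) x : f =1 g ->
  integralOver f x -> integralOver g x.
Proof. by move=> fg [p p_mon px]; exists p; rewrite // -(eq_map_poly fg). Qed.

Lemma integral_reflect (R L E : nzRingType) (f : {rmorphism R -> L})
    (H : {rmorphism L -> E}) (y : L) : injective H ->
  integralOver (H \o f) (H y) -> integralOver f y.
Proof.
move=> injH [p p_mon py]; exists p => //; move: py; rewrite !rootE map_poly_comp.
by rewrite horner_map -(rmorph0 H) (inj_eq injH).
Qed.

(** The determinant trick. Multiplication by [x] has a matrix [M] on the generators; the row [X] of
    generators is killed by [x - M], hence by its determinant, and 1 is a combination of the entries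
    of [X]. *)
Lemma finite_integral (A B : comNzRingType) (f : {rmorphism A -> B}) (T : seq B) :
  (forall b, exists c : nat -> A, b = \sum_(i < size T) f (c i) * T`_i) ->
  integralRange f.
Proof.
move=> gen x; pose n := size T; pose X : 'rV[B]_n := \row_i T`_i.
have [u uE] := gen 1.
have hM (j : 'I_n) : exists c : nat -> A, x * T`_j = \sum_(i < n) f (c i) * T`_i.
  exact: gen.
have [c cE] := fin_all_exists hM.
pose M : 'M[A]_n := \matrix_(i, j) c j i; pose N := x%:M - map_mx f M.
have XN : X *m N = 0.
  apply/eqP; rewrite mulmxBr mul_mx_scalar subr_eq0; apply/eqP/rowP => j.
  by rewrite !mxE cE; apply: eq_bigr => i _; rewrite !mxE mulrC.
exists (char_poly M); first exact: char_poly_monic.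
pose U : 'cV[B]_n := \col_i f (u i).
have XU : X *m U = 1%:M.
  apply/matrixP => i j; rewrite !mxE !ord1 eqxx uE.
  by apply: eq_bigr => l _; rewrite !mxE mulrC.
have: (\det N *: (X *m U)) 0 0 == 0.
  by rewrite scalemxAl -mul_mx_scalar -mul_mx_adj mulmxA XN !mul0mx mxE.
rewrite XU !mxE eqxx mulr1 rootE -horner_evalE -2!det_map_mx.
congr (\det _ == 0).
rewrite raddfB /= map_scalar_mx; apply/matrixP => i j.
by rewrite !mxE raddfB raddfMn /= map_polyX map_polyC /horner_eval !hornerE.
Qed.

(** * The grading by [Z/d] of a [mu_d]-action *)

Section Homogeneous.
Variables (d : nat) (k : fieldType) (A : affine_scheme k) (act : mu_action d A).
Hypothesis d_gt0 : (0 < d)%N.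

(** The degree is a natural number read modulo [d], so that degrees add without casts between
    ordinals. *)
Definition homogeneous (n : nat) (x : A) : Prop :=
  forall j : 'I_d, act j x = if j == (n %% d)%N :> nat then x else 0.

Lemma act0 i : act i 0 = 0.
Proof. by apply: (addrI (act i 0)); rewrite -coactD !addr0. Qed.

Lemma act_sum i (I : Type) (s : seq I) (P : pred I) (f : I -> A) :
  act i (\sum_(t <- s | P t) f t) = \sum_(t <- s | P t) act i (f t).
Proof. by apply: (big_morph (act i)); [exact: coactD|exact: act0]. Qed.

Lemma act_homogeneous (i : 'I_d) x : homogeneous i (act i x).
Proof.
move=> j; rewrite coact_coassoc modn_small // -val_eqE.
by case: eqVneq => // /val_inj ->.
Qed.

Lemma homogeneousM m n x y : homogeneous m x -> homogeneous n y ->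
  homogeneous (m + n) (x * y).
Proof.
move=> hx hy j; rewrite coactM.
have mP := ltn_pmod m d_gt0; have nP := ltn_pmod n d_gt0.
rewrite (bigD1 (Ordinal mP)) //= [X in _ + X]big1 ?addr0; last first.
  move=> i /negPf; rewrite -val_eqE /= => im.
  by rewrite big1 // => l _; rewrite hx im mul0r.
rewrite hx /= eqxx big_mkcond (bigD1 (Ordinal nP)) //= [X in _ + X]big1 ?addr0; last first.
  move=> i /negPf; rewrite -val_eqE /= => iN.
  by rewrite hy iN mulr0 if_same.
by rewrite hy /= eqxx modnDm eq_sym.
Qed.

Lemma homogeneous1 : homogeneous 0 1.
Proof. by move=> j; rewrite coact1 mod0n; case: eqP. Qed.

Lemma homogeneousX n x m : homogeneous n x -> homogeneous (n * m) (x ^+ m).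
Proof.
move=> hx; elim: m => [|m IH]; first by rewrite muln0 expr0; apply: homogeneous1.
by rewrite mulnS exprS; apply: homogeneousM.
Qed.

Lemma homogeneous_mod m n x : m = n %[mod d] -> homogeneous m x -> homogeneous n x.
Proof. by move=> mn hx j; rewrite hx mn. Qed.

Lemma act_mulr (i : 'I_d) x y : homogeneous 0 y -> act i (x * y) = act i x * y.
Proof.
move=> hy; rewrite -{1}(coact_counit act x) mulr_suml act_sum (bigD1 i) //=.
rewrite (homogeneousM (act_homogeneous i x) hy) addn0 modn_small // eqxx.
rewrite big1 ?addr0 // => j /negPf ji.
rewrite (homogeneousM (act_homogeneous j x) hy) addn0 modn_small //.
by rewrite -val_eqE /= eq_sym in ji; rewrite ji.
Qed.

End Homogeneous.

(** [X] contains in degree 1 a [d]-th root [s] of [r]; there is no relation with [uniformizer]. The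
    identification [phi] of the invariants is quantified together with [s], because changing it
    moves [r] by an automorphism of [C]. *)
Definition uniformized (d : nat) (k : fieldType) (C : affine_scheme k)
    (X : mu_curve d k) (r : C) : Prop :=
  exists (phi : {rmorphism C -> X}) (s : X),
  [/\ k_hom phi, injective phi, range phi = [set a | invariant a],
      homogeneous (mu_act X) 1 s & s ^+ d = phi r].

(** * Construction and uniqueness of the normal curve of a radicand *)

Section Model.
Variables (k : fieldType) (C : affine_scheme k) (d : nat) (r : C).
Hypotheses (smC : smooth_curve C) (d_gt1 : (1 < d)%N) (r0 : r != 0).
Let d_gt0 : (0 < d)%N := ltnW d_gt1.

Notation F := {fraction C}.
Variables (L : fieldType) (iota : {rmorphism F -> L}) (z : L) (co : L -> nat -> F).
Hypothesis zd : z ^+ d = iota (tofrac r).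
Hypothesis coE : forall x, x = \sum_(i < d) iota (co x i) * z ^+ i.
Hypothesis co_sum : forall (c : nat -> F) (i : 'I_d),
  co (\sum_(j < d) iota (c j) * z ^+ j) i = c i.
Hypothesis kummer_hom : forall (E : comNzRingType) (f : {rmorphism F -> E}) (b : E),
  b ^+ d = f (tofrac r) ->
  exists H : {rmorphism L -> E}, (forall c, H (iota c) = f c) /\ H z = b.

Let iC : {rmorphism C -> L} := iota \o @FracField.tofrac C.
Let comp (i : nat) x := iota (co x i) * z ^+ i.

Lemma iC_inj : injective iC.
Proof. by move=> a b /fmorph_inj/tofrac_inj. Qed.

Lemma kummer_z_neq0 : z != 0.
Proof.
apply: contraNneq r0 => z0; rewrite -tofrac_eq0 -(fmorph_eq0 iota) -zd z0.
by rewrite expr0n eqn0Ngt d_gt0.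
Qed.

Lemma coD (i : 'I_d) x y : co (x + y) i = co x i + co y i.
Proof.
rewrite {1}(coE x) {1}(coE y) -big_split /=.
rewrite -(co_sum (fun i => co x i + co y i)); congr (co _ _).
by apply: eq_bigr => j _; rewrite rmorphD mulrDl.
Qed.

Lemma coZ (i : 'I_d) c x : co (iota c * x) i = c * co x i.
Proof.
rewrite {1}(coE x) mulr_sumr.
rewrite -(co_sum (fun i => c * co x i)); congr (co _ _).
by apply: eq_bigr => j _; rewrite rmorphM mulrA.
Qed.

Lemma co_mon (i : 'I_d) c (n : nat) : (n < d)%N ->
  co (iota c * z ^+ n) i = if i == n :> nat then c else 0.
Proof.
move=> nd; rewrite -(co_sum (fun i => if i == n then c else 0)); congr (co _ _).
rewrite (bigD1 (Ordinal nd)) //= eqxx big1 ?addr0 // => j /negPf.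
by rewrite -val_eqE /= => ->; rewrite rmorph0 mul0r.
Qed.

Lemma compD (i : 'I_d) x y : comp i (x + y) = comp i x + comp i y.
Proof. by rewrite /comp coD rmorphD mulrDl. Qed.

Lemma comp0 (i : 'I_d) : comp i 0 = 0.
Proof. by apply: (addrI (comp i 0)); rewrite -compD !addr0. Qed.

Lemma comp_sumF (i : 'I_d) (I : Type) (s : seq I) (P : pred I) (f : I -> L) :
  comp i (\sum_(t <- s | P t) f t) = \sum_(t <- s | P t) comp i (f t).
Proof. by apply: (big_morph (comp i)); [exact: compD|exact: comp0]. Qed.

Lemma compZ (i : 'I_d) c x : comp i (iota c * x) = iota c * comp i x.
Proof. by rewrite /comp coZ rmorphM mulrA. Qed.

Lemma compN (i : 'I_d) x : comp i (- x) = - comp i x.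
Proof. by rewrite -mulN1r -(rmorph1 iota) -rmorphN compZ rmorphN rmorph1 mulN1r. Qed.

Lemma comp_mon (i : 'I_d) c n : comp i (iota c * z ^+ n) =
  if i == (n %% d)%N :> nat then iota c * z ^+ n else 0.
Proof.
have nd := ltn_pmod n d_gt0.
have zE : iota c * z ^+ n = iota (c * tofrac r ^+ (n %/ d)) * z ^+ (n %% d).
  by rewrite {1}(divn_eq n d) exprD mulnC exprM zd rmorphM rmorphXn mulrA.
rewrite zE /comp co_mon //; case: eqP => [->//|_]; by rewrite rmorph0 mul0r.
Qed.

Lemma comp_comp (i j : 'I_d) x : comp i (comp j x) = if i == j then comp i x else 0.
Proof.
rewrite {1}[comp j x]/comp comp_mon modn_small // -val_eqE /comp.
by case: eqVneq => // ->.
Qed.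

Lemma compM (n : 'I_d) x y : comp n (x * y) =
  \sum_(i < d) \sum_(j < d | ((i + j) %% d == n)%N) comp i x * comp j y.
Proof.
rewrite {1}(coE x) {1}(coE y) mulr_suml comp_sumF; apply: eq_bigr => i _.
rewrite mulr_sumr comp_sumF [RHS]big_mkcond; apply: eq_bigr => j _.
rewrite mulrACA -rmorphM -exprD comp_mon eq_sym.
by case: ifP => // _; rewrite rmorphM exprD mulrACA.
Qed.

(* Asking integrality of each component, rather than of [x], makes the ring
   graded. *)
Definition model_mem (x : L) : Prop := forall i : 'I_d, integralOver iC (comp i x).

Lemma model_mem_mon c n : integralOver iC (iota c * z ^+ n) ->
  model_mem (iota c * z ^+ n).
Proof. by move=> int i; rewrite comp_mon; case: ifP => // _; apply: integral0. Qed.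

Lemma model_memB x y : model_mem x -> model_mem y -> model_mem (x - y).
Proof. by move=> hx hy i; rewrite compD compN; apply: integral_sub. Qed.

Lemma model_memM x y : model_mem x -> model_mem y -> model_mem (x * y).
Proof.
move=> hx hy n; rewrite compM.
apply: (big_ind (integralOver iC)); [exact: integral0|exact: integral_add|move=> i _].
apply: (big_ind (integralOver iC)); [exact: integral0|exact: integral_add|move=> j _].
exact: integral_mul.
Qed.

Lemma model_mem_iC c : model_mem (iC c).
Proof.
by rewrite -[iC c]mulr1 -(expr0 z); apply: model_mem_mon; rewrite mulr1; apply: integral_id.
Qed.

Lemma integral_z : integralOver iC z.
Proof. by apply: (integral_expn d_gt0); rewrite zd; apply: (integral_id iC). Qed.

Lemma model_mem_z : model_mem z.
Proof.
rewrite -[z]mul1r -(rmorph1 iota) -[z in _ * z]expr1; apply: model_mem_mon.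
by rewrite rmorph1 mul1r expr1; apply: integral_z.
Qed.

Lemma integral_iota c : integralOver iC (iota c) -> exists b, c = tofrac b.
Proof.
move=> [p p_mon pc]; apply: integrally_closed; first exact: smooth_curve_regular.
exists p => //; move: pc; rewrite !rootE map_poly_comp horner_map fmorph_eq0 //.
Qed.

Lemma model_mem_int x : model_mem x -> integralOver iC x.
Proof.
move=> hx; rewrite (coE x).
apply: (big_ind (integralOver iC)); [exact: integral0|exact: integral_add|].
by move=> i _; apply: hx.
Qed.

(** Multiplying the component of degree [i] by [z ^+ (d - i)] gives [iota (co x i * tofrac r)],
    which is integral. Thus [r] is a common denominator for all coordinates. *)
Lemma model_co x (i : 'I_d) : model_mem x -> exists b, co x i * tofrac r = tofrac b.
Proof.
move=> hx; apply: integral_iota.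
have -> : iota (co x i * tofrac r) = comp i x * z ^+ (d - i).
  by rewrite /comp -mulrA -exprD subnKC ?zd ?rmorphM // ltnW.
apply: integral_mul; first exact: hx.
by elim: (d - i)%N => [|n IH]; rewrite ?expr0 ?exprS; [exact: integral1|
  apply: integral_mul => //; exact: integral_z].
Qed.

Variables (D : idomainType) (v : {rmorphism D -> L}).
Hypotheses (v_inj : injective v) (v_mem : forall x, model_mem x <-> exists y, v y = x).
Variables (phi : {rmorphism C -> D}) (s : D).
Hypotheses (phiE : forall c, v (phi c) = iC c) (sE : v s = z).

Lemma model_phi_inj : injective phi.
Proof. by move=> a b /(congr1 v); rewrite !phiE; apply: iC_inj. Qed.

Lemma model_v_mem y : model_mem (v y).
Proof. by apply/v_mem; exists y. Qed.

Lemma model_phi_integral : integralRange phi.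
Proof.
move=> x; have [p p_mon px] := model_mem_int (model_v_mem x).
exists p => //; move: px; rewrite !rootE (eq_map_poly (g := v \o phi)); last first.
  by move=> c; rewrite /= phiE.
by rewrite map_poly_comp horner_map -(rmorph0 v) (inj_eq v_inj).
Qed.

Lemma model_decomp (x : D) : exists rho : nat -> C,
  (forall i : 'I_d, tofrac (rho i) = co (v x) i * tofrac r) /\
  x * phi r = \sum_(i < d) phi (rho i) * s ^+ i.
Proof.
have h (i : 'I_d) : exists b, tofrac b = co (v x) i * tofrac r.
  by have [b ->] := model_co i (model_v_mem x); exists b.
have [f fE] := fin_all_exists h.
pose rho n := if insub n is Some i then f i else 0.
have rhoE (i : 'I_d) : rho i = f i by rewrite /rho valK.
exists rho; split=> [i|]; first by rewrite rhoE.
apply: v_inj; rewrite rmorphM phiE {1}(coE (v x)) mulr_suml rmorph_sum.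
apply: eq_bigr => i _; rewrite rmorphM rmorphXn sE phiE rhoE /= fE rmorphM /=.
by rewrite mulrAC.
Qed.

(** With [r] as common denominator, the piece of degree [i] consists of the [mon i b] for [b] in an
    ideal of [C], which is finitely generated. A trace argument would fail when the characteristic
    divides [d]. *)
Lemma model_module_finite : exists T : seq D,
  forall x, exists c : nat -> C, x = \sum_(i < size T) phi (c i) * T`_i.
Proof.
have noeC : noetherian C by apply: finite_type_noetherian; case: smC => -[].
pose mon (i : nat) b := iota (tofrac b / tofrac r) * z ^+ i.
have monD i a b : mon i (a + b) = mon i a + mon i b.
  by rewrite /mon tofracD mulrDl rmorphD mulrDl.
have monM i a b : mon i (a * b) = iC a * mon i b.
  by rewrite /mon tofracM -mulrA rmorphM mulrA.
have mon0 i : mon i 0 = 0 by rewrite /mon tofrac0 mul0r rmorph0 mul0r.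
have gens (i : 'I_d) : exists T : seq D, forall J : set D, J 0 ->
    (forall x y, J x -> J y -> J (x + y)) -> (forall c x, J x -> J (phi c * x)) ->
    (forall x, x \in T -> J x) -> forall x, v x = comp i (v x) -> J x.
  pose I := [set b | integralOver iC (mon i b)].
  have idI : is_ideal I.
    split; first by rewrite /I /= mon0; apply: integral0.
      by move=> a b; rewrite /I /= monD; apply: integral_add.
    move=> a b; rewrite /I /= monM => int; apply: integral_mul => //.
    exact: (integral_id iC).
  have [g [gI gen]] := noeC I idI.
  have lift t : (forall b, b \in t -> I b) ->
      exists T : seq D, [seq v y | y <- T] = [seq mon i b | b <- t].
    elim: t => [|b t IH] tI; first by exists [::].
    have [b' b't|T TE] := IH; first by apply: tI; rewrite inE b't orbT.
    have [y yE] : exists y, v y = mon i b.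
      by apply/v_mem/model_mem_mon/tI; rewrite inE eqxx.
    by exists (y :: T); rewrite /= yE TE.
  have [T TE] := lift g gI; exists T => J J0 JD JM JT x xi.
  have [b bE] := model_co i (model_v_mem x).
  have xE : v x = mon i b.
    by rewrite xi /mon -bE mulfK // tofrac_eq0.
  pose J' := [set c | exists2 y, J y & v y = mon i c].
  have [|||y Jy yE] := gen J' _ _ b.
  - split; first by exists 0; rewrite ?mon0 ?rmorph0.
      by move=> c e [y Jy yE] [y' Jy' yE']; exists (y + y'); rewrite ?rmorphD ?monD ?yE ?yE' //; apply: JD.
    by move=> c e [y Jy yE]; exists (phi c * y); rewrite ?rmorphM ?monM ?yE ?phiE //; apply: JM.
  - move=> c cg; have : mon i c \in [seq v y | y <- T] by rewrite TE map_f.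
    by move=> /mapP[y yT yE]; exists y; [exact: JT|].
  - by rewrite /I /= -xE xi; apply: model_v_mem.
  by have <- : y = x by apply: v_inj; rewrite yE xE.
have [T TP] := fin_all_exists gens.
exists (flatten [seq T i | i <- enum 'I_d]).
apply: module_span => J J0 JD JM JT x.
have comp_ex (i : 'I_d) : exists y, v y = comp i (v x).
  by apply/v_mem/model_mem_mon/model_v_mem.
have [y yE] := fin_all_exists comp_ex.
have -> : x = \sum_(i < d) y i.
  apply: v_inj; rewrite rmorph_sum {1}(coE (v x)).
  by apply: eq_bigr => i _; rewrite yE.
apply: (big_ind J) => // i _; apply: (TP i) => // [t tT|].
  by apply: JT; apply/flattenP; exists (T i) => //; apply: map_f; rewrite mem_enum.
by rewrite yE comp_comp eqxx.
Qed.

Definition model_scheme : affine_scheme k := AffineScheme (phi \o structure_map C).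

Fact model_act_ex (i : 'I_d) (x : D) : exists y, v y = comp i (v x).
Proof. by apply/v_mem/model_mem_mon/model_v_mem. Qed.

Definition model_coact (i : 'I_d) (x : model_scheme) : model_scheme :=
  projT1 (cid (model_act_ex i x)).

Lemma v_coact i x : v (model_coact i x) = comp i (v x).
Proof. by rewrite /model_coact; case: cid. Qed.

Lemma comp_iC (i : 'I_d) c : comp i (iC c) = if i == 0 :> nat then iC c else 0.
Proof. by rewrite -[iC c]mulr1 -(expr0 z) comp_mon mod0n. Qed.

Fact model_coactD : forall i a b,
  model_coact i (a + b) = model_coact i a + model_coact i b.
Proof. by move=> i a b; apply: v_inj; rewrite rmorphD !v_coact rmorphD compD. Qed.

Fact model_coactZ : forall i c a, model_coact i (structure_map model_scheme c * a) =
  structure_map model_scheme c * model_coact i a.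
Proof.
by move=> i c a; apply: v_inj; rewrite v_coact !rmorphM v_coact /= phiE compZ.
Qed.

Fact model_coact1 : forall i, model_coact i 1 = (i == 0 :> nat)%:R.
Proof.
move=> i; apply: v_inj; rewrite v_coact rmorph1 -(rmorph1 iC) comp_iC rmorph1.
by case: eqP; rewrite ?rmorph1 ?rmorph0.
Qed.

Fact model_coactM : forall (n : 'I_d) a b, model_coact n (a * b) =
  \sum_(i < d) \sum_(j < d | ((i + j) %% d == n)%N) model_coact i a * model_coact j b.
Proof.
move=> n a b; apply: v_inj; rewrite v_coact rmorphM compM rmorph_sum.
apply: eq_bigr => i _; rewrite rmorph_sum; apply: eq_bigr => j _.
by rewrite rmorphM !v_coact.
Qed.

Fact model_coact_counit : forall a, \sum_(i < d) model_coact i a = a.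
Proof.
move=> a; apply: v_inj; rewrite rmorph_sum [RHS]coE; apply: eq_bigr => i _.
by rewrite v_coact.
Qed.

Fact model_coact_coassoc : forall i j a,
  model_coact i (model_coact j a) = if i == j then model_coact i a else 0.
Proof.
move=> i j a; apply: v_inj; rewrite !v_coact comp_comp.
by case: eqP; rewrite ?v_coact ?rmorph0.
Qed.

Definition model_action : mu_action d model_scheme :=
  MuAction model_coactD model_coactZ model_coact1 model_coactM
    model_coact_counit model_coact_coassoc.

Lemma model_finite_type : finite_type model_scheme.
Proof.
have [[[t gent] _ _] _] := smC; have [T TP] := model_module_finite.
exists ([seq phi c | c <- t] ++ T) => S SK SB SM St; apply/seteqP; split=> // x _.
have S0 : S 0 by rewrite -(subrr (structure_map model_scheme 0)); apply: SB.
have SD a b : S a -> S b -> S (a + b).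
  by move=> Sa Sb; have := SB _ _ Sa (SB _ _ S0 Sb); rewrite sub0r opprK.
have SC c : S (phi c).
  suff : [set c | S (phi c)] c by [].
  rewrite (gent [set c | S (phi c)]) // => [a b|a b|a at_]; rewrite /= ?rmorphB ?rmorphM.
  - exact: SB.
  - exact: SM.
  - by apply: St; rewrite mem_cat map_f.
have [c ->] := TP x; apply: (big_ind S) => // i _; apply: SM => //.
by apply: St; rewrite mem_cat mem_nth ?orbT.
Qed.

Lemma model_krull_dim1 : krull_dim1 D.
Proof.
have [[_ _ dimC] _] := smC.
have zero_ideal : is_ideal [set 0 : D] by case: (prime0 D).
have zero1 : ~ [set 0 : D] 1 by case: (prime0 D).
split.
  have [Q [maxQ _]] := maximal_ideal_exists zero_ideal zero1.
  have [[a a0 Qa] _] := krull_dim1_maximal dimC (integral_preimage_maximal model_phi_integral maxQ).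
  exists [set 0], Q; split; [exact: prime0|exact: maximal_prime|].
  split=> [_ ->|h]; first by apply: ideal_zero; case: maxQ.
  have /= pa0 := h _ Qa; move/eqP: a0; apply; apply: model_phi_inj.
  by rewrite pa0 rmorph0.
case=> P [Q [S [PP QP SP [PQ QP'] [QS SQ]]]]; case: dimC => _; apply.
exists (phi @^-1` P), (phi @^-1` Q), (phi @^-1` S).
split; try exact: prime_preimage.
- split=> [a /PQ //|h]; apply: QP'.
  rewrite (integral_incomparable model_phi_integral PP QP PQ) //.
  by apply/seteqP; split=> // a /PQ.
- split=> [a /QS //|h]; apply: SQ.
  rewrite (integral_incomparable model_phi_integral QP SP QS) //.
  by apply/seteqP; split=> // a /QS.
Qed.

Lemma model_coact_rho (i : 'I_d) (x : D) (b : C) :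
  tofrac b = co (v x) i * tofrac r -> model_coact i x * s ^+ (d - i) = phi b.
Proof.
move=> bE; apply: v_inj; rewrite rmorphM rmorphXn v_coact sE phiE.
by rewrite -mulrA -exprD subnKC ?zd 1?ltnW // -rmorphM -bE.
Qed.

Lemma model_s_neq0 : s != 0.
Proof.
by apply/eqP => s0; move/eqP: kummer_z_neq0; rewrite -sE s0 rmorph0.
Qed.

(** Injectivity of [Psi] is proved degree by degree: coordinates along the powers of [z2] turn a
    vanishing image into relations in [C (x) K2], which functionals carry back to [D (x) K]. *)
Lemma model_geometrically_integral : good_radicand d r ->
  geometrically_integral model_scheme.
Proof.
move=> good K i B' jA jK tens.
have gi : geometrically_integral C by case: smC => -[].
have [K2 [i1 [B2 [j2 [jK2 [tens2 irr]]]]]] := good_radicand_irreducible gi d_gt0 good i.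
have j2_inj : injective j2 := tensor_inl_inj tens2.
have [f [_ fE]] := frac_map_morphism j2_inj.
pose g0 : {rmorphism K2 -> {fraction B2}} := (@FracField.tofrac B2) \o jK2.
have [L2 [iota2 [z2 [co2 [zd2 _ co_sum2 _]]]]] := kummer_field d_gt1 irr.
have [|H [Hiota Hz]] := @kummer_hom L2 (iota2 \o f) z2; first by rewrite zd2 /= fE.
pose g : {rmorphism K -> L2} := iota2 \o g0 \o i1.
have [|Psi [PsiA PsiK _]] := tens.2 L2 (H \o v) g.
  by move=> c; rewrite /= phiE /= Hiota /= fE tens2.1.
suff Psi_inj b : Psi b = 0 -> b = 0.
  by move=> a b ab; have /eqP := congr1 Psi ab; rewrite rmorphM rmorph0 mulf_eq0
    => /orP[]/eqP/Psi_inj; [left|right].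
have [t ->] := tensor_span tens b => Pt.
pose rho (x : D) := projT1 (cid (model_decomp x)).
have rhoE x (l : 'I_d) : tofrac (rho x l) = co (v x) l * tofrac r.
  by rewrite /rho; case: cid => ? [].
(* The coordinate of the image along [z2 ^+ l], multiplied by [r] to clear denominators. *)
have coef0 (l : 'I_d) : \sum_(x <- t) j2 (rho x.1 l) * jK2 (i1 x.2) = 0.
  have E0 : \sum_(l < d) iota2 (\sum_(x <- t) f (co (v x.1) l) * g0 (i1 x.2)) * z2 ^+ l = 0.
    rewrite -[RHS]Pt rmorph_sum; under eq_bigr do rewrite rmorph_sum mulr_suml.
    rewrite exchange_big; apply: eq_bigr => x _; rewrite rmorphM PsiA PsiK /=.
    rewrite {2}(coE (v x.1)) rmorph_sum mulr_suml; apply: eq_bigr => m _.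
    by rewrite !rmorphM rmorphXn Hiota Hz mulrAC.
  have := co_sum2 (fun l => \sum_(x <- t) f (co (v x.1) l) * g0 (i1 x.2)) l.
  rewrite E0 => E1; apply: tofrac_inj; rewrite tofrac0.
  have -> : 0 = co2 0 l * f (tofrac r).
    have := co_sum2 (fun=> 0) l; rewrite big1 => [->|m _]; first by rewrite mul0r.
    by rewrite rmorph0 mul0r.
  rewrite E1 mulr_suml rmorph_sum; apply: eq_bigr => x _.
  by rewrite mulrAC -rmorphM -rhoE fE rmorphM.
apply/(tensor_nullP tens) => lam lamP.
apply: (fmorph_inj i1); rewrite rmorph0 /contract rmorph_sum.
(* Multiplication by [s ^+ (d - l)] is injective and sends the piece of degree [l] into [phi C].
   Extending [lam] along it and restricting to [C] gives a functional to which [coef0 l] applies. *)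
have part (l : 'I_d) : \sum_(x <- t) i1 (i (lam (model_coact l x.1))) * i1 x.2 = 0.
  have s_inj : injective (fun y : D => y * s ^+ (d - l)).
    by apply: mulIf; rewrite expf_neq0 // model_s_neq0.
  have [||lam1 lam1P lam1E] := @functional_extension k D D
    (structure_map model_scheme) (structure_map model_scheme) _ s_inj _ _ lam lamP.
  - by move=> y1 y2; rewrite mulrDl.
  - by move=> c y1; rewrite mulrA.
  have lam'P : functional (structure_map C) (lam1 \o phi).
    by split=> [c1 c2|c c1] /=; rewrite ?rmorphD ?lam1P.1 ?rmorphM ?(lam1P.2 c).
  have := (tensor_nullP tens2 [seq (rho x.1 l, i1 x.2) | x <- t]).1.
  rewrite big_map => /(_ (coef0 l) _ lam'P); rewrite /contract big_map => E2.
  rewrite -[RHS]E2; apply: eq_bigr => x _ /=.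
  by rewrite -lam1E (model_coact_rho (rhoE x.1 l)).
transitivity (\sum_(l < d) \sum_(x <- t) i1 (i (lam (model_coact l x.1))) * i1 x.2).
  rewrite exchange_big; apply: eq_bigr => x _; rewrite rmorphM -mulr_suml.
  rewrite -!rmorph_sum -(functional_sum _ _ _ lamP); congr (i1 (i (lam _)) * _).
  by rewrite model_coact_counit.
by rewrite big1 // => l _; apply: part.
Qed.

Hypothesis good : good_radicand d r.

Fact model_affine_curve : affine_curve model_scheme.
Proof.
split; [exact: model_finite_type|exact: model_geometrically_integral|exact: model_krull_dim1].
Qed.

Definition model_curve : mu_curve d k := MuCurve model_affine_curve model_action.

Lemma model_phi_homogeneous c : homogeneous model_action 0 (phi c).
Proof.
move=> i; apply: v_inj; rewrite v_coact phiE comp_iC mod0n.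
by case: eqP; rewrite ?phiE ?rmorph0.
Qed.

Lemma model_s_homogeneous : homogeneous model_action 1 s.
Proof.
move=> i; apply: v_inj; rewrite v_coact sE -[z]mul1r -(rmorph1 iota) -[z in _ * z]expr1.
rewrite comp_mon; case: eqP; rewrite ?rmorph0 // => _.
by rewrite rmorph1 mul1r expr1 sE.
Qed.

Lemma model_range_phi : range phi = [set a : model_curve | invariant a].
Proof.
apply/seteqP; split=> [_ [c _ <-] i|x inv] /=.
  by have := model_phi_homogeneous c i; rewrite mod0n.
have := inv (Ordinal d_gt0); rewrite /= => xE.
have vx : v x = iota (co (v x) 0).
  by rewrite -[in LHS]xE v_coact /comp expr0 mulr1.
have [b bE] : exists b, co (v x) 0 = tofrac b.
  by apply: integral_iota; rewrite -vx; apply/model_mem_int/model_v_mem.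
by exists b => //; apply: v_inj; rewrite phiE vx bE.
Qed.

Lemma model_s_exp : s ^+ d = phi r.
Proof. by apply: v_inj; rewrite rmorphXn sE zd phiE. Qed.

Lemma model_k_hom : k_hom (A := C) (B := model_scheme) phi.
Proof. by []. Qed.

Lemma model_uniformized : uniformized model_curve r.
Proof.
exists phi, s; split; [exact: model_k_hom|exact: model_phi_inj|
  exact: model_range_phi|exact: model_s_homogeneous|exact: model_s_exp].
Qed.

Lemma model_has_quotient : has_quotient C model_curve.
Proof.
by exists phi; split; [exact: model_k_hom|exact: model_phi_inj|exact: model_range_phi].
Qed.

Lemma model_faithful : faithful model_curve.
Proof.
move=> e ed /(_ s) triv; have [|e1] := boolP (e %| 1)%N; first by rewrite dvdn1 => /eqP.
move/eqP: model_s_neq0; case; rewrite -triv big1 // => i ei.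
have := model_s_homogeneous i; rewrite modn_small //= => ->; case: eqP => // i1.
by move: e1; rewrite -i1 ei.
Qed.

(** [L] plays the part of the fraction field of [D]. The map [H] is determined by [C] and [s], and
    it agrees with [th] on all of [D] because multiplication by [r] brings [D] into [C[s]]. *)
Lemma model_hom (X : idomainType) (th : {rmorphism D -> X}) : injective th ->
  exists H : {rmorphism L -> {fraction X}}, forall x, H (v x) = tofrac (th x).
Proof.
move=> th_inj; have [f [_ fE]] := frac_map_morphism (inj_comp th_inj model_phi_inj).
have [|H [Hi Hz]] := @kummer_hom {fraction X} f (tofrac (th s)).
  by rewrite fE -tofracXn -rmorphXn model_s_exp.
exists H => x; have [rho [_ xE]] := model_decomp x.
have HC c : H (v (phi c)) = tofrac (th (phi c)) by rewrite phiE /= Hi fE.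
have pr0 : phi r != 0 by apply: rmorph_neq0 r0; apply: model_phi_inj.
apply: (mulIf (x := H (v (phi r)))).
  by rewrite fmorph_eq0 -(rmorph0 v) (inj_eq v_inj).
rewrite -rmorphM -rmorphM xE HC -tofracM -rmorphM xE !rmorph_sum.
by apply: eq_bigr => i _; rewrite !rmorphM !rmorphXn HC sE Hz.
Qed.

(** A homogeneous [w] in [X'] is a fraction of elements of [D], and so comes from a monomial of [L].
    Finiteness makes [w] integral over [C], so this monomial belongs to the model. *)
Lemma model_normal : mu_normal model_curve.
Proof.
move=> X' th k_th eq_th [T genT] [th_inj [unfrac _ fracK]].
have [H HE] := model_hom th_inj.
have [Phi [PhiE PhiF]] := frac_map_morphism th_inj.
apply: inj_surj_bijective => // x'.
suff im (i : 'I_d) : exists y, th y = mu_act X' i x'.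
  have [y yE] := fin_all_exists im; exists (\sum_(i < d) y i).
  by rewrite rmorph_sum -[RHS](coact_counit (mu_act X')); apply: eq_bigr => i _.
set w := mu_act X' i x'.
have [a [b [b0 qE]]] := fracP (unfrac (tofrac w)).
have wb : w * th b = th a.
  apply: tofrac_inj; rewrite tofracM -!PhiF -[tofrac w]fracK qE -PhiE.
  by rewrite fmorph_div divfK // fmorph_eq0 tofrac_eq0.
(* The ideal of [b] meets [C]. With a denominator of degree 0, the numerator can be replaced by its
   component of degree [i]. *)
have [||c pc0 [b' cE]] := integral_ideal_neq0 model_phi_integral
  (I := [set y | exists b', y = b * b']) (b := b) _ _ b0.
- split; first by exists 0; rewrite mulr0.
    by move=> _ _ [b1 ->] [b2 ->]; exists (b1 + b2); rewrite mulrDr.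
  by move=> e _ [b1 ->]; exists (e * b1); rewrite mulrCA.
- by exists 1; rewrite mulr1.
have wc : w * th (phi c) = th (a * b') by rewrite cE !rmorphM mulrA wb.
have thc : homogeneous (mu_act X') 0 (th (phi c)).
  move=> j; rewrite -eq_th; have /= -> := model_phi_homogeneous c j.
  by case: ifP; rewrite ?rmorph0.
pose u : D := model_coact i (a * b').
have uE : th u = w * th (phi c).
  rewrite -[u]/(mu_act model_curve i (a * b')) eq_th -wc act_mulr //.
  by rewrite /w coact_coassoc eqxx.
pose c' := co (v u) i / tofrac c.
have c0 : tofrac c != 0 :> {fraction C}.
  by rewrite tofrac_eq0; apply: contraNneq pc0 => ->; rewrite rmorph0.
have yE : iota c' * z ^+ i = v u / iC c.
  rewrite /c' fmorph_div mulrAC; congr (_ / _).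
  by rewrite -/(comp i (v u)) v_coact comp_comp eqxx.
have Hy : H (iota c' * z ^+ i) = tofrac w.
  rewrite yE fmorph_div -phiE !HE uE tofracM mulfK //.
  by rewrite tofrac_eq0; apply: rmorph_neq0 pc0.
have [|y vy] := (v_mem (iota c' * z ^+ i)).1.
  apply/model_mem_mon/(integral_reflect (H := H)); first exact: fmorph_inj.
  rewrite Hy; have thI := finite_integral genT.
  apply: (integral_eq (f := @FracField.tofrac X' \o (th \o phi))).
    by move=> e; rewrite /= -HE phiE.
  exact: (integral_rmorph (@FracField.tofrac X')
    (integral_trans model_phi_integral (thI w))).
by exists y; apply: tofrac_inj; rewrite -HE vy Hy.
Qed.

(** If [w] has degree [i], both [w * sX ^+ (d - i)] and [w ^+ d] lie in [C]: the first makes [w] a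
    monomial of [L], the second makes it integral. So [X] embeds in the model, finitely because the
    model is finite over [C], birationally because [r] brings it into [C[s]]; normality of [X] does
    the rest. *)
Lemma model_unique (X : mu_curve d k) : mu_normal X -> uniformized X r ->
  mu_isomorphic X model_curve.
Proof.
move=> normX [fX [sX [kX fX_inj fX_range sX1 sXd]]].
have [f [_ fE]] := frac_map_morphism fX_inj.
have [|H [Hi Hz]] := @kummer_hom {fraction X} f (tofrac sX).
  by rewrite fE -tofracXn sXd.
have H_inj : injective H by exact: fmorph_inj.
have inv_ex x : homogeneous (mu_act X) 0 x -> exists c, fX c = x.
  move=> hx; suff : range fX x by case=> c _ <-; exists c.
  by rewrite fX_range => i; rewrite hx mod0n.
have fr0 : tofrac (fX r) != 0 :> {fraction X}.
  by rewrite tofrac_eq0; apply: rmorph_neq0 r0.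
have part (i : 'I_d) x : exists y : D, [/\ H (v y) = tofrac (mu_act X i x) &
    v y = comp i (v y)].
  set w := mu_act X i x.
  have hw : homogeneous (mu_act X) i w by apply: act_homogeneous.
  have [|b bE] := inv_ex (w * sX ^+ (d - i)).
    apply: homogeneous_mod (homogeneousM d_gt0 hw (homogeneousX d_gt0 (d - i) sX1)).
    by rewrite mul1n subnKC 1?ltnW // modnn mod0n.
  have Hy : H (iota (tofrac b / tofrac r) * z ^+ i) = tofrac w.
    rewrite rmorphM rmorphXn Hi Hz fmorph_div !fE bE -tofracXn mulrAC -tofracM.
    by rewrite -mulrA -exprD subnK 1?ltnW // sXd tofracM mulfK.
  have [|y vy] := (v_mem (iota (tofrac b / tofrac r) * z ^+ i)).1.
    apply/model_mem_mon/(integral_expn d_gt0).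
    have [|c cE] := inv_ex (w ^+ d).
      apply: homogeneous_mod (homogeneousX d_gt0 d hw).
      by rewrite modnMl mod0n.
    rewrite (_ : _ ^+ d = iC c); first exact: (integral_id iC).
    by apply: H_inj; rewrite rmorphXn Hy /= Hi fE cE tofracXn.
  by exists y; rewrite vy Hy comp_mon modn_small // eqxx.
pose H' : {rmorphism D -> {fraction X}} := H \o v.
have H'_inj : injective H' by exact: inj_comp H_inj v_inj.
have [|chi chiE] := lift_rmorphism (g := @FracField.tofrac X) H'_inj.
  move=> x; have im (i : 'I_d) : exists y : D, H' y = tofrac (mu_act X i x).
    by have [y [yE _]] := part i x; exists y.
  have [y yE] := fin_all_exists im; exists (\sum_(i < d) y i).
  by rewrite rmorph_sum -[x in RHS](coact_counit (mu_act X) x) rmorph_sum; apply: eq_bigr.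
have chi_phi c : chi (fX c) = phi c.
  by apply: H'_inj; rewrite chiE /= phiE /= Hi fE.
have chi_s : chi sX = s by apply: H'_inj; rewrite chiE /= sE Hz.
have chi_inj : injective chi.
  by move=> x y /(congr1 H'); rewrite !chiE; apply: tofrac_inj.
have chi_k : k_hom (A := X) (B := model_curve) chi.
  by move=> c; rewrite -kX chi_phi.
have chi_eq : equivariant (Y := model_curve) chi.
  move=> i x; apply: v_inj; rewrite v_coact -{2}(coact_counit (mu_act X) x).
  rewrite !rmorph_sum comp_sumF.
  have vchi j : v (chi (mu_act X j x)) = comp j (v (chi (mu_act X j x))).
    have [y [yE yh]] := part j x.
    by have -> : chi (mu_act X j x) = y by apply: H'_inj; rewrite chiE.
  rewrite (bigD1 i) //= -vchi big1 ?addr0 // => j /negPf ji.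
  by rewrite vchi comp_comp eq_sym ji.
exists chi; split=> //; apply: normX => //.
  have [T TP] := model_module_finite; exists T => b; have [c ->] := TP b.
  by exists (fX \o c); apply: eq_bigr => i _; rewrite /= chi_phi.
split=> //; have [Phi [PhiE PhiF]] := frac_map_morphism chi_inj.
apply: inj_surj_bijective => [x y|q]; first by rewrite -!PhiE => /fmorph_inj.
have pre (a : D) : exists x, chi x = a * phi r.
  have [rho [_ ->]] := model_decomp a.
  exists (\sum_(i < d) fX (rho i) * sX ^+ i); rewrite rmorph_sum.
  by apply: eq_bigr => i _; rewrite rmorphM rmorphXn chi_phi chi_s.
have [a [b [b0 ->]]] := fracP q.
have [x xE] := pre a; have [y yE] := pre b.
exists (tofrac x / tofrac y); rewrite -PhiE fmorph_div !PhiF xE yE !tofracM.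
rewrite -mulf_div divff ?mulr1 // tofrac_eq0.
by apply: rmorph_neq0 r0; apply: model_phi_inj.
Qed.

End Model.

Lemma model_existence (k : fieldType) (C : affine_scheme k) (d : nat) (r : C) :
  smooth_curve C -> (1 < d)%N -> good_radicand d r ->
  exists M : mu_curve d k,
    [/\ faithful M, mu_normal M, has_quotient C M, uniformized M r &
        forall X : mu_curve d k, mu_normal X -> uniformized X r -> mu_isomorphic X M].
Proof.
move=> smC d1 good; have [r0 _] := good.
have gi : geometrically_integral C by case: smC => -[].
have [K2 [i1 [B [j [jK [tens irrB]]]]]] :=
  good_radicand_irreducible gi (ltnW d1) good idfun.
have [f [_ fE]] := frac_map_morphism (tensor_inl_inj tens).
have irr : irreducible_poly ('X^d - (tofrac r)%:P).
  by apply: (irreducible_poly_map (f := f)); rewrite rmorphB /= map_polyXn map_polyC /= fE.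
have [L [iota [z [co [zd coE co_sum hom]]]]] := kummer_field d1 irr.
have mem_iC c : model_mem d iota z co ((iota \o @FracField.tofrac C) c).
  exact: (model_mem_iC d1 zd co_sum).
have mem1 : model_mem d iota z co 1.
  by have := mem_iC 1; rewrite rmorph1.
have [D [v [v_inj v_mem]]] := subring_domain mem1
  (model_memB coE co_sum) (model_memM d1 zd coE co_sum).
have [|phi phiE] := lift_rmorphism (g := iota \o @FracField.tofrac C) v_inj.
  by move=> c; apply/v_mem/mem_iC.
have [s sE] : exists s, v s = z by apply/v_mem; apply: (model_mem_z d1 zd co_sum).
exists (model_curve smC d1 r0 zd coE co_sum hom v_inj v_mem phiE sE good).
split.
- exact: model_faithful.
- exact: model_normal.
- exact: model_has_quotient.
- exact: model_uniformized.
- by move=> X; apply: model_unique.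
Qed.

(** * Geometric integrality excludes roots of the radicand *)

Section UniformizedGood.
Variables (d : nat) (k : fieldType) (C : affine_scheme k) (X : mu_curve d k) (r : C).
Hypotheses (d_gt1 : (1 < d)%N) (r0 : r != 0).
Let d_gt0 : (0 < d)%N := ltnW d_gt1.

(* An [e]-th root [b1 / b2] of [r] splits [s ^+ d - r] over the base change; the
   functionals through degree 0 show that neither factor vanishes. *)
Lemma uniformized_good : uniformized X r -> good_radicand d r.
Proof.
move=> [phi [s [k_phi phi_inj range_phi s1 sd]]]; split=> //.
move=> K i alg B j jK tens e h e2 ed /root_num_den[b1 [b2 [b20 E]]].
have [_ giX _] := mu_curveP X.
have [jA [jC [tensT _]]] := tensor_existence (structure_map X) i.
have domT := giX _ _ _ _ _ tensT.
have [|theta [thA thC _]] := tens.2 _ (jA \o phi) jC.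
  by move=> c; rewrite /= k_phi tensT.1.
have zero_phi c : homogeneous (mu_act X) 0 (phi c).
  have : range phi (phi c) by exists c.
  by rewrite range_phi => inv l; rewrite mod0n; apply: inv.
have pi_ex x : exists c, phi c = mu_act X (Ordinal d_gt0) x.
  suff : range phi (mu_act X (Ordinal d_gt0) x) by case=> c _ <-; exists c.
  rewrite range_phi => l; have := act_homogeneous (mu_act X) (Ordinal d_gt0) x l.
  by rewrite mod0n.
pose pr x := projT1 (cid (pi_ex x)).
have prE x : phi (pr x) = mu_act X (Ordinal d_gt0) x by rewrite /pr; case: cid.
have b10 : b1 != 0.
  apply/eqP => b10; move/eqP: E; rewrite b10 expr0n eqn0Ngt (ltnW e2) eq_sym.
  rewrite mulf_eq0 (negPf (rmorph_neq0 (tensor_inl_inj tens) r0)) /=.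
  by rewrite expf_eq0 (negPf b20) andbF.
(* The functional is one on [C] composed with the projection to degree 0, so [Lam] detects [theta b]
   and ignores everything of degree strictly between 0 and [d]. *)
have key (b : B) : b != 0 -> exists Lam : tensor (structure_map X) i -> K,
    [/\ forall u w, Lam (u + w) = Lam u + Lam w, Lam (theta b) != 0 &
        forall n c, (0 < n < d)%N -> Lam (jA s ^+ n * theta c) = 0].
  move=> b0; have [t bE] := tensor_span tens b.
  have [lam0 lam0P lam0b] : exists2 lam, functional (structure_map C) lam &
      contract i lam t != 0.
    apply: contrapT => no; move/eqP: b0; apply; rewrite bE.
    apply/(tensor_nullP tens) => lam lamP; apply: contrapT => /eqP ?.
    by apply: no; exists lam.
  have lamP : functional (structure_map X) (lam0 \o pr).
    split=> [x y|c x] /=; [rewrite -lam0P.1|rewrite -lam0P.2]; congr (lam0 _);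
      apply: phi_inj; rewrite prE ?coactD ?rmorphD ?prE //.
    by rewrite coactZ rmorphM prE k_phi.
  have [Lam [LamD LamE]] := tensor_contraction tensT lamP.
  have expand n c : exists2 t, c = \sum_(x <- t) j x.1 * jK x.2 &
      jA s ^+ n * theta c = \sum_(x <- [seq (s ^+ n * phi x.1, x.2) | x <- t]) jA x.1 * jC x.2.
    have [t' ->] := tensor_span tens c; exists t' => //.
    rewrite rmorph_sum mulr_sumr big_map; apply: eq_bigr => x _.
    by rewrite rmorphM thA thC /= rmorphM rmorphXn mulrA.
  exists Lam; split=> // [|n c nd].
    have -> : theta b = \sum_(x <- [seq (phi x.1, x.2) | x <- t]) jA x.1 * jC x.2.
      by rewrite bE rmorph_sum big_map; apply: eq_bigr => x _; rewrite rmorphM thA thC.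
    rewrite LamE /contract big_map; apply: contraNneq lam0b => <-; apply/eqP.
    apply: eq_bigr => x _ /=; congr (i (lam0 _) * _); apply: phi_inj.
    by rewrite prE (zero_phi x.1) mod0n.
  have [t' _ ->] := expand n c; rewrite LamE /contract big_map big1 // => x _ /=.
  rewrite (_ : pr _ = 0) ?(functional0 lam0P) ?rmorph0 ?mul0r //.
  apply: phi_inj; rewrite prE rmorph0.
  have := homogeneousM d_gt0 (homogeneousX d_gt0 n s1) (zero_phi x.1) (Ordinal d_gt0).
  move=> ->; rewrite mul1n addn0 modn_small; last by case/andP: nd.
  by case/andP: nd => n0 _; rewrite /= eq_sym eqn0Ngt n0.
pose m := (d %/ e)%N; have me : (m * e)%N = d by rewrite divnK.
have m0 : (0 < m)%N by move: d_gt0; rewrite -me; case: (m).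
have md : (m < d)%N by rewrite -me -{1}[m]muln1 ltn_mul2l m0.
pose xx := jA s ^+ m * theta b2.
have : (xx - theta b1) * (\sum_(l < e) xx ^+ (e.-1 - l) * theta b1 ^+ l) = 0.
  rewrite -subrXX exprMn -exprM me -!rmorphXn E sd rmorphM -[jA (phi r)]/((jA \o phi) r).
  by rewrite -thA subrr.
have Lam0 (Lam : tensor (structure_map X) i -> K) :
    (forall u w, Lam (u + w) = Lam u + Lam w) -> Lam 0 = 0.
  by move=> LamD; apply: (addrI (Lam 0)); rewrite -LamD !addr0.
(* In degree 0 the first factor is [- theta b1] and the second is [theta b1 ^+ e.-1]: the other
   terms contain [jA s] to the power [m * (e.-1 - l)], strictly between 0 and [d]. *)
case/domT => [x0|y0].
  have [Lam [LamD Lamb Lam_hom]] := key b1 b10.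
  move/eqP: Lamb; apply; have := Lam_hom m b2; rewrite m0 md => /(_ isT) <-.
  by congr Lam; apply/esym/eqP; rewrite -subr_eq0 x0.
have e0 : (0 < e)%N by apply: ltnW.
have [Lam [LamD Lamb Lam_hom]] := key (b1 ^+ e.-1) (expf_neq0 _ b10).
move/eqP: Lamb; apply; rewrite -(Lam0 Lam LamD) -y0 -(prednK e0) big_ord_recr /=.
rewrite subnn expr0 mul1r rmorphXn LamD (big_morph Lam LamD (Lam0 Lam LamD)).
rewrite big1 ?add0r // => l _.
rewrite exprMn -exprM -mulrA -!(rmorphXn theta) -rmorphM Lam_hom //.
rewrite muln_gt0 m0 subn_gt0 ltn_ord /= -me ltn_mul2l m0 /=.
by apply: leq_ltn_trans (leq_subr _ _) _; rewrite ltn_predL.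
Qed.

End UniformizedGood.

(** The degrees of nonzero homogeneous elements are closed under addition, as [X] is a domain. They
    are multiples of the least positive one, [e], so [mu_e] acts trivially and [e] must be 1. *)
Lemma faithful_uniformized (d : nat) (k : fieldType) (C : affine_scheme k)
    (X : mu_curve d k) : (1 < d)%N -> faithful X -> has_quotient C X ->
  exists2 r : C, r != 0 & uniformized X r.
Proof.
move=> d1 faithX [phi [k_phi phi_inj range_phi]]; have d0 := ltnW d1.
pose P n := exists2 x : X, x != 0 & homogeneous (mu_act X) n x.
have PD m n : P m -> P n -> P (m + n)%N.
  by move=> [x x0 hx] [y y0 hy]; exists (x * y); [rewrite mulf_neq0|apply: homogeneousM].
have P0 : P 0%N by exists 1; [exact: oner_neq0|exact: homogeneous1].
have Pmod m n : m = n %[mod d] -> P m -> P n.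
  by move=> mn [x x0 hx]; exists x => //; apply: homogeneous_mod hx.
have PM m n : P n -> P (m * n)%N.
  by move=> Pn; elim: m => // m IH; rewrite mulSn; apply: PD.
have Pd : P d by apply: Pmod P0; rewrite modnn mod0n.
have [|e /asboolP[e0 Pe] mine] := @ex_minnP (fun n => `[< (0 < n)%N /\ P n >]).
  by exists d; apply/asboolP.
have eP n : P n -> (e %| n)%N.
  move=> Pn; have [km kn km_kn _] := egcdnP n e0.
  have g0 : (0 < gcdn e n)%N by rewrite gcdn_gt0 e0.
  (* Bezout without subtraction: modulo [d], the coefficient [- kn] is replaced by [kn * d.-1]. *)
  have Pg : P (gcdn e n).
    apply: Pmod (PD _ _ (PM km _ Pe) (PM (kn * d.-1)%N _ Pn)).
    by rewrite km_kn addnAC [(kn * d.-1 * n)%N]mulnAC -mulnS prednK // modnMDl.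
  have : (e <= gcdn e n)%N by apply: mine; apply/asboolP.
  move=> eg; apply/gcdn_idPl/eqP; rewrite eqn_leq eg andbT.
  exact: dvdn_leq (dvdn_gcdl _ _).
have e1 : e = 1%N.
  apply: faithX; first exact: eP.
  move=> a; rewrite -[RHS](coact_counit (mu_act X)) [RHS](bigID (fun i : 'I_d => (e %| i)%N)) /=.
  rewrite [X in _ + X]big1 ?addr0 // => i ei; apply: contrapT => /eqP ai.
  by move/negP: ei; apply; apply: eP; exists (mu_act X i a) => //; apply: act_homogeneous.
have [s s0 s1] : P 1%N by rewrite -e1.
have : range phi (s ^+ d).
  rewrite range_phi => l; have := homogeneousX d0 d s1 l.
  by rewrite mul1n modnn.
case=> r _ rE; exists r; last by exists phi, s.
by apply: contraNneq (expf_neq0 d s0) => r0; rewrite -rE r0 rmorph0.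
Qed.

(** * Isomorphisms of curves and equivalence of radicands *)

Section Isomorphisms.
Variables (d : nat) (k : fieldType).
Implicit Types X Y Z : mu_curve d k.

Lemma mu_isomorphic_refl X : mu_isomorphic X X.
Proof. by exists idfun; split=> //; exists idfun. Qed.

Lemma mu_isomorphic_sym X Y : mu_isomorphic X Y -> mu_isomorphic Y X.
Proof.
move=> [f [kf ef /rmorphism_inverse[g [fK gK]]]].
exists g; split; last by exists f.
- by move=> c; apply: (can_inj fK); rewrite gK kf.
- by move=> i a; apply: (can_inj fK); rewrite gK ef gK.
Qed.

Lemma mu_isomorphic_trans X Y Z :
  mu_isomorphic X Y -> mu_isomorphic Y Z -> mu_isomorphic X Z.
Proof.
move=> [f [kf ef bf]] [g [kg eg bg]]; exists (g \o f); split.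
- by move=> c; rewrite /= kf kg.
- by move=> i a; rewrite /= ef eg.
- exact: bij_comp.
Qed.

Variable C : affine_scheme k.

Definition equivalent_radicands (r r' : C) : Prop :=
  exists (psi : {rmorphism C -> C}) (c : {fraction C}),
  [/\ k_hom (A := C) (B := C) psi, bijective psi, c != 0 &
      tofrac (psi r) = c ^+ d * tofrac r'].

Lemma uniformized_scale X (r c : C) : (0 < d)%N ->
  uniformized X r -> uniformized X (c ^+ d * r).
Proof.
move=> d0 [phi [s [k_phi phi_inj range_phi s1 sd]]].
exists phi, (phi c * s); split=> //; last by rewrite exprMn sd rmorphM rmorphXn.
rewrite -[1%N]add0n; apply: homogeneousM => // l.
have : range phi (phi c) by exists c.
by rewrite range_phi => inv; rewrite mod0n; apply: inv.
Qed.

Lemma uniformized_automorphism X (r : C) (psi : {rmorphism C -> C}) :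
  k_hom (A := C) (B := C) psi -> bijective psi ->
  uniformized X r -> uniformized X (psi r).
Proof.
move=> k_psi /rmorphism_inverse[g [psiK gK]].
move=> [phi [s [k_phi phi_inj range_phi s1 sd]]].
exists (phi \o g), s; split=> //; last by rewrite /= psiK.
- by move=> c; rewrite /= -[structure_map C c]k_psi psiK k_phi.
- exact: inj_comp phi_inj (can_inj gK).
- rewrite -range_phi; apply/seteqP; split=> [_ [c _ <-]|_ [c _ <-]].
    by exists (g c).
  by exists (psi c) => //=; rewrite psiK.
Qed.

(** An isomorphism restricts to [psi] on the invariants, and the factor compares the two roots in
    degree 1. Conversely, with [c = c1 / c2], both curves are uniformized by
    [c2 ^+ d * psi r = c1 ^+ d * r'], and the normal curve of that radicand is unique. *)
Lemma uniformized_isomorphic X Y (r r' : C) : smooth_curve C -> (1 < d)%N ->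
    r != 0 -> r' != 0 -> mu_normal X -> mu_normal Y ->
    uniformized X r -> uniformized Y r' ->
  mu_isomorphic X Y <-> equivalent_radicands r r'.
Proof.
move=> smC d1 r0 r'0 normX normY uX uY; have d0 := ltnW d1.
split=> [[th [k_th eq_th bij_th]]|[psi [c [k_psi bij_psi c0 E]]]]; last first.
  have psi_inj := bij_inj bij_psi.
  have [c1 [c2 [c20 cE]]] := fracP c.
  have c10 : c1 != 0 by apply: contraNneq c0 => c10; rewrite cE c10 tofrac0 mul0r.
  have E1 : c2 ^+ d * psi r = c1 ^+ d * r'.
    apply: tofrac_inj; rewrite !tofracM E cE expr_div_n -!tofracXn mulrA.
    by rewrite mulrCA divff ?mulr1 // tofrac_eq0 expf_neq0.
  have uX' := uniformized_scale c2 d0 (uniformized_automorphism k_psi bij_psi uX).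
  have uY' := uniformized_scale c1 d0 uY.
  rewrite E1 in uX'.
  have [|M [_ _ _ _ uniqM]] := model_existence smC d1 (uniformized_good d1 _ uY').
    by rewrite mulf_neq0 // expf_neq0.
  exact: mu_isomorphic_trans (uniqM X normX uX') (mu_isomorphic_sym (uniqM Y normY uY')).
have [phi [s [k_phi phi_inj range_phi s1 sd]]] := uX.
have [phi' [s' [k_phi' phi'_inj range_phi' s'1 s'd]]] := uY.
have th_inj := bij_inj bij_th.
have phi_zero c : homogeneous (mu_act X) 0 (phi c).
  have : range phi (phi c) by exists c.
  by rewrite range_phi => inv l; rewrite mod0n; apply: inv.
have zero_phi' y : homogeneous (mu_act Y) 0 y -> exists c, phi' c = y.
  move=> hy; suff : range phi' y by case=> c _ <-; exists c.
  by rewrite range_phi' => l; rewrite hy mod0n.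
have th_hom n x : homogeneous (mu_act X) n x -> homogeneous (mu_act Y) n (th x).
  by move=> hx l; rewrite -eq_th hx; case: ifP; rewrite ?rmorph0.
have [|psi psiE] := lift_rmorphism (g := th \o phi) phi'_inj.
  by move=> c; apply/zero_phi'/th_hom.
have psi_bij : bijective psi.
  apply: inj_surj_bijective => [a b /(congr1 phi')|c'].
    by rewrite !psiE => /th_inj/phi_inj.
  have [g [thK gK]] := rmorphism_inverse bij_th.
  have : range phi (g (phi' c')).
    rewrite range_phi => l; apply: th_inj; rewrite eq_th gK.
    have : range phi' (phi' c') by exists c'.
    by rewrite range_phi' => ->; case: ifP; rewrite ?gK ?rmorph0.
  by case=> c _ cE; exists c; apply: phi'_inj; rewrite psiE /= cE gK.
(* The ratio of [th s] to [s'] need not be regular; multiplied by [s' ^+ d], which is [r'], it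
   becomes this element of degree 0. *)
have [w wE] : exists w, phi' w = th s * s' ^+ d.-1.
  apply: zero_phi'; apply: homogeneous_mod (homogeneousM d0 (th_hom _ _ s1)
    (homogeneousX d0 d.-1 s'1)).
  by rewrite mul1n add1n prednK // modnn mod0n.
have E : psi r * r' ^+ d.-1 = w ^+ d.
  apply: phi'_inj; rewrite rmorphM psiE /= -sd !rmorphXn wE exprMn -s'd.
  by rewrite -!exprM mulnC.
have psir0 : psi r != 0 by apply: rmorph_neq0 r0; apply: bij_inj.
have r'F : tofrac r' != 0 :> {fraction C} by rewrite tofrac_eq0.
exists psi, (tofrac w / tofrac r'); split=> //.
- by move=> c; apply: phi'_inj; rewrite psiE /= k_phi k_th k_phi'.
- rewrite mulf_neq0 ?invr_eq0 // tofrac_eq0; apply: contraTneq isT => w0.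
  move/eqP: E; rewrite w0 expr0n eqn0Ngt d0 mulf_eq0 (negPf psir0) /=.
  by rewrite expf_eq0 (negPf r'0) andbF.
- rewrite expr_div_n -tofracXn -E tofracM tofracXn -[in RHS](prednK d0) exprSr.
  by rewrite invfM -!mulrA mulVf // mulr1 /= divff ?mulr1 // expf_neq0.
Qed.

End Isomorphisms.

(** * Phi-pairs *)

Section Monomials.
Variable R : idomainType.
Notation F := {fraction R}.

Lemma tofracX_neq0 : tofrac 'X != 0 :> {fraction {poly F}}.
Proof. by rewrite tofrac_eq0 polyX_eq0. Qed.

Lemma monomialE (h : F) m :
  monomial h m = tofrac h%:P * tofrac 'X ^ m :> {fraction {poly F}}.
Proof. by []. Qed.

Lemma monomialX (h : F) m (e : nat) : monomial h m ^+ e = monomial (h ^+ e) (m * e%:Z).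
Proof. by rewrite !monomialE exprMn -tofracXn -rmorphXn -exprz_exp. Qed.

Lemma monomialM (h1 h2 : F) m1 m2 :
  monomial h1 m1 * monomial h2 m2 = monomial (h1 * h2) (m1 + m2).
Proof.
rewrite !monomialE polyCM tofracM (expfzDr _ _ tofracX_neq0).
exact: mulrACA.
Qed.

Lemma monomial1 : monomial (1 : F) 0 = 1.
Proof. by rewrite monomialE expr0z mulr1 tofrac1. Qed.

(** Multiplication by a power of ['X] turns the identity into one between polynomials, whose
    coefficients can be compared. A degree may occur several times in [s], hence the sum. *)
Lemma monomial_coef (s : seq int) (h : int -> F) a n :
  \sum_(m <- s) monomial (h m) m = monomial a n -> \sum_(m <- s | m == n) h m = a.
Proof.
move=> E; have [N NP] : exists N : nat, forall m, m \in n :: s -> 0 <= N%:Z + m.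
  elim: (n :: s) => [|m t [N NP]]; first by exists 0%N.
  exists (N + `|m|)%N => m'; rewrite inE PoszD => /predU1P[->|/NP Nm'].
    by rewrite -addrA addr_ge0 //; case: (m) => l; rewrite ?NegzE ?abszN ?addNr ?subrr.
  by rewrite addrAC addr_ge0.
have shift (b : F) m : m \in n :: s ->
    monomial b m * tofrac 'X ^+ N = tofrac (b%:P * 'X^(`|N%:Z + m|)).
  move=> ms; have XE : tofrac 'X ^ m * tofrac 'X ^+ N =
      tofrac 'X ^+ `|N%:Z + m| :> {fraction {poly F}}.
    rewrite !exprnP -expfzDr ?tofracX_neq0 //.
    by rewrite addrC gez0_abs ?NP.
  by rewrite monomialE tofracM tofracXn -mulrA XE.
have := congr1 (fun x => x * tofrac 'X ^+ N) E.
rewrite /= (shift a n) ?mem_head // mulr_suml big_seq.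
under eq_bigr => m ms do rewrite shift ?inE ?ms ?orbT //.
rewrite -big_seq -rmorph_sum => /tofrac_inj/(congr1 (fun p : {poly F} => p`_(`|N%:Z + n|))).
rewrite /= coef_sum coefCM coefXn eqxx mulr1 => <-.
rewrite big_mkcond big_seq [RHS]big_seq; apply: eq_bigr => m ms.
rewrite coefCM coefXn eq_sym; have mP : 0 <= N%:Z + m by rewrite NP // inE ms orbT.
rewrite -eqz_nat !gez0_abs //; last by rewrite NP ?mem_head.
by rewrite (inj_eq (addrI _)); case: eqP; rewrite ?mulr1 ?mulr0.
Qed.

Lemma monomial_inj (a b : F) m n : a != 0 -> monomial a m = monomial b n -> m = n /\ a = b.
Proof.
move=> a0 E; have := @monomial_coef [:: m] (fun=> a) b n.
rewrite big_seq1 => /(_ E); rewrite big_mkcond big_seq1.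
case: eqP => [->//|_ b0]; have := @monomial_coef [:: n] (fun=> b) a m.
rewrite big_seq1 => /(_ (esym E)); rewrite big_mkcond big_seq1 -b0 if_same => a0'.
by rewrite -a0' eqxx in a0.
Qed.

End Monomials.

Lemma interval_eq (I J : interval_Q) : lower I = lower J -> upper I = upper J -> I = J.
Proof.
case: I J => [a b ab] [a' b' ab'] /= ea eb; move: ab ab'; rewrite ea eb => ab ab'.
by rewrite (bool_irrelevance ab ab').
Qed.

Lemma power_ratio (E : fieldType) (d : nat) (c r c' r' f : E) :
  c != 0 -> r != 0 -> c' != 0 -> r' != 0 ->
  c ^+ d / r / (c' ^+ d / r') = f ^+ d <-> r' = (f * c' / c) ^+ d * r.
Proof.
move=> c0 r0 c'0 r'0; rewrite expr_div_n exprMn.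
have [cd0 c'd0] := (expf_neq0 d c0, expf_neq0 d c'0).
split=> [<-|E1]; first by field; rewrite cd0 r0 c'd0 r'0.
by rewrite invfM invrK [in LHS]E1; field; rewrite cd0 r0 c'd0.
Qed.

Section PhiPairs.
Variables (k : fieldType) (C : affine_scheme k) (d : nat).
Hypotheses (smC : smooth_curve C) (d_gt1 : (1 < d)%N).
Let d_gt0 : (0 < d)%N := ltnW d_gt1.
Let dQ0 : d%:R != 0 :> rat.
Proof. by rewrite pnatr_eq0 -lt0n. Qed.
Let regC := smooth_curve_regular smC.
Notation F := {fraction C}.

Definition root_divisor (alpha : F) : polyhedral_divisor C :=
  fun y => IntervalQ (lexx ((- ord y alpha)%:~R / d%:R : rat)).

(** The list that presents the inverse may repeat the degree [- d]; the coefficient there is then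
    [h] added as often as this degree occurs, which is the origin of [n]. *)
Lemma unit_inverse (D : polyhedral_divisor C) (alpha : F) :
  unit_of_algebra D (monomial alpha d%:Z) ->
  alpha != 0 /\ exists h (n : nat), H0 D (- d%:Z) h /\ alpha^-1 = h *+ n.
Proof.
move=> [_ [x' [s [h [H0h ->]]]] E].
have a0 : alpha != 0.
  apply/eqP => a0; move/eqP: E.
  by rewrite a0 /monomial polyC0 tofrac0 !mul0r eq_sym oner_eq0.
split=> //; have {}E : \sum_(m <- s) monomial (h m) m = monomial alpha^-1 (- d%:Z).
  have aa : monomial alpha^-1 (- d%:Z) * monomial alpha d%:Z = 1.
    by rewrite monomialM mulVf // addNr monomial1.
  by rewrite -[LHS]mul1r -aa -mulrA E mulr1.
have := monomial_coef E; rewrite (eq_bigr (fun=> h (- d%:Z))); last by move=> m /eqP ->.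
by rewrite big_const_seq iter_addr_0 => <-; exists (h (- d%:Z)), (count (pred1 (- d%:Z)) s).
Qed.

(* [alpha] bounds [d * lower] below by [- ord alpha], and its inverse bounds
   [d * upper] above by the same value. *)
Lemma pair_divisorE (P : Phi_pair d C) (y : set C) : maximal_ideal y ->
  pair_divisor P y = root_divisor (pair_unit P) y.
Proof.
move=> maxy; have [H0a /unit_inverse[a0 [h [n [H0h aE]]]]] := pair_unitP P.
have yP := maximal_prime maxy; have regy := regC maxy.
move: a0 aE H0a; set a := pair_unit P => a0 aE H0a.
have h0 : h != 0 by apply: contraNneq a0 => h0; rewrite -invr_eq0 aE h0 mul0rn.
have n0 : (n%:R : C) != 0.
  apply: contraNneq a0 => n0; rewrite -invr_eq0 aE -mulr_natr.
  by rewrite -(rmorph_nat (@FracField.tofrac C)) n0 rmorph0 mulr0.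
have aV : - ord y a = ord y h + ord y (tofrac (n%:R : C)).
  have -> : - ord y a = ord y (h * tofrac (n%:R : C)).
    by rewrite -(ordV yP regy a0) aE rmorph_nat mulr_natr.
  by rewrite (ordM yP regy) // tofrac_eq0.
have n_ge0 : 0 <= ord y (tofrac (n%:R : C)).
  by apply/(ord_ge0 yP regy); [rewrite tofrac_eq0|apply: local_ring_tofrac].
case: H0a => [/eqP|/(_ y maxy)]; first by rewrite (negPf a0).
case: H0h => [/eqP|/(_ y maxy)]; first by rewrite (negPf h0).
rewrite /ppeval /interval_min; have := lower_upper (pair_divisor P y).
set l := lower _; set u := upper _ => lu.
have dl : d%:R * l <= d%:R * u by rewrite ler_wpM2l ?ler0n.
rewrite !rmorphN /= !mulNr -!pmulrn (min_l dl) (min_r (y := - _)) ?lerN2 // => h1 h2.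
have le1 : d%:R * u <= (- ord y a)%:~R.
  have : - ord y h <= Num.floor (- (d%:R * u)) by rewrite -subr_ge0 opprK addrC.
  rewrite Num.Theory.floor_ge_int rmorphN lerN2 => /le_trans; apply.
  by rewrite ler_int aV lerDl.
have le2 : (- ord y a)%:~R <= d%:R * l :> rat.
  by rewrite -Num.Theory.floor_ge_int -subr_ge0 opprK addrC.
have lE : d%:R * l = (- ord y a)%:~R by apply/eqP; rewrite eq_le le2 andbT (le_trans dl).
have uE : d%:R * u = (- ord y a)%:~R.
  by apply/eqP; rewrite eq_le le1 (le_trans le2).
by apply: interval_eq; rewrite /= -/l -/u; apply: (mulfI dQ0); rewrite mulrCA divff // mulr1.
Qed.

Lemma interval_min_point (m : int) (I : interval_Q) :
  lower I = upper I -> interval_min m I = m%:~R * lower I.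
Proof. by rewrite /interval_min => ->; rewrite minxx. Qed.

Lemma root_divisor_unit (alpha : F) : alpha != 0 ->
  homogeneous_unit (root_divisor alpha) d%:Z alpha /\
  homogeneous_unit (root_divisor alpha) (- d%:Z) alpha^-1.
Proof.
move=> a0; have Hd : H0 (root_divisor alpha) d%:Z alpha.
  right=> y maxy; rewrite /ppeval interval_min_point //= mulrCA divff // mulr1.
  by rewrite intrKfloor addrN.
have HNd : H0 (root_divisor alpha) (- d%:Z) alpha^-1.
  right=> y maxy; rewrite /ppeval interval_min_point //= rmorphN mulNr mulrCA divff // mulr1.
  rewrite -rmorphN intrKfloor opprK (ordV (maximal_prime maxy) (regC maxy)) //.
  by rewrite addNr.
have alg m h : H0 (root_divisor alpha) m h ->
    algebra_of (root_divisor alpha) (monomial h m).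
  move=> Hm; exists [:: m], (fun l => if l == m then h else 0); rewrite big_seq1 eqxx.
  by split=> // l; case: eqP => [->//|_]; left.
have inv : monomial alpha d%:Z * monomial alpha^-1 (- d%:Z) = 1.
  by rewrite monomialM mulfV // subrr monomial1.
split; split=> //; split; try exact: alg.
  by exists (monomial alpha^-1 (- d%:Z)) => //; apply: alg.
by exists (monomial alpha d%:Z); [apply: alg|rewrite mulrC].
Qed.

Lemma root_ppdivisor (r : C) : r != 0 -> ppdivisor (root_divisor (tofrac r)^-1).
Proof.
move=> r0; have [[ftC _ dimC] _] := smC.
have noeC := finite_type_noetherian ftC.
have rF : tofrac r != 0 :> F by rewrite tofrac_eq0.
have dim1 P : prime_ideal P -> (exists2 a : C, a != 0 & P a) -> maximal_ideal P.
  move=> PP nz; have [idP P1 _] := PP.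
  have [y [maxy Py]] := maximal_ideal_exists idP P1.
  by have [_ /(_ P PP Py nz) ->] := krull_dim1_maximal dimC maxy.
apply: sub_finite_set (finite_maximal_ideals (Nz := [set a | a != 0]) noeC dim1 r0).
move=> y [maxy nz]; split=> //; apply: contrapT => yr; apply: nz.
rewrite /= (ordV (maximal_prime maxy) (regC maxy)) // (ord_notin (maximal_prime maxy)) //.
by rewrite oppr0 rmorph0 mul0r.
exact: regC.
Qed.

(** With [m * e = d], an [e]-th root [h] of [r] over a base change would give the [e]-th root
    [c ^+ m / h] of the unit, homogeneous of degree [m]. *)
Lemma geometrically_integral_good (P : Phi_pair d C) :
  geometrically_integral_pair d (pair_divisor P) (pair_unit P) ->
  exists r c : C, [/\ good_radicand d r, c != 0 &
    pair_unit P = tofrac c ^+ d / tofrac r].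
Proof.
move=> giP; have [_ /unit_inverse[a0 _]] := pair_unitP P.
have [c [b [b0 aE]]] := fracP (pair_unit P).
have c0 : c != 0 by apply: contraNneq a0 => c0; rewrite aE c0 tofrac0 mul0r.
(* The unit [c / b] is also [c ^+ d / (b * c ^+ d.-1)]: a radicand has to lie in [C], and only its
   class modulo [d]-th powers matters. *)
pose r := b * c ^+ d.-1; have r0 : r != 0 by rewrite mulf_neq0 // expf_neq0.
have cF : tofrac c != 0 :> F by rewrite tofrac_eq0.
have aE' : pair_unit P = tofrac c ^+ d / tofrac r.
  rewrite aE tofracM tofracXn -[in RHS](prednK d_gt0) exprS invfM mulrCA -mulrA.
  by rewrite [_ ^+ _ / _]divff ?mulr1 1?mulrC // expf_neq0.
exists r, c; split=> //; split=> // K i alg B j jK tens e h e2 ed E.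
have j_inj : injective j := tensor_inl_inj tens.
have regB := smooth_curve_base_change_regular smC alg tens.
have [Phi [PhiE PhiF]] := frac_map_morphism j_inj.
pose m := (d %/ e)%N; have me : (m * e)%N = d by rewrite divnK.
have e0 : (0 < e)%N := ltnW e2.
pose g := tofrac (j c) ^+ m / h.
have gE : g ^+ e = frac_map j (pair_unit P).
  by rewrite expr_div_n -exprM me E -PhiE aE' fmorph_div rmorphXn !PhiF.
have g0 : g != 0.
  apply/eqP => g0; move/eqP: gE; rewrite g0 expr0n eqn0Ngt e0 -PhiE eq_sym.
  by rewrite fmorph_eq0 (negPf a0).
apply: (giP K i alg B j jK tens); exists e, m%:Z, g; split=> //; last first.
  by rewrite monomialX gE -PoszM me.
(* The order of the unit upstairs is [e * ord z g], so the coefficient at [z] of the pulled back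
   divisor in degree [m] is exactly [- ord z g]. *)
right=> z maxz; have zP := maximal_prime maxz; have regz := regB z maxz.
have maxy := integral_preimage_maximal (tensor_integral tens alg) maxz.
have E1 : (ramification j z)%:Z * ord (j @^-1` z) (pair_unit P) = e%:Z * ord z g.
  by rewrite -(ord_frac_map j_inj zP (regC maxy) regz) // -gE (ordX zP regz).
rewrite /ppeval interval_min_point /= (pair_divisorE P maxy) //=.
have -> : m%:~R * ((ramification j z)%:R *
    ((- ord (j @^-1` z) (pair_unit P))%:~R / d%:R)) = (- ord z g)%:~R :> rat.
  have eQ : e%:R != 0 :> rat by rewrite pnatr_eq0 -lt0n.
  have mQ : m%:R != 0 :> rat.
    by apply: contraNneq dQ0 => m0; rewrite -me natrM m0 mul0r.
  have {}E1 : (ramification j z)%:R * (ord (j @^-1` z) (pair_unit P))%:~R =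
      e%:R * (ord z g)%:~R :> rat by rewrite !pmulrn -!rmorphM E1.
  rewrite -[in d%:R]me natrM !rmorphN /= -pmulrn mulNr !mulrN; congr (- _).
  rewrite (_ : (ord z g)%:~R = (ramification j z)%:R *
    (ord (j @^-1` z) (pair_unit P))%:~R / e%:R); last by rewrite E1 mulrAC divff ?mul1r.
  by field; rewrite eQ.
by rewrite intrKfloor addrN.
Qed.

Lemma good_pair (r : C) : good_radicand d r -> exists P : Phi_pair d C,
  geometrically_integral_pair d (pair_divisor P) (pair_unit P) /\
  pair_unit P = (tofrac r)^-1.
Proof.
move=> good; have [r0 no_root] := good.
have a0 : (tofrac r)^-1 != 0 :> F by rewrite invr_eq0 tofrac_eq0.
have [u1 u2] := root_divisor_unit a0.
have G : G_ppdivisor d (root_divisor (tofrac r)^-1).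
  by split; [exact: root_ppdivisor|exists (tofrac r)^-1|exists (tofrac r)^-1^-1].
exists (PhiPair G u1); split=> //= K i alg B j jK tens [e [m [h [e2 _ E]]]].
have [Phi [PhiE PhiF]] := frac_map_morphism (tensor_inl_inj tens).
have [|dE aE] := monomial_inj _ (etrans E (monomialX h m e)).
  by rewrite -PhiE fmorph_eq0.
have ed : (e %| d)%N.
  by move/(congr1 absz): dE; rewrite abszM /= => ->; apply: dvdn_mull.
apply: (no_root K i alg B j jK tens e h^-1 e2 ed).
by rewrite exprVn -aE -PhiE fmorphV invrK PhiF.
Qed.

(** The condition on divisors follows from that on units, since [pair_divisorE] expresses each
    divisor through its unit; the plurifunction [1 (x) f] then suffices. The radicands come in
    reverse order because [psi] pulls back the second pair. *)
Lemma Phi_isomorphicP (P P' : Phi_pair d C) (r r' c c' : C) :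
    r != 0 -> r' != 0 -> c != 0 -> c' != 0 ->
    pair_unit P = tofrac c ^+ d / tofrac r ->
    pair_unit P' = tofrac c' ^+ d / tofrac r' ->
  Phi_isomorphic P P' <-> equivalent_radicands d r' r.
Proof.
move=> r0 r'0 c0 c'0 aE a'E.
have toF (a : C) (a0 : a != 0) : tofrac a != 0 :> F by rewrite tofrac_eq0.
have [rF cF] := (toF r r0, toF c c0).
split=> [[psi [G [[k_psi bij_psi _] [f [f0 E1 E2]]]]]|[psi [c1 [k_psi bij_psi c10 E]]]].
  have psi_inj := bij_inj bij_psi.
  have [Phi [PhiE PhiF]] := frac_map_morphism psi_inj.
  have pc' := toF _ (rmorph_neq0 psi_inj c'0).
  have pr' := toF _ (rmorph_neq0 psi_inj r'0).
  exists psi, (f * tofrac (psi c') / tofrac c); split; [exact: k_psi|exact: bij_psi| |].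
    exact: mulf_neq0 (mulf_neq0 f0 pc') (invr_neq0 cF).
  apply/(power_ratio _ _ cF rF pc' pr').
  by rewrite -E2 -E1 -PhiE aE a'E fmorph_div rmorphXn !PhiF.
have psi_inj := bij_inj bij_psi.
have [Phi [PhiE PhiF]] := frac_map_morphism psi_inj.
have pc' := toF _ (rmorph_neq0 psi_inj c'0).
have pr' := toF _ (rmorph_neq0 psi_inj r'0).
have [r'F c'F] := (toF r' r'0, toF c' c'0).
pose f := c1 * tofrac c / tofrac (psi c').
have f0 : f != 0 := mulf_neq0 (mulf_neq0 c10 cF) (invr_neq0 pc').
have a0 : pair_unit P != 0.
  by rewrite aE; exact: mulf_neq0 (expf_neq0 d cF) (invr_neq0 rF).
have a'0 : pair_unit P' != 0.
  by rewrite a'E; exact: mulf_neq0 (expf_neq0 d c'F) (invr_neq0 r'F).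
have fE : pair_unit P / frac_map psi (pair_unit P') = f ^+ d.
  rewrite -PhiE aE a'E fmorph_div rmorphXn !PhiF.
  by apply/(power_ratio _ _ cF rF pc' pr'); rewrite E /f (divfK pc') (mulfK cF).
pose G : plurifunction C := [:: (1, exist _ f f0)].
have GE : pluri_eval G d%:Z = f ^+ d by rewrite /pluri_eval big_seq1 /= mul1r.
exists psi, G; split; last by exists f; rewrite fE GE.
split=> // y maxy; have yP := maximal_prime maxy; have regy := regC maxy.
have int_psi : integralRange psi.
  by have [g _ gK] := bij_psi; move=> x; rewrite -[x]gK; apply: integral_id.
have maxx := integral_preimage_maximal int_psi maxy.
rewrite /pullback (pair_divisorE P' maxx) (pair_divisorE P maxy).
have ordE : (ramification psi y)%:Z * ord (psi @^-1` y) (pair_unit P') =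
    ord y (pair_unit P) - d%:Z * ord y f.
  rewrite -(ord_frac_map psi_inj yP (regC maxx) regy) // -(ordX yP regy) // -fE.
  have p0 : frac_map psi (pair_unit P') != 0 by rewrite -PhiE fmorph_eq0.
  by rewrite (ordM yP regy) ?invr_eq0 // (ordV yP regy) //; ring.
have valE : (ramification psi y)%:R * ((- ord (psi @^-1` y) (pair_unit P'))%:~R / d%:R) =
    (- ord y (pair_unit P))%:~R / d%:R + (pluri_ord G y)%:~R :> rat.
  rewrite /pluri_ord big_seq1 /= mul1r mulrA !pmulrn -rmorphM mulrN ordE.
  by rewrite !rmorphN !rmorphB rmorphM /= -pmulrn; field; rewrite dQ0.
exact: interval_eq.
Qed.

End PhiPairs.

(** * Bijections between sets of isomorphism classes *)

Definition iso_class_of (T : Type) (P : T -> Prop) (iso : T -> T -> Prop) x (Px : P x) :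
  iso_classes P iso :=
  exist (fun c => exists2 x, P x & c = (fun x' => P x' /\ iso x x'))
    (fun x' => P x' /\ iso x x') (ex_intro2 _ _ x Px erefl).

(** Only [iso1] is assumed to be an equivalence: [Rel] carries the three laws over to [iso2] on
    [P2], so isomorphisms of pairs never have to be composed or inverted. *)
Lemma iso_classes_bijection (T1 T2 : Type) (P1 : T1 -> Prop) (P2 : T2 -> Prop)
    (iso1 : T1 -> T1 -> Prop) (iso2 : T2 -> T2 -> Prop) (Rel : T1 -> T2 -> Prop) :
    (forall x, P1 x -> exists2 y, P2 y & Rel x y) ->
    (forall y, P2 y -> exists2 x, P1 x & Rel x y) ->
    (forall x x' y y', P1 x -> P1 x' -> P2 y -> P2 y' -> Rel x y -> Rel x' y' ->
       iso1 x x' <-> iso2 y y') ->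
    (forall x, iso1 x x) -> (forall x x', iso1 x x' -> iso1 x' x) ->
    (forall x x' x'', iso1 x x' -> iso1 x' x'' -> iso1 x x'') ->
  exists f : iso_classes P1 iso1 -> iso_classes P2 iso2, bijective f.
Proof.
move=> R12 R21 Riso refl1 sym1 trans1.
have refl2 y : P2 y -> iso2 y y.
  by move=> Py; have [x Px xy] := R21 y Py; apply/(Riso x x).
have sym2 y y' : P2 y -> P2 y' -> iso2 y y' -> iso2 y' y.
  move=> Py Py'; have [x Px xy] := R21 y Py; have [x' Px' xy'] := R21 y' Py'.
  by move=> /(Riso x x' y y' Px Px' Py Py' xy xy')/sym1/(Riso x' x y' y); apply.
have trans2 y y' y'' : P2 y -> P2 y' -> P2 y'' -> iso2 y y' -> iso2 y' y'' -> iso2 y y''.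
  move=> Py Py' Py''; have [x Px xy] := R21 y Py.
  have [x' Px' xy'] := R21 y' Py'; have [x'' Px'' xy''] := R21 y'' Py''.
  move=> /(Riso x x' y y' Px Px' Py Py' xy xy') i1.
  move=> /(Riso x' x'' y' y'' Px' Px'' Py' Py'' xy' xy'') i2.
  by apply/(Riso x x'' y y'' Px Px'' Py Py'' xy xy''); exact: (trans1 x x' x'').
have class_eq2 y y' : P2 y -> P2 y' -> iso2 y y' ->
    (fun z => P2 z /\ iso2 y z) = (fun z => P2 z /\ iso2 y' z).
  move=> Py Py' yy'; apply: funext => z; apply: propext.
  split=> -[Pz h]; split=> //; last exact: (trans2 y y' z).
  by apply: (trans2 _ y) => //; apply: sym2.
have class_eq1 x x' : iso1 x x' ->
    (fun z => P1 z /\ iso1 x z) = (fun z => P1 z /\ iso1 x' z).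
  move=> xx'; apply: funext => z; apply: propext.
  split=> -[Pz h]; split=> //; last exact: (trans1 x x' z).
  by apply: (trans1 _ x) => //; apply: sym1.
have image (c : iso_classes P1 iso1) : exists c' : iso_classes P2 iso2,
    exists x y, [/\ P1 x, P2 y, Rel x y, sval c = (fun z => P1 z /\ iso1 x z) &
      sval c' = (fun z => P2 z /\ iso2 y z)].
  case: c => c [x Px cE]; have [y Py xy] := R12 x Px.
  by exists (iso_class_of iso2 Py), x, y.
exists (fun c => projT1 (cid (image c))).
apply: inj_surj_bijective => [c1 c2|[c' c'P]].
  case: cid => c1' [x1 [y1 [P1x P1y r1 c1E c1'E]]] /=.
  case: cid => c2' [x2 [y2 [P2x P2y r2 c2E c2'E]]] /= c12.
  have y12 : iso2 y2 y1.
    have : sval c2' y1 by rewrite -c12 c1'E; split=> //; apply: refl2.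
    by rewrite c2'E => -[].
  have x12 : iso1 x1 x2 by apply/sym1/(Riso x2 x1 y2 y1).
  case: c1 c2 c1E c2E {c1' c2' c1'E c2'E c12} => [c1 c1P] [c2 c2P] /= c1E c2E.
  by apply: eq_exist; rewrite c1E c2E (class_eq1 _ _ x12).
have [y Py c'E] := c'P; have [x Px xy] := R21 y Py.
exists (iso_class_of iso1 Px); case: cid => c1 [x1 [y1 [P1x P1y r1 /= cE c1E]]] /=.
case: c1 c1E => c1 c1P /= c1E; apply: eq_exist; rewrite c1E c'E.
apply: class_eq2 => //; apply/(Riso x1 x) => //.
have : P1 x1 /\ iso1 x x1.
  by have /= -> := congr1 (fun c : T1 -> Prop => c x1) cE; split.
by case=> _; apply: sym1.
Qed.

Local Close Scope ring_scope.

Theorem theorem4p12 (p : nat) (k : fieldType) (C0 : affine_scheme k) (d : nat)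
    (hk : perfect_field p k) (hC0 : smooth_curve C0) (hd : 2 <= d) :
  exists f : E_aff d C0 -> S_aff d C0, bijective f.
Proof.
(* The factor [c ^+ d] lets the unit be an arbitrary fraction, not only the inverse of an element of
   the ring. *)
pose Rel (X : mu_curve d k) (P : Phi_pair d C0) := exists r c : C0,
  [/\ good_radicand d r, c != 0%R, uniformized X r &
      pair_unit P = (tofrac c ^+ d / tofrac r)%R].
apply: (iso_classes_bijection (Rel := Rel)).
- move=> X [faithX _ quotX].
  have [r r0 uX] := faithful_uniformized hd faithX quotX.
  have good := uniformized_good hd r0 uX.
  have [P [giP PE]] := good_pair hC0 hd good.
  exists P => //; exists r, 1%R; split=> //; first exact: oner_neq0.
  by rewrite PE tofrac1 expr1n div1r.
- move=> P /(geometrically_integral_good hC0 hd)[r [c [good c0 PE]]].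
  have [M [faithM normM quotM uM _]] := model_existence hC0 hd good.
  by exists M => //; exists r, c.
- move=> X X' P P' [_ normX _] [_ normX' _] _ _ [r [c [good c0 uX PE]]].
  move=> [r' [c' [good' c'0 uX' PE']]].
  have [[r0 _] [r'0 _]] := (good, good').
  (* [Phi_isomorphicP] exchanges the radicands; the curves are therefore compared from [X'] to [X],
     and symmetry restores the order. *)
  have isoP := Phi_isomorphicP hC0 hd r0 r'0 c0 c'0 PE PE'.
  have isoX := uniformized_isomorphic hC0 hd r'0 r0 normX' normX uX' uX.
  by split=> [/mu_isomorphic_sym/isoX/isoP|/isoP/isoX/mu_isomorphic_sym].
- exact: mu_isomorphic_refl.
- exact: mu_isomorphic_sym.
- exact: mu_isomorphic_trans.
Qed.
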